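(* For every dimension $d\ge 1$ there exist constants $c, C\in(0,\infty)$ depending only on $d$ such that for every non-negative locally finite measure $\nu$ on $\mathbb{R}^d$, $$c\cdot \inf_v \widetilde{\mathrm{Ra}}(v)\;\le\; \mathrm{Tra}(\nu)\;\le\; C\cdot \inf_v \mathrm{Ra}(v),$$ where both infima are taken over all locally integrable vector fields $v$ on $\mathbb{R}^d$ connecting the measures $\nu$ and $m_d$. (All three quantities take values in $[0,\infty]$.)
   Context: $m_d$ is the $d$-dimensional Lebesgue measure on $\mathbb{R}^d$, $|\cdot|$ is the Euclidean norm. A measure is locally finite if it is a Borel measure finite on bounded sets. Transportation distance: for non-negative locally finite measures $\nu_1,\nu_2$ on $\mathbb{R}^d$, a transportation from $\nu_1$ to $\nu_2$ is a non-negative locally finite measure $\gamma$ on $\mathbb{R}^d\times\mathbb{R}^d$ with marginals $\nu_1$ and $\nu_2$, i.e. $\iint \varphi(x)\,d\gamma(x,y)=\int\varphi\,d\nu_1$ and $\iint \varphi(y)\,d\gamma(x,y)=\int\varphi\,d\nu_2$ for all continuous compactly supported $\varphi:\mathbb{R}^d\to\mathbb{R}$. Set $$\mathrm{Tra}(\nu_1,\nu_2)=\inf_\gamma \sup\{|x-y| : (x,y)\in\operatorname{spt}(\gamma)\}\in[0,\infty],$$ the infimum being over all transportations $\gamma$ from $\nu_1$ to $\nu_2$ (it is $+\infty$ if there are none), where $\operatorname{spt}$ is the closed support. Set $\mathrm{Tra}(\nu)=\mathrm{Tra}(\nu,m_d)$. Connecting vector fields: a locally integrable vector field $v:\mathbb{R}^d\to\mathbb{R}^d$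 connects $\nu$ and $m_d$ if $\operatorname{div} v=\nu-m_d$ weakly, i.e. for all smooth compactly supported $\varphi:\mathbb{R}^d\to\mathbb{R}$, $$\int_{\mathbb{R}^d}\langle v(x),\nabla\varphi(x)\rangle\,dm_d(x)=-\int_{\mathbb{R}^d}\varphi\,d(\nu-m_d).$$ Size of a field: let $r\mathbb{B}$ be the ball of radius $r$ centered at $0$ in $\mathbb{R}^d$ and $\chi_r=\frac{1}{m_d(r\mathbb{B})}\mathbf{1}_{r\mathbb{B}}$. For a locally integrable vector field $v$, $$\mathrm{Ra}(v)=\inf_{r>0}\{r+\|v*\chi_r\|_\infty\},\qquad \widetilde{\mathrm{Ra}}(v)=\inf_{r>0}\{r+\|\,|v|*\chi_r\|_\infty\},$$ where $*$ is convolution (componentwise for the vector field $v$), $\|\cdot\|_\infty$ is the supremum norm (of the Euclidean length, for vector fields), possibly $+\infty$. *)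

(* Defs.v *)
From HB Require Import structures.
From mathcomp Require Import all_boot all_order all_algebra.
From mathcomp Require Import lra.
From mathcomp Require Import all_classical all_reals all_analysis.
From mathcomp Require Import measurable_realfun.
Set Implicit Arguments.
Unset Strict Implicit.
Unset Printing Implicit Defensive.
Import Order.TTheory GRing.Theory Num.Theory.
Import numFieldNormedType.Exports.

Local Open Scope classical_set_scope.
Local Open Scope ring_scope.

Section borel_rV.
Variables (R : realType) (n : nat).

Let rV_measurable := <<s @open 'rV[R]_n >>.

Let rV_measurable0 : rV_measurable set0.
Proof. exact: sigma_algebra0. Qed.

Let rV_measurableC A : rV_measurable A -> rV_measurable (~` A).
Proof. exact: sigma_algebraC. Qed.

Let rV_measurable_bigcup (F : (set 'rV[R]_n)^nat) :
  (forall i, rV_measurable (F i)) -> rV_measurable (\bigcup_i F i).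
Proof. exact: sigma_algebra_bigcup. Qed.

HB.instance Definition _ := @isMeasurable.Build (sigma_display (@open 'rV[R]_n))
  'rV[R]_n rV_measurable rV_measurable0 rV_measurableC rV_measurable_bigcup.

Lemma open_measurable_rV (U : set 'rV[R]_n) : open U -> measurable U.
Proof. exact: sub_sigma_algebra. Qed.

End borel_rV.

Section dense_balls.
Variables (R : realType).

Lemma open_bigcup_ball (T : pseudoMetricType R) (I : Type) (c : I -> T) :
  (forall x e, 0 < e -> exists i, ball x e (c i)) ->
  forall U : set T, open U ->
  U = \bigcup_(k in [set k : I * nat | ball (c k.1) k.2.+1%:R^-1 `<=` U])
        ball (c k.1) k.2.+1%:R^-1.
Proof.
move=> cdense U oU; apply/seteqP; split => [x Ux|x [k /= kU] /kU//].
have /nbhs_ballP[_ /posnumP[e] eU] : nbhs x U by exact: open_nbhs_nbhs.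
have [//|N] := @ltr_add_invr R 0 (e%:num / 2) _.
rewrite add0r => Ne.
have [i xi] := cdense x N.+1%:R^-1 ltac:(by rewrite invr_gt0).
exists (i, N) => /=; last exact: ball_sym.
move=> y iy; apply: eU; rewrite [e%:num]splitr.
apply: le_ball (ltW (ltrD Ne Ne)) _ _.
exact: ball_triangle xi iy.
Qed.

Lemma dense_ratr (x e : R) : 0 < e -> exists q : rat, ball x e (ratr q).
Proof.
move=> e0; have [|q] := @rat_in_itvoo R (x - e) (x + e).
  by rewrite ltrBlDr -addrA ltrDl addr_gt0.
by rewrite in_itv/= => /andP[q1 q2]; exists q; rewrite /ball/= ltr_distl; lra.
Qed.

Lemma dense_rV_ratr n (x : 'rV[R]_n) (e : R) : 0 < e ->
  exists q : 'rV[rat]_n, ball x e (map_mx ratr q).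
Proof.
move=> e0.
have /choice[q xq] : forall i, exists q : rat, ball (x ord0 i) e (ratr q).
  by move=> i; exact: dense_ratr.
exists (\row_i q i); split => // i j; rewrite !mxE ord1.
exact: xq.
Qed.

End dense_balls.

Section lebesgue_rV.
Variable R : realType.

Lemma open_prod_measurable n (U : set (R * 'rV[R]_n)) : open U -> measurable U.
Proof.
move=> oU.
rewrite (open_bigcup_ball (c := fun q : rat * 'rV[rat]_n =>
  (ratr q.1, map_mx ratr q.2) : R * 'rV[R]_n) _ oU).
  rewrite bigcup_mkcond.
  apply: (@countable_bigcupT_measurable _ _ (rat * 'rV[rat]_n * nat)%type).
    exact: countableP.
  move=> k; case: ifPn => // _; apply: measurableX.
    exact: open_measurable (ball_open _ _).
  exact: open_measurable_rV (ball_open _ _).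
move=> x e e0; have [q xq] := dense_ratr x.1 e0.
have [w xw] := dense_rV_ratr x.2 e0.
by exists (q, w).
Qed.

Definition cons_rV n (p : R * 'rV[R]_n) : 'rV[R]_n.+1 :=
  \row_i oapp (p.2 ord0) p.1 (unlift ord0 i).

Definition uncons_rV n (v : 'rV[R]_n.+1) : R * 'rV[R]_n :=
  (v ord0 ord0, \row_i v ord0 (lift ord0 i)).

Lemma cons_rVK n : cancel (@cons_rV n) (@uncons_rV n).
Proof.
move=> [x v]; rewrite /uncons_rV mxE unlift_none/=; congr pair.
by apply/rowP => i; rewrite !mxE liftK.
Qed.

Lemma uncons_rVK n : cancel (@uncons_rV n) (@cons_rV n).
Proof.
move=> v; apply/rowP => i; rewrite !mxE.
by case: unliftP => [j ->|->]/=; rewrite ?mxE.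
Qed.

Lemma measurable_coord_rV n (i : 'I_n) :
  measurable_fun [set: 'rV[R]_n] (fun v : 'rV[R]_n => v ord0 i).
Proof.
apply: (measurability _ (RGenOpens.measurableE R)).
move=> _ [_ [a [b ->] <-]]; rewrite setTI; apply: open_measurable_rV.
by apply: open_comp (interval_open _ _) => // v _; exact: coord_continuous.
Qed.

Lemma measurable_cons_rV n : measurable_fun [set: R * 'rV[R]_n] (@cons_rV n).
Proof.
apply: (@measurability _ _ _ _ _ _ (@open 'rV[R]_n.+1)) => //.
move=> _ [U oU <-]; rewrite setTI; apply: open_prod_measurable.
apply: open_comp oU => p _; apply/cvg_ballP => e e0.
exists (ball p.1 e, ball p.2 e) => /=; first by split; exact: nbhsx_ballx.
move=> q [/= pq1 [_ pq2]]; split => // i j.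
by rewrite !mxE; case: unliftP => [k|] _ /=; [exact: pq2|exact: pq1].
Qed.

Lemma measurable_uncons_rV n : measurable_fun [set: 'rV[R]_n.+1] (@uncons_rV n).
Proof.
apply/measurable_fun_pairP; split.
  exact: measurable_coord_rV.
apply: (@measurability _ _ _ _ _ _ (@open 'rV[R]_n)) => //.
move=> _ [U oU <-]; rewrite setTI; apply: open_measurable_rV.
apply: open_comp oU => p _ A /nbhs_ballP[e e0 eA].
exists (fun i j => ball (p i j) e) => /=; first by move=> i j; exact: nbhsx_ballx.
by move=> q pq; apply: eA; split => // i j; rewrite !mxE; exact: pq.
Qed.

Section lebesgue_rV_step.
Variables (n : nat) (mu : {sigma_finite_measure set 'rV[R]_n -> \bar R}).

Definition lebesgue_rV_step : set 'rV[R]_n.+1 -> \bar R :=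
  pushforward (lebesgue_measure \x mu)%E (@cons_rV n).

HB.instance Definition _ := Measure.copy lebesgue_rV_step
  (measure_function_pushforward__canonical__measure_function_Measure
    (lebesgue_measure \x mu)%E (@measurable_cons_rV n)).

Let sigma_finite_step : sigma_finite setT lebesgue_rV_step.
Proof.
have /sigma_finiteP[F [TF ndF Foo]] := sigma_finiteT (@lebesgue_measure R).
have /sigma_finiteP[G [TG ndG Goo]] := sigma_finiteT mu.
exists (fun k => @uncons_rV n @^-1` (F k `*` G k)).
  rewrite -preimage_bigcup (_ : \bigcup_k _ = setT) ?preimage_setT//.
  apply/seteqP; split => // -[x y] _.
  have [i _ Fx] : (\bigcup_k F k) x by rewrite -TF.
  have [j _ Gy] : (\bigcup_k G k) y by rewrite -TG.
  exists (maxn i j) => //; split => /=.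
    by move: x Fx; exact/subsetPset/ndF/leq_maxl.
  by move: y Gy; exact/subsetPset/ndG/leq_maxr.
move=> k; have [mF Fk] := Foo k; have [mG Gk] := Goo k.
have mFG : measurable (F k `*` G k : set (R * 'rV[R]_n)) by exact: measurableX.
split; first by rewrite -[X in measurable X]setTI; exact: measurable_uncons_rV.
rewrite /lebesgue_rV_step /pushforward -comp_preimage.
rewrite (_ : _ \o _ = id) ?preimage_id; last by apply/funext => p /=; rewrite cons_rVK.
by rewrite product_measure1E// lte_mul_pinfty// ge0_fin_numE.
Qed.

HB.instance Definition _ := Measure_isSigmaFinite.Build _ _ _ lebesgue_rV_step
  sigma_finite_step.

End lebesgue_rV_step.

Fixpoint lebesgue_rV (n : nat) :
    {sigma_finite_measure set 'rV[R]_n -> \bar R} :=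
  if n is m.+1 return {sigma_finite_measure set 'rV[R]_n -> \bar R}
  then lebesgue_rV_step (lebesgue_rV m) else \d_(0 : 'rV[R]_0).

Lemma lebesgue_rVS n (A : set 'rV[R]_n.+1) : lebesgue_rV n.+1 A =
  (lebesgue_measure \x lebesgue_rV n)%E (@cons_rV n @^-1` A).
Proof. by []. Qed.

Lemma lebesgue_rV_box n (a b : 'rV[R]_n) :
  (forall i, a ord0 i <= b ord0 i) ->
  lebesgue_rV n [set v | forall i, v ord0 i \in `[a ord0 i, b ord0 i]] =
  (\prod_(i < n) (b ord0 i - a ord0 i))%:E.
Proof.
elim: n a b => [|n IH] a b ab.
  rewrite big_ord0 /= diracE mem_set// => i; by case: i.
rewrite lebesgue_rVS.
pose a' : 'rV[R]_n := \row_j a ord0 (lift ord0 j).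
pose b' : 'rV[R]_n := \row_j b ord0 (lift ord0 j).
pose B := [set v : 'rV[R]_n | forall i, v ord0 i \in `[a' ord0 i, b' ord0 i]].
have -> : @cons_rV n @^-1`
    [set v | forall i, v ord0 i \in `[a ord0 i, b ord0 i]] =
    `[a ord0 ord0, b ord0 ord0]%classic `*` B.
  apply/seteqP; split => [[x v] /= xv|[x v] /= [x0 vi] i].
    split => [|i]; first by have := xv ord0; rewrite mxE unlift_none.
    by have := xv (lift ord0 i); rewrite !mxE liftK.
  rewrite mxE; case: unliftP => [j ->|->] //=.
  by have := vi j; rewrite !mxE.
rewrite product_measure1E//; last first.
  rewrite /B (_ : [set v | _] = \bigcap_(i in [set: 'I_n])
    (fun v : 'rV[R]_n => v ord0 i) @^-1` `[a' ord0 i, b' ord0 i]%classic).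
    apply: fin_bigcap_measurable => // i _.
    rewrite -[X in measurable X]setTI.
    exact: measurable_coord_rV.
  by apply/seteqP; split => v /= H i; [move=> _|]; exact: H.
rewrite [X in (X * _)%E](_ : _ = (b ord0 ord0 - a ord0 ord0)%:E); last first.
  apply: etrans (lebesgue_measure_itv `[a ord0 ord0, b ord0 ord0]) _.
  rewrite /= lte_fin; case: ltP => // ba.
  by rewrite (@le_anti _ _ (a ord0 ord0) (b ord0 ord0)) ?subrr// ab ba.
rewrite IH; last by move=> i; rewrite !mxE.
rewrite -EFinM big_ord_recl; congr (_ * _)%:E.
by apply: eq_bigr => i _; rewrite !mxE.
Qed.

End lebesgue_rV.

Lemma measurable_prod_rVE (R : realType) (m n : nat) :
  @measurable _ ('rV[R]_m * 'rV[R]_n)%type = <<s @open ('rV[R]_m * 'rV[R]_n)%type >>.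
Proof.
apply/seteqP; split; last first.
  apply: smallest_sub; first exact: sigma_algebra_measurable.
  move=> U oU.
  rewrite (open_bigcup_ball (c := fun q : 'rV[rat]_m * 'rV[rat]_n =>
    (map_mx ratr q.1, map_mx ratr q.2) : 'rV[R]_m * 'rV[R]_n) _ oU).
    rewrite bigcup_mkcond.
    apply: (@countable_bigcupT_measurable _ _ ('rV[rat]_m * 'rV[rat]_n * nat)%type).
      exact: countableP.
    move=> k; case: ifPn => // _; apply: measurableX;
      exact: open_measurable_rV (ball_open _ _).
  move=> x e e0; have [q xq] := dense_rV_ratr x.1 e0.
  have [w xw] := dense_rV_ratr x.2 e0.
  by exists (q, w).
apply: smallest_sub; first exact: smallest_sigma_algebra.
pose T := g_sigma_algebraType (@open ('rV[R]_m * 'rV[R]_n)%type).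
have sub k (f : T -> 'rV[R]_k) :
    (forall U, open U -> @open ('rV[R]_m * 'rV[R]_n)%type (f @^-1` U)) ->
    preimage_set_system setT f measurable `<=` @measurable _ T.
  move=> fo _ [A mA <-]; suff mf : measurable_fun [set: T] f by exact: mf.
  apply: (@measurability _ _ _ _ _ _ (@open 'rV[R]_k)) => //.
  by move=> _ [U oU <-]; rewrite setTI; apply: sub_sigma_algebra; exact: fo.
rewrite subUset; split; apply: sub => U oU; apply: open_comp oU => z _.
  exact: cvg_fst.
exact: cvg_snd.
Qed.

Section transportation.
Variables (R : realType) (d : nat).
Local Notation E := 'rV[R]_d.
Local Notation m_d := (lebesgue_rV R d).
Implicit Types (nu : set E -> \bar R) (phi : E -> R) (v : E -> E).

Definition dotp (u w : E) : R := \sum_i u ord0 i * w ord0 i.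

(* the norm `|_| that the library puts on matrices is the sup norm *)
Definition enorm (u : E) : R := Num.sqrt (dotp u u).

Definition locally_finite nu : Prop :=
  forall A : set E, measurable A -> bounded_set A -> (nu A < +oo)%E.

(* the product sigma-algebra on E * E is the Borel one: measurable_prod_rVE *)
Definition locally_finite2 (gamma : set (E * E) -> \bar R) : Prop :=
  forall A : set (E * E), measurable A -> bounded_set A -> (gamma A < +oo)%E.

Definition spt (gamma : set (E * E) -> \bar R) : set (E * E) :=
  [set z | forall U : set (E * E), open U -> U z -> (0 < gamma U)%E].

Definition compactly_supported phi : Prop :=
  compact (closure [set x | phi x != 0]).

(* The marginal identities are between \bar R-valued integrals: phi z.1 need not
   be compactly supported in z, and its gamma-integrability is a consequence of
   these identities for nonnegative phi. *)
Definition transportation nu1 nu2 : set {measure set (E * E) -> \bar R} :=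
  [set gamma | [/\ locally_finite2 gamma,
    forall phi, continuous phi -> compactly_supported phi ->
      (\int[gamma]_z (phi z.1)%:E = \int[nu1]_x (phi x)%:E)%E &
    forall phi, continuous phi -> compactly_supported phi ->
      (\int[gamma]_z (phi z.2)%:E = \int[nu2]_x (phi x)%:E)%E]].

(* maxe 0 takes the supremum in [0, +oo], where the empty set has supremum 0 *)
Definition Tra2 nu1 nu2 : \bar R := ereal_inf
  [set maxe 0%E (ereal_sup [set (enorm (z.1 - z.2))%:E | z in spt gamma])
    | gamma in transportation nu1 nu2].

Definition Tra nu : \bar R := Tra2 nu m_d.

Definition partial (i : 'I_d) phi : E -> R :=
  fun x => 'D_(delta_mx ord0 i) phi x.

Definition partials (s : seq 'I_d) phi : E -> R := foldr partial phi s.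

(* C^oo: all iterated partial derivatives exist and are continuous *)
Definition smooth phi : Prop := forall s : seq 'I_d,
  continuous (partials s phi) /\
  forall i x, derivable (partials s phi) x (delta_mx ord0 i).

Definition grad phi (x : E) : E := \row_i partial i phi x.

Definition locally_integrable_field v : Prop :=
  measurable_fun [set: E] v /\
  forall (i : 'I_d) (K : set E), compact K ->
    m_d.-integrable K (fun x => (v x ord0 i)%:E).

Definition connects v nu : Prop :=
  forall phi, smooth phi -> compactly_supported phi ->
  (\int[m_d]_x (dotp (v x) (grad phi x))%:E =
   - (\int[nu]_x (phi x)%:E - \int[m_d]_x (phi x)%:E))%E.

Definition connecting_fields nu : set (E -> E) :=
  [set v | locally_integrable_field v /\ connects v nu].

Definition eball (r : R) : set E := [set x | enorm x < r].

Definition chi (r : R) (x : E) : R := (fine (m_d (eball r)))^-1 * \1_(eball r) x.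

Definition conv (f g : E -> R) (x : E) : R := \int[m_d]_y (f y * g (x - y)).

Definition field_conv v (g : E -> R) (x : E) : E :=
  \row_i conv (fun y => v y ord0 i) g x.

Definition sup_norm (f : E -> R) : \bar R :=
  ereal_sup [set `|f x|%:E | x in [set: E]].

Definition field_sup_norm v : \bar R :=
  ereal_sup [set (enorm (v x))%:E | x in [set: E]].

Definition Ra v : \bar R := ereal_inf
  [set (r%:E + field_sup_norm (field_conv v (chi r)))%E | r in [set r | 0 < r]].

Definition Ra_tilde v : \bar R := ereal_inf
  [set (r%:E + sup_norm (conv (enorm \o v) (chi r)))%E | r in [set r | 0 < r]].

End transportation.

(* Main.v *)
From HB Require Import structures.
Require Import Defs.
From mathcomp Require Import all_boot all_order all_algebra.
From mathcomp Require Import ring lra.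
From mathcomp Require Import all_classical all_reals all_analysis.
From mathcomp Require Import measurable_realfun.
Set Implicit Arguments.
Unset Strict Implicit.
Unset Printing Implicit Defensive.
Import Order.TTheory GRing.Theory Num.Theory.
Import numFieldNormedType.Exports.

Local Open Scope classical_set_scope.
Local Open Scope ring_scope.

(** Both inequalities come from explicit constructions, one turning a connecting
    field into a transportation and one going back.  Orders of magnitude are
    measured with sup-norm boxes, since [`|x| <= enorm x <= n * `|x|].

    Upper bound.  Let [v] connect [nu] to Lebesgue measure [m], and let
    [w = v * chi_r] be bounded by [M].  Fix a smooth probability density [eta]
    carried by the box of radius [L], with partial derivatives of order
    [L^-(n+1)] ([exists_bump]), and let [S] be its average by [chi_r].
    Convolution can be moved from the field to the test function
    ([integral_conv_smoothing]), so testing [div v = nu - m] against the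
    translate [S(x - q)] gives
      [N(q) := int S(x - q) nu(dx) = 1 - int <w(y), grad eta (y - q)> dy].
    The right-hand side is the total mass of the density
      [a(q, y) := (2L)^-n 1_(|y - q| <= L) - <w(y), grad eta (y - q)>],
    and the integral of [a(q, y)] over [q] is [1], because derivatives of [eta]
    have integral zero.  When [L] exceeds [M] by a dimensional factor the second
    term of [a] is at most half of the first one, so [a] is nonnegative and [N]
    is positive.  Now send each point [x] of [nu] to [q] with density
    [S(x - q)], and spread the mass [N(q)] that arrives at [q] in proportion to
    [a(q, y)]: the result is exactly [m], and no mass has moved by more than
    [r + 2L] ([Tra_le_of_kernels], [Tra_le_of_field]).  As [L] can be taken of
    order [r + M], this is the upper bound.

    Lower bound.  Let [gamma] be a transportation from [nu] to [m] that moves mass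
    by at most [r].  For [(x, y)] distributed according to [gamma] and an
    independent [z] with density [chi_r], let a particle run from [x] to [y + z]
    along a segment in unit time, and let [v] be the total momentum density of
    these particles.  By the fundamental theorem of calculus
    ([integral_along_segment]) the integral of [<v, grad phi>] is the mean of
    [phi(y + z) - phi(x)], which is [int phi dm - int phi dnu] because blurring
    [m] by [z] does not change it ([test_plan_field]); the blur makes [v] a
    function instead of a measure carried by segments.  Speeds are at most [2r],
    and particles seen in a box of radius [r] have their target [y] in the
    concentric box of radius [4r], of measure [(8r)^n].  Hence the mean of [|v|]
    over balls of radius [r] is at most a dimensional multiple of [r]
    ([exists_field_of_plan]). *)

(** * Coordinates, boxes and affine changes of variables *)

Section sup_norm_coordinates.
Variables (R : realType) (n : nat).
Implicit Types x : 'rV[R]_n.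

Lemma coord_le_norm x i : `|x ord0 i| <= `|x|.
Proof.
rewrite [leRHS]/Num.norm /= mx_normrE; apply/bigmax_geP; right.
by exists (ord0, i).
Qed.

Lemma norm_le_coord x c : 0 <= c -> (forall i, `|x ord0 i| <= c) -> `|x| <= c.
Proof.
move=> c0 xc; rewrite [leLHS]/Num.norm /= mx_normrE; apply/bigmax_leP; split => //=.
by case=> i j _ /=; rewrite ord1.
Qed.

Lemma norm_le_enorm x : `|x| <= enorm x.
Proof.
apply: norm_le_coord; first exact: sqrtr_ge0.
move=> i; rewrite -sqrtr_sqr ler_wsqrtr// /dotp (bigD1 i)//= -expr2 lerDl.
by apply: sumr_ge0 => j _; rewrite -expr2 sqr_ge0.
Qed.

Lemma enorm_le_norm x : enorm x <= n%:R * `|x|.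
Proof.
rewrite -[leRHS]ger0_norm ?mulr_ge0// -sqrtr_sqr ler_wsqrtr// /dotp.
apply: (@le_trans _ _ (\sum_(i < n) `|x| ^+ 2)).
  apply: ler_sum => i _; rewrite -expr2 -real_normK ?num_real//.
  by rewrite ler_sqr ?nnegrE// coord_le_norm.
rewrite sumr_const card_ord -[leLHS]mulr_natl exprMn ler_wpM2r ?sqr_ge0//.
by rewrite -natrX ler_nat; case: n => // k; rewrite -{1}(mul1n k.+1) leq_mul.
Qed.

End sup_norm_coordinates.

Section measurability.
Variables (R : realType) (n : nat).

(** Open sets are countable unions of sup-norm balls, and such a ball is a
    finite intersection of conditions on single coordinates. *)
Lemma measurable_fun_rV d (T : measurableType d) (f : T -> 'rV[R]_n) :
  (forall i, measurable_fun [set: T] (fun t => f t ord0 i)) ->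
  measurable_fun [set: T] f.
Proof.
move=> mf; apply: (@measurability _ _ _ _ _ _ (@open 'rV[R]_n)) => //.
move=> _ [U oU <-]; rewrite setTI.
rewrite (open_bigcup_ball (c := fun q : 'rV[rat]_n => map_mx ratr q : 'rV[R]_n)
  (@dense_rV_ratr R n) oU) preimage_bigcup bigcup_mkcond.
apply: (@countable_bigcupT_measurable _ _ ('rV[rat]_n * nat)%type).
  exact: countableP.
move=> [q k] /=; case: ifPn => // _.
rewrite (_ : _ @^-1` _ = \bigcap_(i in [set: 'I_n])
    (fun t => f t ord0 i) @^-1` ball (ratr (q ord0 i) : R) k.+1%:R^-1).
  apply: fin_bigcap_measurable => // i _.
  by rewrite -[X in measurable X]setTI; apply: mf => //; apply: open_measurable; exact: ball_open.
apply/seteqP; split => [t [_ Bt] i _|t Bt].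
  by have := Bt ord0 i; rewrite mxE.
split => // i j; rewrite ord1 mxE; exact: Bt.
Qed.

Lemma continuous_measurable_rV (f : 'rV[R]_n -> R) : continuous f ->
  measurable_fun [set: 'rV[R]_n] f.
Proof.
move=> cf; apply: (measurability _ (RGenOpens.measurableE R)).
move=> _ [_ [a [b ->] <-]]; rewrite setTI; apply: open_measurable_rV.
by apply: open_comp (interval_open _ _) => // v _; exact: cf.
Qed.

Lemma closed_measurable_rV (A : set 'rV[R]_n) : closed A -> measurable A.
Proof.
by move=> cA; rewrite -(setCK A); apply: measurableC; apply: open_measurable_rV; exact: closed_openC.
Qed.

End measurability.

Section lebesgue_affine.
Variable R : realType.
Local Open Scope ereal_scope.

Lemma ge0_integral_lebesgue_rVS n (f : 'rV[R]_n.+1 -> \bar R) :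
  measurable_fun [set: 'rV[R]_n.+1] f -> (forall x, 0 <= f x) ->
  \int[lebesgue_rV R n.+1]_x f x =
  \int[lebesgue_measure]_t \int[lebesgue_rV R n]_x f (cons_rV (t, x)).
Proof.
move=> mf f0.
have mc : measurable_fun [set: measurableTypeR R * 'rV[R]_n] (@cons_rV R n).
  exact: measurable_cons_rV.
have mfc : measurable_fun [set: measurableTypeR R * 'rV[R]_n] (f \o @cons_rV R n).
  exact: measurableT_comp mf mc.
pose m : {measure set 'rV[R]_n.+1 -> \bar R} :=
  measure_function_pushforward__canonical__measure_function_Measure
    (@lebesgue_measure R \x lebesgue_rV R n) mc.
rewrite [LHS](eq_measure_integral m)//.
rewrite (ge0_integral_pushforward mc) //.
by rewrite preimage_setT; apply: fubini_tonelli1 => // z; exact: f0.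
Qed.

(** Uniqueness of Lebesgue measure: the rescaled image measure is checked on
    half-open intervals.  For [s < 0] the preimage of such an interval is
    half-open on the other side, which does not change its length. *)
Lemma lebesgue_measure_affine (a s : R) (A : set (measurableTypeR R)) : s != 0%R -> measurable A ->
  `|s|%:E * lebesgue_measure ((fun x => a + s * x)%R @^-1` A) = lebesgue_measure A.
Proof.
move=> s0 mA.
have mf : measurable_fun [set: measurableTypeR R]
    (fun x : measurableTypeR R => (a + s * x)%R : measurableTypeR R).
  by apply: measurable_funD => //; apply: measurable_funM.
pose mu := measure_function.pushforward (@lebesgue_measure R) (fun x : measurableTypeR R => (a + s * x)%R : measurableTypeR R).
pose m : {measure set (measurableTypeR R) -> \bar R} :=
  measure_function_pushforward__canonical__measure_function_Measure
    (@lebesgue_measure R) mf.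
have s0' : (0 <= `|s|)%R by [].
apply/esym/(lebesgue_measure_unique (mu := mscale (NngNum s0') m)) => //.
move=> _ [[b c]] _ <-.
rewrite /= /mscale /= /pushforward.
have [sp|sn] := ltP 0%R s.
  rewrite (_ : _ @^-1` _ = `](b - a) / s, (c - a) / s]%classic)%R; last first.
    apply/seteqP; split => x /=; rewrite !in_itv /= ltr_pdivrMr// ler_pdivlMr// [(s * _)%R]mulrC; lra.
  rewrite !lebesgue_measure_itv/= !lte_fin ltr_pM2r ?invr_gt0// ltrD2r.
  case: ifPn => [bc|]; last by rewrite mule0.
  by rewrite -!EFinB -EFinM gtr0_norm// -mulrBl mulrCA mulfV// mulr1; congr (_%:E); ring.
have {}sn : (s < 0)%R by rewrite lt_neqAle s0.
rewrite (_ : _ @^-1` _ = `[(c - a) / s, (b - a) / s[%classic)%R; last first.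
  apply/seteqP; split => x /=; rewrite !in_itv /= ler_ndivrMr// ltr_ndivlMr// [(s * _)%R]mulrC; lra.
rewrite !lebesgue_measure_itv/= !lte_fin ltr_nM2r ?invr_lt0// ltrD2r.
case: ifPn => [bc|]; last by rewrite mule0.
by rewrite -!EFinB -EFinM ltr0_norm// -mulrBl mulrCA mulNr mulfV// mulrN1; congr (_%:E); ring.
Qed.

Lemma ge0_integral_affineR (a s : R) (f : R -> \bar R) : s != 0%R ->
  measurable_fun setT f -> (forall x, 0 <= f x) ->
  `|s|%:E * \int[lebesgue_measure]_x f (a + s * x)%R = \int[lebesgue_measure]_x f x.
Proof.
move=> s0 mf f0.
have mg : measurable_fun [set: measurableTypeR R]
    (fun x : measurableTypeR R => (a + s * x)%R : measurableTypeR R).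
  by apply: measurable_funD => //; apply: measurable_funM.
have s0' : (0 <= `|s|)%R by [].
pose m : {measure set (measurableTypeR R) -> \bar R} :=
  measure_function_pushforward__canonical__measure_function_Measure
    (@lebesgue_measure R) mg.
rewrite [RHS](eq_measure_integral (mscale (NngNum s0') m)); last first.
  by move=> A mA _; rewrite /= /mscale/= /pushforward lebesgue_measure_affine.
rewrite ge0_integral_mscale//.
congr (_ * _).
by rewrite (ge0_integral_pushforward mg)// preimage_setT.
Qed.

(** By induction on the dimension: [lebesgue_rV n.+1] is a product, so the first
    coordinate is handled by the one-dimensional case. *)
Lemma ge0_integral_affine n (a : 'rV[R]_n) (s : R) (f : 'rV[R]_n -> \bar R) :
  s != 0%R -> measurable_fun setT f -> (forall x, 0 <= f x) ->
  (`|s| ^+ n)%:E * \int[lebesgue_rV R n]_x f (a + s *: x)%R =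
  \int[lebesgue_rV R n]_x f x.
Proof.
move=> s0; elim: n a f => [|n IH] a f mf f0.
  rewrite expr0 mul1e; apply: eq_integral => x _; congr (f _).
  by apply/rowP => -[].
have mcomb k (b : 'rV[R]_k) : measurable_fun [set: 'rV[R]_k] (fun x : 'rV[R]_k => b + s *: x)%R.
  apply: measurable_fun_rV => i; under eq_fun do rewrite !mxE.
  by apply: measurable_funD => //; apply: measurable_funM => //; exact: measurable_coord_rV.
rewrite !ge0_integral_lebesgue_rVS//; last first.
  by apply: measurableT_comp mf _; exact: mcomb.
pose g t := \int[lebesgue_rV R n]_x f (cons_rV (t, x)).
have mfc : measurable_fun setT (f \o @cons_rV R n).
  by apply: measurableT_comp mf _; exact: measurable_cons_rV.
have g0 t : 0 <= g t by exact: integral_ge0.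
have mg : measurable_fun setT g.
  apply: (measurable_fun_fubini_tonelli_F (f \o @cons_rV R n)) => // z; exact: f0.
apply: etrans (ge0_integral_affineR (a ord0 ord0) s0 mg g0).
rewrite exprS EFinM -muleA; congr (_ * _).
have mcomp : measurable_fun setT (fun z => f (a + s *: @cons_rV R n z)%R).
  apply: (measurableT_comp mf); apply: (measurableT_comp (mcomb _ a)).
  exact: measurable_cons_rV.
rewrite -ge0_integralZl//=; last 2 first.
- by apply: (measurable_fun_fubini_tonelli_F (fun z => f (a + s *: cons_rV z)%R)) => // z; exact: f0.
- by move=> *; exact: integral_ge0.
apply: eq_integral => t _.
rewrite /g -(IH (uncons_rV a).2)//; last exact: measurableT_comp mfc _.
congr (_ * _); apply: eq_integral => x _; congr (f _).
by apply/rowP => i; rewrite !mxE; case: unliftP => [j ->|->] /=; rewrite ?mxE.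
Qed.

Lemma ge0_integral_shift n (a : 'rV[R]_n) (f : 'rV[R]_n -> \bar R) :
  measurable_fun setT f -> (forall x, 0 <= f x) ->
  \int[lebesgue_rV R n]_x f (a + x)%R = \int[lebesgue_rV R n]_x f x.
Proof.
move=> mf f0; rewrite -[RHS](ge0_integral_affine a (oner_neq0 R))//.
rewrite normr1 expr1n mul1e; apply: eq_integral => x _; by rewrite scale1r.
Qed.

Lemma ge0_integral_reflect n (a : 'rV[R]_n) (f : 'rV[R]_n -> \bar R) :
  measurable_fun setT f -> (forall x, 0 <= f x) ->
  \int[lebesgue_rV R n]_x f (a - x)%R = \int[lebesgue_rV R n]_x f x.
Proof.
move=> mf f0; have s0 : (-1 : R)%R != 0%R by rewrite oppr_eq0 oner_neq0.
rewrite -[RHS](ge0_integral_affine a s0 mf)//.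
rewrite normrN1 expr1n mul1e; apply: eq_integral => x _; by rewrite scaleN1r.
Qed.

End lebesgue_affine.

Section boxes.
Variables (R : realType) (n : nat).
Local Notation m_n := (lebesgue_rV R n).
Implicit Types (c x : 'rV[R]_n) (r : R).

Definition box c r : set 'rV[R]_n := [set x | `|x - c| <= r].

Lemma closed_box c r : closed (box c r).
Proof.
apply: (@closed_comp _ _ (fun x : 'rV[R]_n => `|x - c|) [set z | z <= r]); last first.
  exact: closed_le.
move=> x _; apply: (@continuous_comp _ _ _ (fun x => x - c) Num.norm).
  by apply: continuousB; [exact: cvg_id|exact: cst_continuous].
exact: norm_continuous.
Qed.

Lemma measurable_box c r : measurable (box c r).
Proof. apply: closed_measurable_rV; exact: closed_box. Qed.

Lemma bounded_box c r : bounded_set (box c r).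
Proof.
exists (`|c| + r); split; first exact: num_real.
move=> M cM x /= xc; rewrite -(subrK c x) (le_trans (ler_normD _ _))//.
by rewrite (le_trans _ (ltW cM))// addrC lerD2l.
Qed.

Lemma compact_box c r : compact (box c r).
Proof. apply: bounded_closed_compact; [exact: bounded_box|exact: closed_box]. Qed.

Lemma bounded_subset_box (A : set 'rV[R]_n) : bounded_set A ->
  exists2 r, 0 < r & A `<=` box 0 r.
Proof.
move=> [M [_ AM]]; exists (`|M| + 1); first by rewrite ltr_pwDr.
move=> x Ax; rewrite /box/= subr0; apply: AM => //.
by rewrite (le_lt_trans (ler_norm M))// ltrDl.
Qed.

Lemma box_lebesgue c r : 0 <= r -> m_n (box c r) = ((2 * r) ^+ n)%:E.
Proof.
move=> r0.
pose a : 'rV[R]_n := \row_i (c ord0 i - r).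
pose b : 'rV[R]_n := \row_i (c ord0 i + r).
rewrite (_ : box c r = [set v | forall i, v ord0 i \in `[a ord0 i, b ord0 i]]).
  rewrite lebesgue_rV_box => [|i]; last by rewrite !mxE; lra.
  rewrite (eq_bigr (fun=> 2 * r)); first by rewrite prodr_const card_ord.
  by move=> i _; rewrite !mxE; lra.
apply/seteqP; split => x /= xr.
  move=> i; rewrite in_itv/= !mxE.
  have := le_trans (coord_le_norm _ i) xr; rewrite !mxE ler_norml; lra.
apply: norm_le_coord => // i; rewrite !mxE.
have := xr i; rewrite in_itv/= !mxE ler_norml; lra.
Qed.

End boxes.

(** * Differentiability along lines from continuous partial derivatives *)

Section directional_derivatives.
Variables (R : realType) (n : nat).
Local Notation E := 'rV[R]_n.
Implicit Types (f : E -> R) (x v h : E).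

Lemma is_derive_line f x v (t l : R) :
  is_derive (t *: v + x) v f l -> is_derive t (1 : R) (fun s : R => f (s *: v + x)) l.
Proof.
move=> [df <-].
have lineE : (fun h : R => h^-1 *: (((fun s : R => f (s *: v + x)) \o shift t) (h *: 1) -
    f (t *: v + x))) =
  (fun h : R => h^-1 *: ((f \o shift (t *: v + x)) (h *: v) - f (t *: v + x))).
  apply/funext => h /=; congr (_ *: (f _ - _)).
  by rewrite [h *: 1]mulr1 scalerDl addrA.
by split; [rewrite /derivable lineE|rewrite /derive lineE].
Qed.

Lemma is_derive_of_line f x v (l : R) :
  is_derive (0 : R) 1 (fun s : R => f (s *: v + x)) l -> is_derive x v f l.
Proof.
move=> [df <-].
have lineE : (fun h : R => h^-1 *: (((fun s : R => f (s *: v + x)) \o shift 0) (h *: 1) -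
    f (0 *: v + x))) =
  (fun h : R => h^-1 *: ((f \o shift x) (h *: v) - f x)).
  apply/funext => h /=; congr (_ *: (f _ - f _)).
    by rewrite [h *: 1]mulr1 addr0.
  by rewrite scale0r add0r.
by split; [move: df; rewrite /derivable lineE|rewrite /derive lineE].
Qed.

Lemma line_MVT f x v (c : R) :
  (forall y, derivable f y v) ->
  exists2 t : R, `|t| <= `|c| & f (c *: v + x) - f x = c * 'D_v f (t *: v + x).
Proof.
move=> df; pose g t := f (t *: v + x); pose dg t := 'D_v f (t *: v + x).
have dgE (t : R) : is_derive t (1 : R) g (dg t).
  by apply: is_derive_line; exact/derivableP.
have cg (A : set R) : {within A, continuous g}.
  apply: continuous_subspaceT => t; apply: differentiable_continuous.
  by apply/derivable1_diffP; have [] := dgE t.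
have g0 : g 0 = f x by rewrite /g scale0r add0r.
have [c0|c0] := leP 0 c.
  have [t] := MVT_segment c0 (fun t _ => dgE t) (cg _).
  rewrite in_itv/= subr0 mulrC => /andP[t0 tc]; rewrite g0 => gE.
  by exists t => //; rewrite !ger0_norm.
have [t] := MVT_segment (ltW c0) (fun t _ => dgE t) (cg _).
rewrite in_itv/= sub0r => /andP[ct t0]; rewrite g0 => gE.
exists t; first by rewrite !ler0_norm ?lerN2// ltW.
by move: gE; rewrite /g => gE; rewrite -opprB gE mulrN opprK mulrC.
Qed.

(** Move from [x] to [h + x] one coordinate at a time and use the mean value
    theorem on each of the [n] legs, all of which stay within [`|h|] of [x]. *)
Lemma coordinatewise_MVT f x h :
  (forall i y, derivable f y (delta_mx ord0 i)) ->
  exists xi : 'I_n -> E, (forall i, `|xi i - x| <= `|h|) /\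
    f (h + x) - f x = \sum_i h ord0 i * partial i f (xi i).
Proof.
move=> df.
pose H k : E := \row_i (if (i < k)%N then h ord0 i else 0).
have HS (i : 'I_n) : H i.+1 = h ord0 i *: delta_mx ord0 i + H i.
  apply/rowP => j; rewrite !mxE eqxx/= ltnS leq_eqVlt.
  case: (ltngtP j i) => [ji|ji|/val_inj ->].
  - by rewrite orbT -val_eqE/= (ltn_eqF ji) mulr0 add0r.
  - by rewrite /= -val_eqE/= (gtn_eqF ji) mulr0 add0r.
  - by rewrite !eqxx mulr1 addr0.
have /choice[t tP] : forall i : 'I_n, exists t : R, `|t| <= `|h ord0 i| /\
    f (H i.+1 + x) - f (H i + x) =
    h ord0 i * partial i f (t *: delta_mx ord0 i + (H i + x)).
  move=> i; have [t tc tE] := line_MVT (H i + x) (h ord0 i) (df i).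
  by exists t; split => //; rewrite HS -addrA.
exists (fun i => t i *: delta_mx ord0 i + (H i + x)); split.
  move=> i; rewrite addrA addrK; apply: norm_le_coord => // j.
  rewrite !mxE eqxx/=; have [->|ji] := eqVneq j i.
    by rewrite mulr1 ltnn addr0 (le_trans (tP i).1)// coord_le_norm.
  rewrite mulr0 add0r; case: ifP => _; first exact: coord_le_norm.
  by rewrite normr0.
under eq_bigr do rewrite -(tP _).2.
rewrite -(big_mkord xpredT (fun i => f (H i.+1 + x) - f (H i + x))).
rewrite telescope_sumr//; congr (f _ - f _).
  by congr (_ + _); apply/rowP => i; rewrite mxE ltn_ord.
rewrite -[LHS]add0r; congr (_ + _); apply/rowP => i; by rewrite !mxE ltn0.
Qed.

Lemma lipschitz_bounded_partials f C :
  (forall i y, derivable f y (delta_mx ord0 i)) ->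
  (forall i y, `|partial i f y| <= C) ->
  forall x h, `|f (h + x) - f x| <= n%:R * C * `|h|.
Proof.
move=> df fC x h; have [xi [_ ->]] := coordinatewise_MVT x h df.
apply: le_trans (ler_norm_sum _ _ _) _.
rewrite -[n in n%:R]card_ord -mulrA mulr_natl -sumr_const.
by apply: ler_sum => i _; rewrite normrM mulrC ler_pM ?coord_le_norm.
Qed.

(** Only derivatives along the axes are assumed to exist.  By
    [coordinatewise_MVT] the difference quotient along [v] is a combination of
    partial derivatives at points tending to [x], so their continuity yields
    the derivative in the direction [v]. *)
Lemma is_derive_grad f x v :
  (forall i y, derivable f y (delta_mx ord0 i)) ->
  (forall i, continuous (partial i f)) -> is_derive x v f (dotp v (grad f x)).
Proof.
move=> df cf; pose l := dotp v (grad f x).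
have limE : (fun h : R => h^-1 *: ((f \o shift x) (h *: v) - f x)) @ 0^' --> l.
  apply/cvgrPdist_le => e e0.
  pose K := (n%:R * `|v| + 1); have K0 : 0 < K by rewrite ltr_wpDl// mulr_ge0.
  have /choice[r rP] : forall i, exists r : R, 0 < r /\
      forall y, `|y - x| <= r -> `|partial i f x - partial i f y| <= e / K.
    move=> i; have /cvgrPdist_le/(_ (e / K)) := cf i x.
    rewrite divr_gt0// => /(_ isT)/nbhs_normP[r r0 rP].
    exists (r / 2); split => [|y yx]; first by rewrite divr_gt0.
    apply: rP; rewrite /= /ball_/= distrC (le_lt_trans yx)// ltr_pdivrMr//.
    by rewrite ltr_pMr// ltr1n.
  near=> h.
  have h0 : h != 0 by near: h; exact: nbhs_dnbhs_neq.
  have [xi [xih /= ->]] := coordinatewise_MVT x (h *: v) df.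
  rewrite /l /dotp scaler_sumr -sumrB.
  rewrite (eq_bigr (fun i => v ord0 i * (partial i f x - partial i f (xi i)))); last first.
    by move=> i _; rewrite !mxE /= /GRing.scale/= mulrBr !mulrA mulVf// mul1r.
  apply: le_trans (ler_norm_sum _ _ _) _.
  apply: (@le_trans _ _ (\sum_(i < n) `|v| * (e / K))).
    apply: ler_sum => i _; rewrite normrM ler_pM ?coord_le_norm//.
    apply: (rP i).2; rewrite (le_trans (xih i))//.
    move: i {xi xih}; near: h.
    have : \forall h \near 0^', `|h *: v| <= \big[Order.min/1]_i r i.
      have r0 : 0 < \big[Order.min/1]_i r i.
        by apply/bigmin_gtP; split => // i _; exact: (rP i).1.
      have v1 : 0 < `|v| + 1 by rewrite ltr_wpDl.
      have r1 : 0 < (\big[Order.min/1]_i r i) / (`|v| + 1).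
        by rewrite divr_gt0.
      near=> h; rewrite normrZ.
      have : `|h| <= (\big[Order.min/1]_i r i) / (`|v| + 1).
        near: h; apply: dnbhs0_le; exact: r1.
      rewrite ler_pdivlMr// => hr; apply: le_trans hr.
      by rewrite ler_wpM2l// lerDl.
    by apply: filterS => h hr i; rewrite (le_trans hr)// bigmin_le//.
  rewrite sumr_const card_ord -[leLHS]mulr_natl mulrA mulrA ler_pdivrMr//.
  by rewrite mulrC ler_pM2l// /K lerDl.
by split; [apply/cvg_ex; exists l|apply/cvg_lim].
Unshelve. all: by end_near. Qed.

End directional_derivatives.

(** * Flat functions *)

Section flat_functions.
Variable R : realType.
Implicit Types (P : {poly R}) (t u : R).

(** The functions [P(1/t) exp(-1/t)], with a polynomial [P] rather than [P = 1]
    alone, form a family stable under differentiation, including at [0]; hence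
    all of them are smooth. *)
Definition flat P t : R := if 0 < t then P.[t^-1] * expR (- t^-1) else 0.

(** Induction on [P]: half of the exponential rate is spent on the quotient of
    [P] by ['X], the other half on the factor [u]. *)
Lemma poly_le_expR P (e : R) : 0 < e ->
  exists2 C, 0 <= C & forall u, 0 <= u -> `|P.[u]| <= C * expR (e * u).
Proof.
elim/poly_ind: P e => [|P c IH] e e0.
  by exists 0 => // u _; rewrite horner0 normr0 mul0r.
have e20 : 0 < e / 2 by rewrite divr_gt0.
have [C C0 CP] := IH _ e20.
exists (C * (e / 2)^-1 + `|c|) => [|u u0].
  by rewrite addr_ge0// mulr_ge0// invr_ge0 ltW.
rewrite hornerMXaddC mulrDl (le_trans (ler_normD _ _))// lerD//; last first.
  by rewrite ler_peMr// -expR0 ler_expR mulr_ge0// ltW.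
rewrite normrM (ger0_norm u0).
rewrite [e in expR (e * u)]splitr mulrDl expRD mulrACA.
apply: ler_pM => //; first exact: CP.
rewrite -ler_pdivrMl ?invr_gt0// invrK.
by rewrite (le_trans _ (expR_ge1Dx _))// lerDr.
Qed.

(** Applied to [P * 'X], this bounds the difference quotient of [flat P] at [0],
    since [t^-1 * flat P t = flat (P * 'X) t]. *)
Lemma flat_le_linear P : exists2 C, 0 < C & forall t, `|flat P t| <= C * `|t|.
Proof.
have [C C0 CP] := poly_le_expR (P * 'X) (ltr01 : 0 < 1 :> R).
exists (C + 1) => [|t]; first by rewrite ltr_wpDl.
rewrite /flat; case: ifPn => [t0|_]; last by rewrite normr0 mulr_ge0// addr_ge0.
have tV0 : 0 <= t^-1 by rewrite invr_ge0 ltW.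
have := CP _ tV0; rewrite hornerMX mul1r normrM (ger0_norm tV0).
rewrite ler_pdivrMr// => Pt.
rewrite normrM (ger0_norm (expR_ge0 _)) expRN ler_pdivrMr ?expR_gt0//.
rewrite (gtr0_norm t0) (le_trans Pt)// [leRHS]mulrAC ler_pM2r// ler_pM2r ?expR_gt0//.
by rewrite lerDl.
Qed.

(** The polynomial of the derivative, from the chain rule for [t |-> t^-1]. *)
Definition flat_deriv P := 'X^2 * (P - P^`()).

Lemma flatM P Q t : flat (P * Q) t = P.[t^-1] * flat Q t.
Proof.
by rewrite /flat; case: ifPn => _; rewrite ?mulr0// hornerM mulrA.
Qed.

Lemma is_derive_horner P t : is_derive t 1 (fun x => P.[x]) (P^`()).[t].
Proof.
elim/poly_ind: P => [|P c IH].
  rewrite deriv0 horner0 (_ : (fun _ => _) = cst 0).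
    exact: is_derive_cst.
  by apply/funext => x; rewrite horner0.
rewrite (_ : (fun _ => _) = (fun x => P.[x]) * id + cst c).
  apply: is_derive_eq.
  rewrite derivMXaddC hornerD hornerMX /= addr0 /GRing.scale/= mulr1.
  by rewrite [t * _]mulrC.
by apply/funext => x; rewrite hornerMXaddC.
Qed.

Lemma is_derive_flat P t : is_derive t 1 (flat P) (flat (flat_deriv P) t).
Proof.
have [t0|t0|->] := ltgtP t 0.
- rewrite /flat ltNge (ltW t0)/=.
  apply: near_eq_is_derive (is_derive_cst (0 : R) t (1 : R)).
  near=> x; rewrite /flat ifF//; apply/negbTE; rewrite -leNgt; apply/ltW.
  by near: x; exact: lt_nbhsl.
- pose g x : R := P.[x^-1] * expR (- x^-1).
  apply: (near_eq_is_derive (f := g)).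
    by near=> x; rewrite /flat ifT//; near: x; exact: lt_nbhsr.
  have dV : is_derive t 1 (fun x : R => x^-1) (- t ^- 2).
    have t0' : (id t : R) != 0 by exact: lt0r_neq0.
    apply: is_derive_eq (is_deriveV t0' (is_derive_id t (1:R))) _.
    by rewrite /GRing.scale/= mulr1.
  have dP : is_derive t 1 (fun x : R => P.[x^-1]) (P^`().[t^-1] * - t ^- 2).
    exact: (is_derive1_comp (is_derive_horner _ _) dV).
  have dN : is_derive t 1 (fun x : R => - x^-1) (- - t ^- 2) by exact: is_deriveN.
  have dE : is_derive t 1 (fun x : R => expR (- x^-1)) (expR (- t^-1) * - - t ^- 2).
    exact: (is_derive1_comp (is_derive_expR _) dN).
  apply: is_derive_eq (is_deriveM dP dE) _.
  rewrite /flat t0 /flat_deriv !hornerE /GRing.scale/= opprK exprVn.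
  by ring.
- rewrite [flat (flat_deriv P) 0]/flat ltxx.
  have lim0 : (fun h : R => h^-1 *: ((flat P \o shift 0) (h *: 1) - flat P 0)) @ 0^' --> (0:R).
    have [C C0 CP] := flat_le_linear (P * 'X).
    apply/cvgrPdist_le => e e0; near=> h.
    rewrite sub0r normrN /= [h *: 1]mulr1 addr0 [flat P 0]/flat ltxx subr0.
    rewrite [_ *: _](_ : _ = flat (P * 'X) h); last first.
      by rewrite mulrC flatM hornerX.
    rewrite (le_trans (CP _))// -ler_pdivlMl// mulrC.
    near: h; apply: dnbhs0_le; by rewrite divr_gt0.
  by split; [apply/cvg_ex; exists 0|apply/cvg_lim].
Unshelve. all: by end_near. Qed.

Lemma continuous_flat P : continuous (flat P).
Proof.
move=> t; apply: differentiable_continuous; apply/derivable1_diffP.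
by have [] := is_derive_flat P t.
Qed.

End flat_functions.

Section flat_algebra.
Variables (R : realType) (n : nat).
Local Notation E := 'rV[R]_n.

(** Sums and products of flat functions of single coordinates.  The class is
    closed under partial derivatives and consists of continuous functions, so
    its members are smooth. *)
Inductive flat_expr : (E -> R) -> Prop :=
| flat_expr_coord P a b i : flat_expr (fun x => flat P (a + b * x ord0 i))
| flat_expr_cst c : flat_expr (fun=> c)
| flat_exprD f g : flat_expr f -> flat_expr g -> flat_expr (fun x => f x + g x)
| flat_exprM f g : flat_expr f -> flat_expr g -> flat_expr (fun x => f x * g x).

Lemma flat_expr_derive f : flat_expr f -> forall i, exists2 g,
  flat_expr g & forall x, is_derive x (delta_mx ord0 i) f (g x).
Proof.
elim=> [P a b j|c|{}f g _ IHf _ IHg|{}f g ff IHf fg IHg] i.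
- exists (fun x => (b * (j == i)%:R) * flat (flat_deriv P) (a + b * x ord0 j)).
    by apply: flat_exprM; [exact: flat_expr_cst|exact: flat_expr_coord].
  move=> x; apply: is_derive_of_line.
  pose c := b * (j == i)%:R.
  pose lin := (fun s : R => (a + b * x ord0 j) + c * s).
  rewrite [X in is_derive _ _ X](_ : _ = flat P \o lin); last first.
    apply/funext => s /=; rewrite /lin /c !mxE eqxx/=; congr flat.
    by ring.
  have dl : is_derive (0:R) (1:R) lin c.
    have d1 : is_derive (0:R) (1:R) (cst (a + b * x ord0 j) + (c *: id)) (0 + c *: 1).
      by apply: is_deriveD.
    by apply: is_derive_eq d1 _; rewrite add0r [_ *: _]mulr1.
  apply: is_derive_eq (is_derive1_comp (is_derive_flat P (lin 0)) dl) _.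
  by rewrite /lin mulr0 addr0 mulrC.
- by exists (fun=> 0) => [|x]; [exact: flat_expr_cst|exact: is_derive_cst].
- have [f' ff' df] := IHf i; have [g' fg' dg] := IHg i.
  exists (fun x => f' x + g' x) => [|x]; first exact: flat_exprD.
  exact: (@is_deriveD _ _ _ f g).
- have [f' ff' df] := IHf i; have [g' fg' dg] := IHg i.
  exists (fun x => f x * g' x + g x * f' x) => [|x].
    by apply: flat_exprD; exact: flat_exprM.
  exact: (@is_deriveM _ _ f g).
Qed.

Lemma continuous_flat_expr f : flat_expr f -> continuous f.
Proof.
elim=> [P a b i|c|{}f g _ cf _ cg|{}f g _ cf _ cg] x.
- have cl : continuous (fun y : E => a + b * y ord0 i).
    move=> y; apply: (@continuousD _ _ _ (fun=> a) (fun y : E => b * y ord0 i)).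
      exact: cst_continuous.
    apply: (@continuousM _ _ (fun=> b) (fun y : E => y ord0 i)).
      exact: cst_continuous.
    exact: coord_continuous.
  apply: (@continuous_comp _ _ _ (fun y : E => a + b * y ord0 i) (flat P)).
    exact: cl.
  exact: continuous_flat.
- exact: cst_continuous.
- by apply: (@continuousD _ _ _ f g); [exact: cf|exact: cg].
- by apply: (@continuousM _ _ f g); [exact: cf|exact: cg].
Qed.

Lemma flat_expr_partial f i : flat_expr f -> flat_expr (partial i f).
Proof.
move=> /flat_expr_derive/(_ i)[g fg dg].
by rewrite (_ : partial i f = g)//; apply/funext => x; exact: derive_val.
Qed.

Lemma smooth_flat_expr f : flat_expr f -> smooth f.
Proof.
move=> ff s; have : flat_expr (partials s f).
  by elim: s => //= i s; exact: flat_expr_partial.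
move=> fs; split; first exact: continuous_flat_expr.
by move=> i x; have [g _ dg] := flat_expr_derive fs i; have [] := dg x.
Qed.

End flat_algebra.

(** * Smooth functions with bounded support, and a bump *)

Section supports.
Variables (R : realType) (n : nat).
Local Notation E := 'rV[R]_n.
Local Notation m_n := (lebesgue_rV R n).
Implicit Types (f : E -> R) (c x y : E) (r : R).

(** A quantitative form of compact support: it keeps track of the radius, which
    is what bounds the distance over which mass is moved. *)
Definition vanishes_off c r f := forall x, r < `|x - c| -> f x = 0.

Lemma partial_vanishes_off c r f i : vanishes_off c r f ->
  vanishes_off c r (partial i f).
Proof.
move=> f0 x xr; rewrite /partial -(@derive_cst _ _ _ (0 : R) x (delta_mx ord0 i)).
apply: near_eq_derive.
have : nbhs x (~` box c r).
  apply: open_nbhs_nbhs; split; last by apply/negP; rewrite -ltNge.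
  exact/closed_openC/closed_box.
by apply: filterS => y /= yr; rewrite f0// ltNge; exact/negP.
Qed.

Lemma continuous_vanishing_bounded c r f : continuous f -> vanishes_off c r f ->
  exists2 C, 0 <= C & forall x, `|f x| <= C.
Proof.
move=> cf f0.
have : compact (f @` box c r).
  apply: continuous_compact; last exact: compact_box.
  by apply: continuous_subspaceT.
move=> /compact_bounded[M [_ MP]]; exists (`|M| + 1) => [|x]; first exact: addr_ge0.
have [xr|/f0->] := leP `|x - c| r; last by rewrite normr0 addr_ge0.
apply: (MP (`|M| + 1)); last by exists x.
by rewrite (le_lt_trans (ler_norm M))// ltrDl.
Qed.

Lemma vanishes_off_compact c r f : vanishes_off c r f -> compactly_supported f.
Proof.
move=> f0; apply: (@subclosed_compact _ _ (box c r)); [exact: closed_closure|exact: compact_box|].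
rewrite [X in _ `<=` X](closure_id _).1; last exact: closed_box.
by apply: closure_subset => x /=; apply: contra_neqP => /negP; rewrite -ltNge => /f0.
Qed.

Lemma compactly_supported_vanishes f : compactly_supported f ->
  exists2 r, 0 < r & vanishes_off 0 r f.
Proof.
move=> /compact_bounded/bounded_subset_box[r r0 fr]; exists r => // x xr.
apply: contrapT => /eqP fx; have : box 0 r x by apply/fr/subset_closure.
by rewrite /box/= leNgt xr.
Qed.

Lemma is_derive_affine f (s : R) (a x v : E) :
  derivable f (s *: x + a) v ->
  is_derive x v (fun y => f (s *: y + a)) (s * 'D_v f (s *: x + a)).
Proof.
move=> df; apply: is_derive_of_line.
pose g (t : R) := f (t *: v + (s *: x + a)).
have dg : is_derive (0 * s : R) (1 : R) g ('D_v f (s *: x + a)).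
  apply: is_derive_line; rewrite mul0r scale0r add0r; exact/derivableP.
have ds : is_derive (0 : R) (1 : R) (fun t : R => t * s) s.
  have d1 : is_derive (0:R) (1:R) (s *: id) (s *: 1) by exact: is_deriveZ.
  rewrite (_ : (fun _ => _) = s *: id); last first.
    by apply/funext => t; rewrite mulrC.
  by apply: is_derive_eq d1 _; rewrite [_ *: _]mulr1.
rewrite [X in is_derive _ _ X](_ : _ = g \o (fun t : R => t * s)); last first.
  by apply/funext => t; rewrite /g /= scalerDr scalerA mulrC addrA.
by have := @is_derive1_comp _ g (fun t : R => t * s) 0 _ _ dg ds; rewrite [_ * s]mulrC.
Qed.

Lemma smooth_partial f i : smooth f -> smooth (partial i f).
Proof.
by move=> sf s; have := sf (rcons s i); rewrite /partials -cats1 foldr_cat.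
Qed.

Lemma smooth_continuous f : smooth f -> continuous f.
Proof. by move=> /(_ [::])[]. Qed.

Lemma smooth_derivable f : smooth f ->
  forall i x, derivable f x (delta_mx ord0 i).
Proof. by move=> /(_ [::])[]. Qed.
Arguments smooth_derivable {f} _ _ _.

Lemma partial_shift f c i : smooth f ->
  partial i (fun x => f (x - c)) = (fun x => partial i f (x - c)).
Proof.
move=> sf; apply/funext => x; rewrite /partial.
have d1 := @is_derive_affine f 1 (- c) x (delta_mx ord0 i) (smooth_derivable sf _ _).
have := derive_val (is_derive := d1); rewrite mul1r scale1r => <-.
by rewrite (_ : (fun y => f (1 *: y - c)) = (fun y => f (y - c)))//; apply/funext => y; rewrite scale1r.
Qed.

Lemma smooth_shift f c : smooth f -> smooth (fun x => f (x - c)).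
Proof.
move=> sf s.
have {sf} [g sg ->] : exists2 g, smooth g &
    partials s (fun x => f (x - c)) = (fun x => g (x - c)).
  elim: s => [|i s [g sg /= ->]]; first by exists f.
  by exists (partial i g); [exact: smooth_partial|exact: partial_shift].
split.
  move=> x; apply: (@continuous_comp _ _ _ (fun x => x - c) g).
    by apply: continuousB; [exact: cvg_id|exact: cst_continuous].
  exact: smooth_continuous.
move=> i x.
have d1 := @is_derive_affine g 1 (- c) x (delta_mx ord0 i) (smooth_derivable sg _ _).
rewrite (_ : (fun _ => _) = (fun y => g (1 *: y - c))); first by have [] := d1.
by apply/funext => y; rewrite scale1r.
Qed.

Lemma partial_scale f (k : R) i : smooth f ->
  partial i (fun x => k * f x) = (fun x => k * partial i f x).
Proof.
move=> sf; rewrite (_ : (fun x => k * f x) = k *: f)//; apply/funext => x.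
exact: (deriveZ k (smooth_derivable sf i x)).
Qed.

Lemma smooth_scale f (k : R) : smooth f -> smooth (fun x => k * f x).
Proof.
move=> sf s.
have {sf} [g sg ->] : exists2 g, smooth g & partials s (fun x => k * f x) = (fun x => k * g x).
  elim: s => [|i s [g sg /= ->]]; first by exists f.
  by exists (partial i g); [exact: smooth_partial|exact: partial_scale].
split; last first.
  move=> i x; rewrite (_ : (fun x => k * g x) = k *: g)//.
  by apply: derivableZ; exact: smooth_derivable.
move=> x; apply: (@continuousM _ _ (fun=> k) g); first exact: cst_continuous.
exact: (smooth_continuous sg).
Qed.

Lemma partial_affine f (s : R) c i x : smooth f ->
  partial i (fun x => f (s *: x + c)) x = s * partial i f (s *: x + c).
Proof.
move=> sf; have d1 := @is_derive_affine f s c x (delta_mx ord0 i) (smooth_derivable sf _ _).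
exact: derive_val.
Qed.

Lemma smooth_bounded_partials f c r : smooth f -> vanishes_off c r f ->
  exists2 C, 0 <= C & forall i x, `|partial i f x| <= C.
Proof.
move=> sf f0.
have /choice[C CP] : forall i, exists C, 0 <= C /\ forall x, `|partial i f x| <= C.
  move=> i; have [C C0 CP] := continuous_vanishing_bounded
    (smooth_continuous (smooth_partial i sf)) (partial_vanishes_off i f0).
  by exists C.
have C0 i : 0 <= C i := (CP i).1.
exists (\sum_i C i) => [|i x]; first exact: sumr_ge0.
by rewrite (le_trans ((CP i).2 _))// (bigD1 i)//= lerDl sumr_ge0.
Qed.

Lemma smooth_measurable f : smooth f -> measurable_fun [set: E] f.
Proof. by move=> /smooth_continuous; exact: continuous_measurable_rV. Qed.

End supports.

Section bump.
Variables (R : realType) (n : nat).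
Local Notation E := 'rV[R]_n.
Local Notation m_n := (lebesgue_rV R n).

(** Positive exactly on the box where every [L * x_i] lies in [(-1, 1)]; the
    scale [L] is a parameter so that each scale is literally a [flat_expr]. *)
Definition bump (L : R) (x : E) : R :=
  \prod_i (flat 1 (1 + - L * x ord0 i) * flat 1 (1 + L * x ord0 i)).

Lemma bump_scale (L : R) x : bump L x = bump 1 (L *: x + 0).
Proof.
by apply: eq_bigr => i _; rewrite !mxE addr0 mulN1r mul1r mulNr.
Qed.

Lemma smooth_bump L : smooth (bump L).
Proof.
apply: smooth_flat_expr; rewrite /bump.
elim: index_enum => [|i s IH].
  under eq_fun do rewrite big_nil; exact: flat_expr_cst.
under eq_fun do rewrite big_cons.
by apply: flat_exprM => //; apply: flat_exprM; exact: flat_expr_coord.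
Qed.

Lemma flat1_ge0 t : 0 <= flat (1 : {poly R}) t.
Proof.
by rewrite /flat; case: ifPn => // _; rewrite hornerE mul1r expR_ge0.
Qed.

Lemma bump_ge0 L x : 0 <= bump L x.
Proof. by apply: prodr_ge0 => i _; apply: mulr_ge0; exact: flat1_ge0. Qed.

Lemma bump_vanishes (L : R) : 0 < L -> vanishes_off 0 L (bump L^-1).
Proof.
move=> L0 x; rewrite subr0 => Lx; rewrite /bump.
have [i Li] : exists i, L < `|x ord0 i|.
  apply: contrapT => /forallNP xL; suff : `|x| <= L by rewrite leNgt Lx.
  apply: norm_le_coord => [|i]; first exact: ltW.
  by rewrite leNgt; exact/negP.
rewrite (bigD1 i)//= (_ : _ * _ = 0) ?mul0r//.
have flat0 t : t <= 0 -> flat (1 : {poly R}) t = 0.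
  by move=> t0; rewrite /flat ltNge t0.
have [xi0|xi0] := leP 0 (x ord0 i).
  rewrite (flat0 (1 + - L^-1 * _)) ?mul0r//.
  move: Li; rewrite ger0_norm// mulNr subr_le0 => /ltW.
  by rewrite ler_pdivlMl// mulr1.
have fL : 1 + L^-1 * x ord0 i <= 0.
  move: Li; rewrite ltr0_norm// => /ltW.
  by rewrite -lerBrDl sub0r ler_pdivrMl// mulrN1 lerNr.
by rewrite (flat0 _ fL) mulr0 mul0r.
Qed.

(** Finiteness: the bump is bounded and lives in the unit box.  Positivity: each
    of its [2 * n] factors is at least [exp(-2)] on the box of radius [1/2]. *)
Lemma integral_bump : exists2 Z : R, 0 < Z &
  (\int[m_n]_x (bump 1 x)%:E = Z%:E)%E.
Proof.
have b0 : vanishes_off 0 1 (bump 1) by have := bump_vanishes (@ltr01 R); rewrite invr1.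
have [C C0 bC] := continuous_vanishing_bounded (smooth_continuous (smooth_bump 1)) b0.
have mb : measurable_fun setT (EFin \o bump 1).
  by apply/measurable_EFinP; apply: smooth_measurable; exact: smooth_bump.
have ibox (k : R) (r : R) : 0 <= r -> 0 <= k ->
    (\int[m_n]_x (k * \1_(box 0 r) x)%:E = (k * (2 * r) ^+ n)%:E)%E.
  move=> r0 k0; under eq_integral do rewrite EFinM.
  rewrite ge0_integralZl//; last first.
    by apply/measurable_EFinP; exact: measurable_indic (measurable_box _ _).
  rewrite integral_indic ?setIT//; last exact: measurable_box.
  by rewrite [X in (_ * X)%E]box_lebesgue.
have ble : (\int[m_n]_x (bump 1 x)%:E <= (C * (2 * 1) ^+ n)%:E)%E.
  rewrite -ibox//; apply: ge0_le_integral => //.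
  - by move=> x _; rewrite lee_fin bump_ge0.
  - apply/measurable_EFinP; apply: measurable_funM => //.
    exact: measurable_indic (measurable_box _ _).
  move=> x _; rewrite lee_fin indicE; have [_|xB] := boolP (x \in box 0 1).
    by rewrite mulr1 (le_trans (ler_norm _)).
  by move: xB; rewrite notin_setE /box/= => /negP; rewrite -ltNge mulr0 => /b0 ->.
pose k : R := \prod_(i < n) (expR (- 2) * expR (- 2)).
have k0 : 0 < k by apply: prodr_gt0 => i _; rewrite mulr_gt0// expR_gt0.
have leb : ((k * (2 * (1 / 2)) ^+ n)%:E <= \int[m_n]_x (bump 1 x)%:E)%E.
  rewrite -ibox//; last exact: ltW.
  apply: ge0_le_integral => //.
  - by move=> x _; rewrite lee_fin mulr_ge0// ltW.
  - apply/measurable_EFinP; apply: measurable_funM => //.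
    exact: measurable_indic (measurable_box _ _).
  move=> x _; rewrite lee_fin indicE; have [/set_mem xB|xB] := boolP (x \in box 0 (1 / 2)); last first.
    by rewrite mulr0 bump_ge0.
  have flatx t : 1 / 2 <= t -> expR (- 2) <= flat (1 : {poly R}) t.
    move=> ht; have t0 : 0 < t by apply: lt_le_trans ht.
    rewrite /flat t0 hornerE mul1r ler_expR lerN2 -[leRHS]invrK lef_pV2 ?posrE//.
    by rewrite -[leLHS]mul1r.
  rewrite mulr1; apply: ler_prod => i _; rewrite mulr_ge0 ?expR_ge0//=.
  have := le_trans (coord_le_norm _ i) xB; rewrite subr0 ler_norml => xi.
  by apply: ler_pM; rewrite ?expR_ge0//; apply: flatx; lra.
exists (fine (\int[m_n]_x (bump 1 x)%:E)%E).
  rewrite fine_gt0//; apply/andP; split; last exact: le_lt_trans ble (ltry _).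
  by apply: lt_le_trans leb; rewrite lte_fin mulr_gt0// exprn_gt0// divff// mulr1.
rewrite fineK// fin_numElt (le_lt_trans ble (ltry _)) andbT.
by apply: lt_le_trans leb; exact: ltNyr.
Qed.

(** A single profile rescaled to [L^-n eta(x / L)]; each derivative costs one
    more power of [L], and the constant depends on the profile only. *)
Lemma exists_bump : exists2 C : R, 0 < C & forall L : R, 0 < L -> exists eta : E -> R,
  [/\ smooth eta, forall x, 0 <= eta x, vanishes_off 0 L eta,
      (\int[m_n]_x (eta x)%:E = 1)%E &
      forall i x, `|partial i eta x| <= C / L ^+ n.+1].
Proof.
have [Z Z0 ZE] := integral_bump.
have b0 : vanishes_off 0 1 (bump 1) by have := bump_vanishes (@ltr01 R); rewrite invr1.
have [C' C'0 CP] := smooth_bounded_partials (smooth_bump 1) b0.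
pose C := C' + 1; have C0 : 0 < C by rewrite ltr_wpDl.
exists (C / Z) => [|L L0]; first by rewrite divr_gt0.
pose k := (Z * L ^+ n)^-1.
have k0 : 0 < k by rewrite invr_gt0 mulr_gt0// exprn_gt0.
have L1 : 0 < L^-1 by rewrite invr_gt0.
pose eta x := k * bump L^-1 x; exists eta.
have etaE i : partial i eta = (fun x => k * partial i (bump L^-1) x).
  exact: partial_scale (smooth_bump _).
split.
- exact: smooth_scale (smooth_bump _).
- by move=> x; rewrite mulr_ge0 ?bump_ge0// ltW.
- by move=> x Lx; rewrite /eta bump_vanishes ?mulr0.
- under eq_integral do rewrite EFinM.
  have mb (M : R) : measurable_fun setT (EFin \o @bump M).
    by apply/measurable_EFinP; apply: smooth_measurable; exact: smooth_bump.
  have bp (M : R) x : (0 <= (bump M x)%:E)%E by rewrite lee_fin bump_ge0.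
  rewrite ge0_integralZl//; [|exact: mb|by rewrite lee_fin ltW].
  have := ge0_integral_affine 0 (lt0r_neq0 L1) (mb 1) (bp 1); rewrite ZE => ZE1.
  rewrite (eq_integral (fun x : E => (bump 1 (0 + L^-1 *: x))%:E)); last first.
    by move=> x _; rewrite bump_scale addrC.
  rewrite /k invfM EFinM -muleA [X in (_ * X)%E](_ : _ = Z%:E); last first.
    by rewrite -ZE1 (gtr0_norm L1) -exprVn.
  by rewrite -EFinM mulVf// gt_eqF.
- move=> i x; rewrite etaE normrM (gtr0_norm k0).
  have -> : bump L^-1 = (fun x => bump 1 (L^-1 *: x + 0)).
    by apply/funext => y; rewrite bump_scale.
  rewrite (partial_affine _ _ _ _ (smooth_bump 1)) normrM (gtr0_norm L1).
  rewrite [leRHS](_ : _ = k * (L^-1 * C)); last first.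
    rewrite /k exprS; field.
    by rewrite !gt_eqF// exprn_gt0.
  rewrite !ler_pM2l//.
  by rewrite (le_trans (CP _ _))// lerDl.
Qed.

End bump.

(** * Smoothing by a kernel *)

Lemma integral_reflect (R : realType) n (a : 'rV[R]_n) (f : 'rV[R]_n -> \bar R) :
  measurable_fun setT f ->
  (\int[lebesgue_rV R n]_x f (a - x)%R = \int[lebesgue_rV R n]_x f x)%E.
Proof.
move=> mf; rewrite integralE [RHS]integralE; congr (_ - _)%E.
  apply: etrans (ge0_integral_reflect a (measurable_funepos mf) (funepos_ge0 f)).
  by apply: eq_integral => x _; rewrite !unlock.
apply: etrans (ge0_integral_reflect a (measurable_funeneg mf) (funeneg_ge0 f)).
by apply: eq_integral => x _; rewrite !unlock.
Qed.

(** Neighbourhoods of row vectors are generated by entrywise balls; here they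
    are compared with the balls of the norm. *)
Lemma nbhs_of_ball (R : realType) n (x : 'rV[R]_n) (e : R) (P : set 'rV[R]_n) :
  0 < e -> (forall y, `|x - y| < e -> P y) -> nbhs x P.
Proof.
move=> e0 xP; have : nbhs x (ball x e) by exact: nbhsx_ballx.
apply: filterS => y [_ yP]; apply: xP; apply: le_lt_trans.
  apply: (@norm_le_coord _ _ (x - y) (\big[Order.max/0]_i `|x ord0 i - y ord0 i|)).
    exact: bigmax_ge_id.
  by move=> i; rewrite !mxE; exact: le_bigmax.
by apply/bigmax_ltP; split => // i _; exact: yP.
Qed.

Lemma finite_integrable_indic d (T : measurableType d) (R : realType)
    (mu : {measure set T -> \bar R}) (A : set T) :
  measurable A -> (mu A < +oo)%E -> mu.-integrable setT (EFin \o \1_A).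
Proof.
move=> mA Aoo; apply/integrableP; split.
  exact/measurable_EFinP/measurable_indic.
rewrite (eq_integral (fun x => (\1_A x)%:E)); first by rewrite integral_indic// setIT.
by move=> t _; rewrite gee0_abs// lee_fin.
Qed.

Section smoothing.
Variables (R : realType) (n : nat).
Local Notation E := 'rV[R]_n.
Local Notation m_n := (lebesgue_rV R n).
Variable k : E -> R.
Hypothesis ik : m_n.-integrable setT (EFin \o k).
Implicit Types (f : E -> R) (x y z : E).

(** Convolution with the reflection of [k], that is, the adjoint of
    convolution with [k]. *)
Definition smoothing f y : R := \int[m_n]_z (k z * f (y + z)).

Let mk : measurable_fun setT k.
Proof. by apply/measurable_EFinP; exact: measurable_int ik. Qed.

Lemma measurable_shift f y : measurable_fun setT f ->
  measurable_fun setT (fun z => f (y + z)).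
Proof.
move=> mf; apply: measurableT_comp mf _; apply: measurable_fun_rV => i.
under eq_fun do rewrite mxE.
by apply: measurable_funD => //; exact: measurable_coord_rV.
Qed.

Lemma smoothing_integrable f C y : measurable_fun setT f ->
  (forall x, `|f x| <= C) ->
  m_n.-integrable setT (fun z => (k z * f (y + z))%:E).
Proof.
move=> mf fC; under eq_fun do rewrite EFinM.
apply: integrableMl => //; first exact: measurable_shift.
exists C; split; first exact: num_real.
by move=> M CM z _ /=; rewrite (le_trans (fC _))// ltW.
Qed.

(** [f] is Lipschitz, having bounded partial derivatives, and averaging
    translates of a Lipschitz function preserves this property. *)
Lemma continuous_smoothing c r f : smooth f -> vanishes_off c r f ->
  continuous (smoothing f).
Proof.
move=> sf f0.
have [B B0 fB] := continuous_vanishing_bounded (smooth_continuous sf) f0.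
have [D D0 CD] := smooth_bounded_partials sf f0.
have lip := lipschitz_bounded_partials (smooth_derivable sf) CD.
pose K := \int[m_n]_z `|k z|.
have K0 : 0 <= K by exact: Rintegral_ge0.
have mf := smooth_measurable sf.
have FL y h : `|smoothing f (h + y) - smoothing f y| <= K * (n%:R * D * `|h|).
  rewrite /smoothing -RintegralB//; [|exact: smoothing_integrable fB..].
  have iB : m_n.-integrable setT
      (EFin \o (fun z => k z * f (h + y + z) - k z * f (y + z))).
    rewrite (_ : _ \o _ = (fun z => (k z * f (h + y + z))%:E) \-
      (fun z => (k z * f (y + z))%:E))%E//.
    by apply: integrableB => //; exact: smoothing_integrable fB.
  apply: le_trans (le_normr_Rintegral _ iB) _ => //.
  have ink : m_n.-integrable setT (EFin \o (fun z => `|k z|)) by exact: integrable_norm.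
  rewrite /K -RintegralZr//; apply: le_Rintegral => //.
  - exact: (integrable_norm iB).
  - have -> : EFin \o (fun z => `|k z| * (n%:R * D * `|h|)) =
        (fun z => (`|k z|%R)%:E * (n%:R * D * `|h|)%:E)%E.
      by apply/funext => z /=; rewrite EFinM.
    exact: integrableZr.
  move=> z _; rewrite -mulrBr normrM ler_wpM2l//.
  by rewrite -addrA.
pose M := K * (n%:R * D) + 1; have M0 : 0 < M by rewrite ltr_wpDl// !mulr_ge0.
move=> y; apply/(@cvgrPdist_le _ _ _ _ (@nbhs_filter E y)) => e e0.
suff : nbhs y [set x | `|smoothing f y - smoothing f x| <= e] by [].
apply: (@nbhs_of_ball _ _ _ (e / M)) => [|x yx]; first by rewrite divr_gt0.
rewrite /= distrC -[x](subrK y) (le_trans (FL _ _))//.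
rewrite mulrA (@le_trans _ _ (M * `|x - y|))//; first by rewrite ler_wpM2r// lerDl.
by rewrite mulrC -ler_pdivlMr// distrC ltW.
Qed.

(** Differentiation under the integral sign along the [i]-th axis, dominated
    by a multiple of [`|k|]. *)
Lemma is_derive_smoothing c r f i y : smooth f -> vanishes_off c r f ->
  is_derive y (delta_mx ord0 i) (smoothing f) (smoothing (partial i f) y).
Proof.
move=> sf f0; apply: is_derive_of_line.
have [B B0 fB] := continuous_vanishing_bounded (smooth_continuous sf) f0.
have [C C0 fC] := continuous_vanishing_bounded
  (smooth_continuous (smooth_partial i sf)) (partial_vanishes_off i f0).
pose g (t : R) (z : E) : R := k z * f (t *: delta_mx ord0 i + (y + z)).
have dg t z : is_derive t (1 : R) (g ^~ z)
    (k z * partial i f (t *: delta_mx ord0 i + (y + z))).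
  rewrite (_ : g ^~ z = k z *: (fun t => f (t *: delta_mx ord0 i + (y + z))))//.
  apply: is_deriveZ; apply: is_derive_line; apply/derivableP.
  exact: smooth_derivable.
have FE : (fun s : R => smoothing f (s *: delta_mx ord0 i + y)) =
    (fun t => \int[m_n]_(z in setT) g t z).
  by apply/funext => t; apply: eq_Rintegral => z _; rewrite /g addrA.
have a0 : `](-1), 1[%classic (0 : R) by rewrite /= in_itv/= ltrN10 ltr01.
have h1 t : `](-1), 1[%classic t -> m_n.-integrable setT (EFin \o g t).
  move=> _; rewrite /g (_ : _ \o _ =
    (fun z => (k z * f (t *: delta_mx ord0 i + y + z))%:E)).
    exact: smoothing_integrable (smooth_measurable sf) fB.
  by apply/funext => z /=; rewrite addrA.
have h2 t z : `](-1), 1[%classic t -> setT z -> derivable (g ^~ z) t 1.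
  by move=> _ _; have [] := dg t z.
have h3 z : 0 <= `|k z| * C by rewrite mulr_ge0.
have h4 : m_n.-integrable setT (EFin \o (fun z => `|k z| * C)).
  have -> : EFin \o (fun z => `|k z| * C) = (fun z => (`|k z|%R)%:E * C%:E)%E.
    by apply/funext => z /=; rewrite EFinM.
  by apply: integrableZr => //; exact: (integrable_norm ik).
have h5 t z : `](-1), 1[%classic t -> setT z -> `|partial1of2 g t z| <= `|k z| * C.
  move=> _ _; rewrite partial1of2E (derive_val (is_derive := dg t z)).
  by rewrite normrM ler_wpM2l.
rewrite FE; split.
  exact: (derivable_under_integral measurableT a0 h1 h2 h3 h4 h5).
rewrite -derive1E (differentiation_under_integral measurableT a0 h1 h2 h3 h4 h5).
apply: eq_Rintegral => z _; rewrite partial1of2E (derive_val (is_derive := dg 0 z)).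
by rewrite scale0r add0r.
Qed.

Lemma partial_smoothing c r f i : smooth f -> vanishes_off c r f ->
  partial i (smoothing f) = smoothing (partial i f).
Proof.
by move=> sf f0; apply/funext => y; have [] := is_derive_smoothing i y sf f0.
Qed.

Lemma smooth_smoothing c r f : smooth f -> vanishes_off c r f ->
  smooth (smoothing f).
Proof.
move=> sf f0 s.
have {f0 sf} [g sg [g0 ->]] : exists2 g, smooth g & vanishes_off c r g /\
    partials s (smoothing f) = smoothing g.
  elim: s => [|i s [g sg [g0 /= ->]]]; first by exists f.
  exists (partial i g); first exact: smooth_partial.
  by split; [exact: partial_vanishes_off|exact: partial_smoothing sg g0].
split; first exact: continuous_smoothing sg g0.
by move=> i x; have [] := is_derive_smoothing i x sg g0.
Qed.

Lemma smoothing_vanishes c r s f : vanishes_off c r f -> vanishes_off 0 s k ->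
  vanishes_off c (r + s) (smoothing f).
Proof.
move=> f0 k0 y yrs; rewrite /smoothing /Rintegral integral0_eq// => z _.
have [zs|/k0->] := leP `|z - 0| s; last by rewrite mul0r.
rewrite f0 ?mulr0// ltNge; apply: contraL yrs => yz; rewrite -leNgt.
have -> : y - c = (y + z - c) - (z - 0).
  by rewrite subr0 -!addrA (addrCA z) addrN addr0.
by rewrite (le_trans (ler_normB _ _))// lerD.
Qed.

Lemma smoothing_ge0 f y : (forall z, 0 <= k z) -> (forall z, 0 <= f z) ->
  0 <= smoothing f y.
Proof. by move=> k0 f0; apply: Rintegral_ge0 => z _; rewrite mulr_ge0. Qed.

End smoothing.

(** The integral of [z |-> f (y + z)] does not depend on [y]; its derivative in
    [y], taken under the integral sign, is the integral of the partial
    derivative. *)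
Lemma integral_partial0 (R : realType) n (f : 'rV[R]_n -> R) r i :
  smooth f -> vanishes_off 0 r f -> (forall x, 0 <= f x) ->
  (\int[lebesgue_rV R n]_x (partial i f x)%:E = 0)%E.
Proof.
move=> sf f0 fp.
have [r' [r0' fr']] : exists r', 0 <= r' /\ vanishes_off 0 r' f.
  exists `|r|; split => // x rx; apply: f0; exact: le_lt_trans (ler_norm _) rx.
(* the indicator of B serves as the kernel: B contains the supports of all the
   translates by vectors of norm at most 1, so it does not affect them *)
pose B := box (0 : 'rV[R]_n) (r' + 1); pose k : 'rV[R]_n -> R := \1_B.
have ik : (lebesgue_rV R n).-integrable setT (EFin \o k).
  apply: finite_integrable_indic; first exact: measurable_box.
  by rewrite [X in (X < _)%E]box_lebesgue ?ltry// addr_ge0.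
have [C C0 fC] := continuous_vanishing_bounded
  (smooth_continuous (smooth_partial i sf)) (partial_vanishes_off i f0).
have kE (g : 'rV[R]_n -> R) (y : 'rV[R]_n) : vanishes_off 0 r' g -> `|y| <= 1 ->
    smoothing k g y = \int[lebesgue_rV R n]_z g (y + z).
  move=> g0 y1; apply: eq_Rintegral => z _; rewrite /k indicE.
  have [_|zB] := boolP (z \in B); first by rewrite mul1r.
  rewrite mul0r g0// subr0.
  move: zB; rewrite notin_setE /B/box/= subr0 => /negP; rewrite -ltNge => zr.
  rewrite -[z](addKr y) in zr.
  have := lt_le_trans zr (ler_normD _ _); rewrite normrN; lra.
have [_ ] := is_derive_smoothing ik i 0 sf fr'.
rewrite kE ?normr0//; last exact: partial_vanishes_off.
rewrite (@near_eq_derive _ _ _ _ (cst (smoothing k f 0))) ?derive_cst; last first.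
  suff : nbhs (0 : 'rV[R]_n) [set y | smoothing k f y = cst (smoothing k f 0) y] by [].
  apply: (@nbhs_of_ball _ _ _ 1) => // y; rewrite sub0r normrN => y1.
  rewrite /= /cst !kE ?normr0//; last exact: ltW.
  rewrite /Rintegral; congr fine.
  have mf : measurable_fun setT (EFin \o f).
    by apply/measurable_EFinP; exact: smooth_measurable.
  rewrite (ge0_integral_shift y mf) ?(ge0_integral_shift 0 mf)// => x; by rewrite lee_fin.
rewrite /Rintegral; under eq_integral do rewrite add0r.
move=> If0; rewrite -[LHS]fineK -?If0//.
apply: integrable_fin_num => //.
rewrite (_ : (fun _ => _) = (fun z => (k z * partial i f (0 + z))%:E)).
  exact: smoothing_integrable (smooth_measurable (smooth_partial i sf)) fC.
apply/funext => z; rewrite add0r /k indicE; have [_|zB] := boolP (z \in B); first by rewrite mul1r.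
rewrite mul0r (partial_vanishes_off i fr')//.
move: zB; rewrite notin_setE /B/box/= subr0 => /negP; rewrite -ltNge; lra.
Qed.

(** * Averages over Euclidean balls *)

Lemma integral_shift (R : realType) n (a : 'rV[R]_n) (f : 'rV[R]_n -> \bar R) :
  measurable_fun setT f ->
  (\int[lebesgue_rV R n]_x f (a + x)%R = \int[lebesgue_rV R n]_x f x)%E.
Proof.
move=> mf; rewrite integralE [RHS]integralE; congr (_ - _)%E.
  apply: etrans (ge0_integral_shift a (measurable_funepos mf) (funepos_ge0 f)).
  by apply: eq_integral => x _; rewrite !unlock.
apply: etrans (ge0_integral_shift a (measurable_funeneg mf) (funeneg_ge0 f)).
by apply: eq_integral => x _; rewrite !unlock.
Qed.

Lemma measurable_fun_integral2 d1 d2 (T1 : measurableType d1)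
    (T2 : measurableType d2) (R : realType)
    (mu : {sigma_finite_measure set T2 -> \bar R}) (f : T1 * T2 -> \bar R) :
  measurable_fun setT f ->
  measurable_fun setT (fun x => \int[mu]_y f (x, y))%E.
Proof.
move=> mf.
have -> : (fun x => \int[mu]_y f (x, y))%E =
    ((fun x => \int[mu]_y f^\+ (x, y)) \- (fun x => \int[mu]_y f^\- (x, y)))%E.
  apply/funext => x /=; rewrite integralE; congr (_ - _)%E;
    by apply: eq_integral => y _; rewrite !unlock.
apply: emeasurable_funB; apply: measurable_fun_fubini_tonelli_F => //.
  exact: measurable_funepos.
exact: measurable_funeneg.
Qed.

Lemma EFin_Rintegral d (T : measurableType d) (R : realType)
    (mu : {measure set T -> \bar R}) (f : T -> R) :
  mu.-integrable setT (EFin \o f) ->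
  ((\int[mu]_x f x)%R%:E = \int[mu]_x (f x)%:E)%E.
Proof. by move=> fi; rewrite /Rintegral fineK//; exact: integrable_fin_num. Qed.

Section measurable_vector_operations.
Variables (R : realType) (n : nat) (d : measure_display) (T : measurableType d).
Implicit Types (f g : T -> 'rV[R]_n) (s : T -> R).

Lemma measurable_rV_coord f i : measurable_fun setT f ->
  measurable_fun setT (fun t => f t ord0 i).
Proof. by move=> mf; exact: measurableT_comp (measurable_coord_rV i) mf. Qed.

Lemma measurable_rVD f g : measurable_fun setT f -> measurable_fun setT g ->
  measurable_fun setT (fun t => f t + g t).
Proof.
move=> mf mg; apply: measurable_fun_rV => i; under eq_fun do rewrite mxE.
by apply: measurable_funD; exact: measurable_rV_coord.
Qed.

Lemma measurable_rVB f g : measurable_fun setT f -> measurable_fun setT g ->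
  measurable_fun setT (fun t => f t - g t).
Proof.
move=> mf mg; apply: measurable_fun_rV => i; under eq_fun do rewrite !mxE.
by apply: measurable_funB; exact: measurable_rV_coord.
Qed.

Lemma measurable_rVZ s f : measurable_fun setT s -> measurable_fun setT f ->
  measurable_fun setT (fun t => s t *: f t).
Proof.
move=> ms mf; apply: measurable_fun_rV => i; under eq_fun do rewrite !mxE.
by apply: measurable_funM => //; exact: measurable_rV_coord.
Qed.

End measurable_vector_operations.

Section averaging_kernel.
Variables (R : realType) (n : nat).
Local Notation E := 'rV[R]_n.
Local Notation m_n := (lebesgue_rV R n).
Implicit Types (x y z : E) (r : R).

Lemma measurable_enorm : measurable_fun setT (@enorm R n).
Proof.
apply: measurableT_comp; first exact: continuous_measurable_fun (@sqrt_continuous R).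
rewrite /dotp; apply: measurable_sum => i.
by apply: measurable_funM; exact: measurable_coord_rV.
Qed.

Lemma measurable_eball r : measurable (@eball R n r).
Proof.
rewrite -[X in measurable X]setTI.
have := measurable_enorm measurableT (measurable_itv `]-oo, r[).
by congr measurable; apply/seteqP; split => x /=; rewrite in_itv.
Qed.

Lemma eball_sub_box r : eball r `<=` box (0 : E) r.
Proof.
by move=> x /= xr; rewrite /box/= subr0 (le_trans (norm_le_enorm x))// ltW.
Qed.

Lemma box_sub_eball r : 0 < r -> box (0 : E) (r / (2 * n.+1%:R)) `<=` eball r.
Proof.
move=> r0 x; rewrite /box/= subr0 => xr; apply: (le_lt_trans (enorm_le_norm x)).
apply: (@le_lt_trans _ _ (n.+1%:R * (r / (2 * n.+1%:R)))).
  by rewrite ler_pM// ler_nat.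
rewrite invfM mulrCA (mulrCA n.+1%:R) mulfV ?pnatr_eq0// mulr1.
by rewrite ltr_pdivrMr// mulr_natr mulr2n ltrDl.
Qed.

(** The left-hand side is the volume of the box of radius [r / (2 * n.+1)], which
    fits in the ball because [enorm x <= n * `|x|]. *)
Lemma eball_lebesgue_ge r : 0 < r ->
  (((r / n.+1%:R) ^+ n)%:E <= m_n (eball r))%E.
Proof.
move=> r0; have : (m_n (box (0 : E) (r / (2 * n.+1%:R))) <= m_n (eball r))%E.
  by apply: le_measure; rewrite ?inE; [exact: measurable_box|exact: measurable_eball|exact: box_sub_eball].
rewrite box_lebesgue; last by rewrite divr_ge0// ltW.
congr (_%:E <= _)%E; congr (_ ^+ _).
by rewrite invfM mulrCA [2 * _]mulrA mulfV// mul1r.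
Qed.

Lemma eball_lebesgue_lty r : 0 < r -> (m_n (eball r) < +oo)%E.
Proof.
move=> r0; apply: (@le_lt_trans _ _ (m_n (box (0 : E) r))).
  by apply: le_measure; rewrite ?inE; [exact: measurable_eball|exact: measurable_box|exact: eball_sub_box].
by rewrite [X in (X < _)%E]box_lebesgue ?ltry// ltW.
Qed.

Lemma eball_lebesgue_gt0 r : 0 < r -> (0 < m_n (eball r))%E.
Proof.
move=> r0; apply: lt_le_trans (eball_lebesgue_ge r0).
by rewrite lte_fin exprn_gt0// divr_gt0.
Qed.

Lemma eball_volume_gt0 r : 0 < r -> 0 < fine (m_n (eball r)).
Proof. by move=> r0; rewrite fine_gt0// eball_lebesgue_gt0//= eball_lebesgue_lty. Qed.

Variable r : R.
Hypothesis r0 : 0 < r.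
Local Notation chi := (@chi R n r).

Lemma chi_ge0 x : 0 <= chi x.
Proof. by rewrite mulr_ge0// invr_ge0 fine_ge0. Qed.

Lemma chi_le x : chi x <= (fine (m_n (eball r)))^-1.
Proof.
by rewrite -[leRHS]mulr1 ler_wpM2l// ?invr_ge0 ?fine_ge0.
Qed.

Lemma chi_vanishes : vanishes_off 0 r chi.
Proof.
move=> x xr; rewrite /chi indicE memNset ?mulr0// => /eball_sub_box.
by rewrite /box/= leNgt xr.
Qed.

Lemma measurable_chi : measurable_fun setT chi.
Proof. by apply: measurable_funM => //; apply: measurable_indic; exact: measurable_eball. Qed.

Lemma integrable_chi : m_n.-integrable setT (EFin \o chi).
Proof.
rewrite (_ : _ \o _ = (fun x => (fine (m_n (eball r)))^-1%:E * (\1_(eball r) x)%:E)%E); last first.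
  by apply/funext => x /=; rewrite EFinM.
apply: integrableZl => //; apply: finite_integrable_indic; first exact: measurable_eball.
exact: eball_lebesgue_lty.
Qed.

Lemma integral_chi : (\int[m_n]_x (chi x)%:E = 1)%E.
Proof.
under eq_integral do rewrite EFinM.
rewrite ge0_integralZl//; last 2 first.
- by apply/measurable_EFinP; apply: measurable_indic; exact: measurable_eball.
- by rewrite lee_fin invr_ge0 fine_ge0.
rewrite integral_indic ?setIT//; last exact: measurable_eball.
rewrite -[X in (_ * X)%E]fineK; last by rewrite ge0_fin_numE// eball_lebesgue_lty.
by rewrite -EFinM mulVf// gt_eqF// eball_volume_gt0.
Qed.

(** Averaging against a probability density preserves the integral. *)
Lemma integral_smoothing (f : E -> R) C : measurable_fun setT f ->
  (forall x, 0 <= f x <= C) ->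
  (\int[m_n]_y (smoothing chi f y)%:E = \int[m_n]_y (f y)%:E)%E.
Proof.
move=> mf fC.
have fC' x : `|f x| <= C by have /andP[f0 fxC] := fC x; rewrite ger0_norm.
under eq_integral do rewrite EFin_Rintegral ?(smoothing_integrable integrable_chi _ mf fC')//.
have mH : measurable_fun setT (fun p : E * E => (chi p.2 * f (p.1 + p.2))%:E).
  apply/measurable_EFinP; apply: measurable_funM.
    exact: measurableT_comp measurable_chi measurable_snd.
  apply: measurableT_comp mf _; apply: measurable_fun_rV => i.
  under eq_fun do rewrite mxE.
  by apply: measurable_funD; apply: measurableT_comp (measurable_coord_rV i) _.
rewrite (fubini_tonelli (fun p : E * E => (chi p.2 * f (p.1 + p.2))%:E)) => //; last first.
  by move=> [y z]; rewrite lee_fin mulr_ge0 ?chi_ge0//; have /andP[] := fC (y + z).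
have f0 x : (0 <= (f x)%:E)%E by rewrite lee_fin; have /andP[] := fC x.
have mEf : measurable_fun setT (EFin \o f) by exact/measurable_EFinP.
transitivity (\int[m_n]_z ((\int[m_n]_y (f y)%:E) * (chi z)%:E))%E.
  apply: eq_integral => z _ /=; under eq_integral do rewrite EFinM addrC.
  rewrite ge0_integralZl//; last by rewrite lee_fin chi_ge0.
    rewrite muleC; congr (_ * _)%E.
    exact: (ge0_integral_shift z mEf f0).
  by apply/measurable_EFinP; exact: measurable_shift.
rewrite ge0_integralZl//.
- by rewrite integral_chi mule1.
- by apply/measurable_EFinP; exact: measurable_chi.
- by move=> z _; rewrite lee_fin chi_ge0.
- by apply: integral_ge0 => y _.
Qed.

End averaging_kernel.

Lemma integral_smoothing_integrable (R : realType) n (r : R) (f : 'rV[R]_n -> R) C :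
  0 < r -> measurable_fun setT f -> (forall x, `|f x| <= C) ->
  (lebesgue_rV R n).-integrable setT (EFin \o f) ->
  (\int[lebesgue_rV R n]_y (smoothing (chi r) f y)%:E =
   \int[lebesgue_rV R n]_y (f y)%:E)%E.
Proof.
move=> r0 mf fC fi; set m := lebesgue_rV R n.
have ik : m.-integrable setT (EFin \o @chi R n r) by exact: integrable_chi.
under eq_integral do rewrite EFin_Rintegral ?(smoothing_integrable ik _ mf fC)//.
pose H (p : 'rV[R]_n * 'rV[R]_n) : \bar R := (chi r p.2 * f (p.1 + p.2))%:E.
have mH : measurable_fun setT H.
  apply/measurable_EFinP; apply: measurable_funM.
    exact: measurableT_comp (measurable_chi r) measurable_snd.
  by apply: measurableT_comp mf _; exact: measurable_rVD.
have mEf : measurable_fun setT (EFin \o f) by exact/measurable_EFinP.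
have mfz z : measurable_fun setT (fun y : 'rV[R]_n => (f (y + z)%R)%:E).
  apply/measurable_EFinP; apply: measurableT_comp mf _; exact: measurable_rVD.
have iH : (m \x m)%E.-integrable setT H.
  apply/integrable21ltyP => //.
  rewrite (eq_integral (fun z => (\int[m]_y `|f y|%:E) * (chi r z)%:E)%E).
    rewrite ge0_integralZl//.
    - rewrite integral_chi// mule1; have := integrable_lty measurableT (integrable_abse fi).
      by [].
    - by apply/measurable_EFinP; exact: measurable_chi.
    - by move=> z _; rewrite lee_fin chi_ge0.
    - by apply: integral_ge0 => y _; rewrite lee_fin.
  move=> z _; under eq_integral do rewrite /H/= normrM (ger0_norm (chi_ge0 r z)) EFinM.
  rewrite ge0_integralZl//.
  - rewrite muleC; congr (_ * _)%E; rewrite -[RHS](integral_shift z (f := fun y => `|f y|%:E)).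
      by apply: eq_integral => y _; rewrite addrC.
    by apply/measurable_EFinP; exact: measurableT_comp.
  - by apply/measurable_EFinP; apply: measurableT_comp => //; apply/measurable_EFinP; exact: mfz.
  - by rewrite lee_fin chi_ge0.
rewrite [LHS](Fubini iH).
rewrite (eq_integral (fun z => (chi r z)%:E * \int[m]_y (f y)%:E)%E).
  have fI : (\int[m]_y (f y)%:E)%E \is a fin_num by exact: (integrable_fin_num _ fi).
  rewrite -(fineK fI) integralZr//.
  by rewrite integral_chi// mul1e.
move=> z _; rewrite -(integral_shift z mEf).
under eq_integral do rewrite /H/= EFinM addrC.
rewrite integralZl//.
apply/integrableP; split; first by under eq_fun do rewrite addrC; exact: mfz.
have /integrableP[_] := fi.
rewrite -(integral_shift z)//; exact: measurableT_comp.
Qed.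

Section averaged_field.
Variables (R : realType) (n : nat).
Local Notation E := 'rV[R]_n.
Local Notation m_n := (lebesgue_rV R n).
Variables (v : E -> E) (r : R).
Hypotheses (r0 : 0 < r) (vloc : locally_integrable_field v).
Local Notation chi := (@chi R n r).
Implicit Types (x y z : E) (i : 'I_n).

Let vi i y : R := v y ord0 i.

Lemma measurable_field_coord i : measurable_fun setT (vi i).
Proof. exact: measurableT_comp (measurable_coord_rV i) vloc.1. Qed.

Let mkernel i : measurable_fun setT (fun p : E * E => vi i p.2 * chi (p.1 - p.2)).
Proof.
apply: measurable_funM.
  exact: measurableT_comp (measurable_field_coord i) measurable_snd.
apply: measurableT_comp (measurable_chi r) _; apply: measurable_fun_rV => j.
under eq_fun do rewrite !mxE.
apply: measurable_funB; by apply: measurableT_comp (measurable_coord_rV j) _.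
Qed.

Lemma measurable_conv_coord i : measurable_fun setT (Defs.conv (vi i) chi).
Proof.
have := @measurable_fun_integral2 _ _ E E R m_n
  (fun p => (vi i p.2 * chi (p.1 - p.2))%:E).
move=> /(_ ltac:(exact/measurable_EFinP)) mI.
exact: (measurableT_comp (fine_measurable (@measurableT _ (\bar R))) mI).
Qed.

Lemma integrable_field_box i c s (f : E -> R) C :
  measurable_fun setT f -> (forall x, `|f x| <= C) -> vanishes_off c s f ->
  m_n.-integrable setT (fun y => (vi i y * f y)%:E).
Proof.
move=> mf fC f0.
have := vloc.2 i _ (@compact_box _ _ c s).
move=> /(integrable_mkcond _ (measurable_box c s)) vB.
rewrite (_ : (fun _ => _) = (fun y => (((fun x => (v x ord0 i)%:E) \_ (box c s)) y * (f y)%:E)%E)).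
  apply: integrableMl => //.
  exists C; split; first exact: num_real.
  by move=> M CM z _ /=; rewrite (le_trans (fC _))// ltW.
apply/funext => y; rewrite patchE; case: ifPn => [_|]; first by rewrite EFinM.
by rewrite notin_setE /box/= => /negP; rewrite -ltNge => /f0 ->; rewrite mulr0 mul0e.
Qed.

Lemma integrable_conv_kernel i x :
  m_n.-integrable setT (fun y => (vi i y * chi (x - y))%:E).
Proof.
apply: (@integrable_field_box _ x r _ (fine (m_n (eball r)))^-1).
- apply: measurableT_comp (measurable_chi r) _; apply: measurable_fun_rV => j.
  under eq_fun do rewrite !mxE.
  by apply: measurable_funB => //; exact: measurable_coord_rV.
- by move=> y; rewrite ger0_norm ?chi_ge0 ?chi_le.
- by move=> y xy; apply: chi_vanishes; rewrite subr0 distrC.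
Qed.

(** The adjunction between convolution and smoothing: averaging the field
    amounts to averaging the test function.  This is how a bound on [v * chi],
    rather than on [v], gives information on [nu]. *)
Lemma integral_conv_smoothing i c s (f : E -> R) C :
  measurable_fun setT f -> (forall x, `|f x| <= C) -> vanishes_off c s f ->
  (\int[m_n]_y (vi i y * smoothing chi f y)%:E =
   \int[m_n]_x (Defs.conv (vi i) chi x * f x)%:E)%E.
Proof.
move=> mf fC f0.
have C0 : 0 <= C by apply: le_trans (fC 0).
pose H (p : E * E) : \bar R := (vi i p.1 * chi (p.2 - p.1) * f p.2)%:E.
have mH : measurable_fun setT H.
  apply/measurable_EFinP; apply: measurable_funM; last first.
    exact: measurableT_comp mf measurable_snd.
  apply: measurable_funM.
    exact: measurableT_comp (measurable_field_coord i) measurable_fst.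
  apply: measurableT_comp (measurable_chi r) _; exact: measurable_rVB.
have smE y : smoothing chi f y = \int[m_n]_x (chi (x - y) * f x).
  rewrite /smoothing /Rintegral; congr fine.
  rewrite -[RHS](integral_shift y); last first.
    apply/measurable_EFinP; apply: measurable_funM => //.
    apply: measurableT_comp (measurable_chi r) _; apply: measurable_fun_rV => j.
    under eq_fun do rewrite !mxE.
    by apply: measurable_funB => //; exact: measurable_coord_rV.
  by apply: eq_integral => z _; rewrite addrAC subrr add0r.
pose D := (fine (m_n (eball r)))^-1 * C.
have D0 : 0 <= D by rewrite mulr_ge0// invr_ge0 fine_ge0.
have Hle p : (`|H p| <= (`|vi i p.1| * \1_(box c (s + r)) p.1)%:E *
    (D * \1_(box c s) p.2)%:E)%E.
  rewrite /H abse_EFin -EFinM lee_fin !indicE.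
  have P0 : 0 <= `|vi i p.1| * (p.1 \in box c (s + r))%:R * (D * (p.2 \in box c s)%:R).
    by apply: mulr_ge0; apply: mulr_ge0; rewrite ?ler0n.
  have [xs|xs] := leP `|p.2 - c| s; last first.
    by rewrite (f0 _ xs) mulr0 normr0.
  have [yx|yx] := leP `|p.2 - p.1| r; last first.
    by rewrite (@chi_vanishes _ _ r) ?subr0// mulr0 mul0r normr0.
  rewrite mem_set ?mulr1; last first.
    rewrite /box/= -[p.1](subrK p.2) -addrA [s + r]addrC.
    by rewrite (le_trans (ler_normD _ _))// lerD// distrC.
  rewrite mem_set ?mulr1//.
  rewrite normrM normrM -mulrA ler_wpM2l// /D ler_pM//.
  by rewrite ger0_norm ?chi_ge0 ?chi_le.
have i2 : m_n.-integrable setT (fun x => (D * \1_(box c s) x)%:E).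
  under eq_fun do rewrite EFinM.
  apply: integrableZl => //; apply: finite_integrable_indic.
    exact: measurable_box.
  have [s0|s0] := leP 0 s; first by rewrite [X in (X < _)%E]box_lebesgue// ltry.
  rewrite (_ : box c s = set0) ?measure0//; apply/seteqP; split => // x.
  by rewrite /box/= => /le_lt_trans/(_ s0); rewrite ltNge normr_ge0.
have i3 y : m_n.-integrable setT (fun x => (chi (x - y) * f x)%:E).
  apply: le_integrable i2 => //.
    apply/measurable_EFinP; apply: measurable_funM => //.
    by apply: measurableT_comp (measurable_chi r) _; exact: measurable_rVB.
  move=> x _; rewrite !abse_EFin lee_fin indicE.
  have [xs|xs] := leP `|x - c| s; last by rewrite (f0 _ xs) mulr0 normr0.
  rewrite mem_set// mulr1 (ger0_norm D0) normrM /D ler_pM//.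
  by rewrite ger0_norm ?chi_ge0 ?chi_le.
have iH : (m_n \x m_n)%E.-integrable setT H.
  apply/integrable12ltyP => //.
  pose F y : \bar R := ((`|vi i y| * \1_(box c (s + r)) y)%:E *
     \int[m_n]_x (D * \1_(box c s) x)%:E)%E.
  have i1 : m_n.-integrable setT (fun y => (`|vi i y| * \1_(box c (s + r)) y)%:E).
    have := @integrable_field_box i c (s + r) \1_(box c (s + r)) 1.
    move=> /(_ ltac:(exact: measurable_indic (measurable_box _ _))).
    move=> /(_ ltac:(by move=> x; rewrite indicE; case: (_ \in _); rewrite ?normr0 ?normr1)).
    move=> /(_ ltac:(by move=> x xs; rewrite indicE memNset// /box/= => /le_lt_trans/(_ xs); rewrite ltxx)).
    move/integrable_abse; apply: eq_integrable => // y _ /=.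
    by rewrite normrM (ger0_norm (_ : 0 <= \1__ _)).
  apply: (@le_lt_trans _ _ (\int[m_n]_y F y)%E).
    apply: ge0_le_integral => //.
    - by move=> y _; exact: integral_ge0.
    - have mHa : measurable_fun setT (abse \o H) by apply: measurableT_comp.
      by apply: (measurable_fun_fubini_tonelli_F (abse \o H)) => // p; exact: abse_ge0.
    - apply: emeasurable_funM => //; exact: measurable_int i1.
    move=> y _; rewrite /F.
    have m2 : measurable_fun setT (fun x => (D * \1_(box c s) x)%:E) by exact: measurable_int i2.
    have p2 x : (0 <= (D * \1_(box c s) x)%:E)%E by rewrite lee_fin mulr_ge0.
    have q1 : (0 <= (`|vi i y| * \1_(box c (s + r)) y)%:E)%E by rewrite lee_fin mulr_ge0.
    rewrite -(ge0_integralZl _ measurableT m2)//; apply: ge0_le_integral => //.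
    - apply: (@measurableT_comp _ _ _ _ _ _ abse) => //.
      exact: measurableT_comp mH _.
    - exact: emeasurable_funM.
  have I2 : (\int[m_n]_x (D * \1_(box c s) x)%:E \is a fin_num)%E.
    exact: integrable_fin_num.
  rewrite /F -(fineK I2).
  have := integrable_lty measurableT (integrableZr measurableT (fine (\int[m_n]_x (D * \1_(box c s) x)%:E)%E) i1).
  by [].
transitivity (\int[m_n]_y \int[m_n]_x H (y, x))%E.
  apply: eq_integral => y _; rewrite smE EFinM EFin_Rintegral; last exact: i3.
  rewrite -(integralZl measurableT (i3 y)).
  by apply: eq_integral => x _; rewrite /H /= -EFinM mulrA.
rewrite (Fubini iH); apply: eq_integral => x _.
rewrite EFinM /Defs.conv EFin_Rintegral; last exact: integrable_conv_kernel.
rewrite muleC -(integralZl measurableT (integrable_conv_kernel i x)).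
by apply: eq_integral => y _; rewrite /H /= muleC -EFinM.
Qed.

End averaged_field.

(** * Transportations built from kernels *)

Section sigma_finite_copy.
Context d (T : measurableType d) (R : realType) (mu : {measure set T -> \bar R}).
Hypothesis smu : sigma_finite setT mu.

(** A copy of [mu] that carries the proof of sigma-finiteness as structure, in
    the form in which the theorems of Tonelli and Fubini use it. *)
Definition as_sigma_finite of sigma_finite setT mu : set T -> \bar R := mu.

HB.instance Definition _ := Measure.copy (as_sigma_finite smu) mu.

HB.instance Definition _ :=
  Measure_isSigmaFinite.Build _ _ _ (as_sigma_finite smu) smu.

End sigma_finite_copy.

Section measure_constructions.
Local Open Scope ereal_scope.

Lemma exists_density d (T : measurableType d) (R : realType)
    (mu : {measure set T -> \bar R}) (g : T -> \bar R) :
  measurable_fun setT g -> (forall x, 0 <= g x) ->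
  exists gamma : {measure set T -> \bar R},
    forall A, gamma A = \int[mu]_(x in A) g x.
Proof.
move=> mg g0; pose rho A := \int[mu]_(x in A) g x.
have rho0 : rho set0 = 0 by rewrite /rho integral_set0.
have rho_ge0 A : 0 <= rho A by exact: integral_ge0.
have rhoU : semi_sigma_additive rho.
  move=> F mF tF mUF; rewrite /rho; apply: cvg_toP.
    apply: ereal_nondecreasing_is_cvgn => m n mn.
    by apply: lee_sum_nneg_natr => // k _ _; exact: rho_ge0.
  by rewrite ge0_integral_bigcup//=; exact: measurable_funTS.
pose M := isMeasure.Build _ _ _ rho rho0 rho_ge0 rhoU.
by pose gamma : {measure set T -> \bar R} := HB.pack rho M; exists gamma.
Qed.

(** Passes from marginals on sets to marginals on functions. *)
Lemma integral_image_measure d1 d2 (T1 : measurableType d1)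
    (T2 : measurableType d2) (R : realType) (mu1 : {measure set T1 -> \bar R})
    (mu2 : {measure set T2 -> \bar R}) (p : T1 -> T2) (f : T2 -> \bar R) :
  measurable_fun setT p -> (forall A, measurable A -> mu1 (p @^-1` A) = mu2 A) ->
  measurable_fun setT f ->
  \int[mu1]_x f (p x) = \int[mu2]_y f y.
Proof.
move=> mp mu12 mf.
have pos (h : T2 -> \bar R) : measurable_fun setT h -> (forall y, 0 <= h y) ->
    \int[mu1]_x h (p x) = \int[mu2]_y h y.
  move=> mh h0.
  pose m : {measure set T2 -> \bar R} :=
    measure_function_pushforward__canonical__measure_function_Measure mu1 mp.
  rewrite [RHS](eq_measure_integral m); last by move=> A mA _; rewrite /= -mu12.
  rewrite (ge0_integral_pushforward mp mu1 measurableT mh (fun y _ => h0 y)).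
  by rewrite preimage_setT.
rewrite integralE [RHS]integralE -(pos _ (measurable_funepos mf) (funepos_ge0 f)).
rewrite -(pos _ (measurable_funeneg mf) (funeneg_ge0 f)).
by congr (_ - _); apply: eq_integral => x _; rewrite !unlock.
Qed.

End measure_constructions.

Section locally_finite_measures.
Variables (R : realType) (n : nat).
Local Notation E := 'rV[R]_n.

Lemma locally_finite_sigma_finite (nu : {measure set E -> \bar R}) :
  locally_finite nu -> sigma_finite setT nu.
Proof.
move=> lf; exists (fun k => box (0 : E) k%:R).
  apply/esym; apply/seteqP; split => // x _.
  exists (Num.truncn `|x|).+1 => //; rewrite /box/= subr0 ltW//.
  by have /andP[] := truncn_itv (normr_ge0 x).
by move=> k; split; [exact: measurable_box|apply: lf; [exact: measurable_box|exact: bounded_box]].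
Qed.

Lemma bounded_prod_box (A : set (E * E)) : bounded_set A ->
  exists r, forall z, A z -> box (0 : E) r z.1 /\ box (0 : E) r z.2.
Proof.
move=> [M [_ AM]]; exists (`|M| + 1) => z Az.
have : `|z| <= `|M| + 1.
  by apply: AM => //; rewrite (le_lt_trans (ler_norm M))// ltrDl.
by rewrite /box/= !subr0 [`|z|]/Num.norm/= ge_max => /andP[].
Qed.

End locally_finite_measures.

Section plans_from_kernels.
Variables (R : realType) (n : nat).
Local Notation E := 'rV[R]_n.
Local Notation m_n := (lebesgue_rV R n).
Variables (nu : {sigma_finite_measure set E -> \bar R}) (k a : E * E -> R)
  (N : E -> R) (r s : R).
Hypotheses (nu_lf : locally_finite nu)
  (mk : measurable_fun setT k) (ma : measurable_fun setT a)
  (mN : measurable_fun setT N)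
  (k0 : forall p, 0 <= k p) (a0 : forall p, 0 <= a p) (N0 : forall q, 0 < N q)
  (kr : forall x q, r < `|x - q| -> k (x, q) = 0)
  (as_ : forall q y, s < `|y - q| -> a (q, y) = 0)
  (k1 : forall x, (\int[m_n]_q (k (x, q))%:E = 1)%E)
  (a1 : forall y, (\int[m_n]_q (a (q, y))%:E = 1)%E)
  (kN : forall q, (\int[nu]_x (k (x, q))%:E = (N q)%:E)%E)
  (aN : forall q, (\int[m_n]_y (a (q, y))%:E = (N q)%:E)%E).

Let K (z : (E * E) * E) : R := k (z.1.1, z.2) * a (z.2, z.1.2) / N z.2.

Let mK : measurable_fun setT K.
Proof.
apply: measurable_funM; first apply: measurable_funM.
- apply: measurableT_comp mk _; apply: measurable_fun_pair => //.
  exact: measurableT_comp measurable_fst measurable_fst.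
- apply: measurableT_comp ma _; apply: measurable_fun_pair => //.
  exact: measurableT_comp measurable_snd measurable_fst.
- rewrite (_ : (fun z => _) = (fun z => expR (- ln (N z.2)))); last first.
    by apply/funext => z; rewrite expRN lnK// posrE.
  apply: measurableT_comp => //; apply: measurableT_comp => //.
  apply: measurableT_comp; first exact: measurable_ln.
  exact: measurableT_comp mN measurable_snd.
Qed.

Let K0 z : 0 <= K z.
Proof. by rewrite /K !mulr_ge0// invr_ge0 ltW. Qed.

Let g (z : E * E) : \bar R := (\int[m_n]_q (K (z, q))%:E)%E.

Let mg : measurable_fun setT g.
Proof.
apply: (measurable_fun_fubini_tonelli_F (EFin \o K)).
- by apply/measurable_EFinP; exact: mK.
- by move=> z; rewrite lee_fin.
Qed.

Let g0 z : (0 <= g z)%E.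
Proof. by apply: integral_ge0 => q _; rewrite lee_fin. Qed.

Let mKx x : measurable_fun setT (fun p : E * E => (K ((x, p.1), p.2))%:E).
Proof.
apply/measurable_EFinP; apply: measurableT_comp mK _.
apply: measurable_fun_pair => //; exact: measurable_fun_pair.
Qed.

Let mKy y : measurable_fun setT (fun p : E * E => (K ((p.1, y), p.2))%:E).
Proof.
apply/measurable_EFinP; apply: measurableT_comp mK _.
apply: measurable_fun_pair => //; exact: measurable_fun_pair.
Qed.

Let mk2 q : measurable_fun setT (fun x => (k (x, q))%:E).
Proof. by apply/measurable_EFinP; apply: measurableT_comp mk _; exact: measurable_fun_pair. Qed.
Let ma1 q : measurable_fun setT (fun y => (a (q, y))%:E).
Proof. by apply/measurable_EFinP; apply: measurableT_comp ma _; exact: measurable_fun_pair. Qed.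

Let g_first x : (\int[m_n]_y g (x, y) = 1)%E.
Proof.
rewrite (fubini_tonelli (fun p : E * E => (K ((x, p.1), p.2))%:E)) => //=; last first.
  by move=> p; rewrite lee_fin.
rewrite -[RHS](k1 x); apply: eq_integral => q _.
under eq_integral do rewrite /K/= mulrAC EFinM.
rewrite ge0_integralZl//.
- by rewrite aN -EFinM mulfVK// gt_eqF.
- by move=> y _; rewrite lee_fin.
- by rewrite lee_fin divr_ge0// ltW.
Qed.

Let g_second y : (\int[nu]_x g (x, y) = 1)%E.
Proof.
rewrite (fubini_tonelli (fun p : E * E => (K ((p.1, y), p.2))%:E)) => //=; last first.
  by move=> p; rewrite lee_fin.
rewrite -[RHS](a1 y); apply: eq_integral => q _.
under eq_integral do rewrite /K/= -mulrA mulrC EFinM.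
rewrite ge0_integralZl//.
- by rewrite kN -EFinM mulfVK// gt_eqF.
- by move=> x _; rewrite lee_fin.
- by rewrite lee_fin divr_ge0// ltW.
Qed.

Let g_short z : r + s < `|z.1 - z.2| -> g z = 0%E.
Proof.
move=> rs; apply: integral0_eq => q _; rewrite /K/=.
have [xq|/kr->] := leP `|z.1 - q| r; last by rewrite !mul0r.
have [yq|/as_->] := leP `|z.2 - q| s; last by rewrite mulr0 mul0r.
suff : `|z.1 - z.2| <= r + s by rewrite leNgt rs.
rewrite -[z.1](subrK q) -addrA (le_trans (ler_normD _ _))// lerD//.
by rewrite distrC.
Qed.

(** Mass travels in two steps, from [x] to an intermediate point [q] with density
    [k (x, q)], then from [q] to [y] with density [a (q, y) / N q].  Here [N q] is
    both the mass that [q] receives from [nu] and the total mass of [a (q, _)],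
    so the second step sends out exactly what arrived; by [a1] the density of
    what reaches [y] is [1].  The joint law has density [g] with respect to
    [nu \x m_n] and is carried by pairs at distance at most [r + s]. *)
Lemma Tra_le_of_kernels : (Tra nu <= (n%:R * (r + s))%:E)%E.
Proof.
have [gamma gammaE] := exists_density (nu \x m_n)%E mg g0.
have fstE A : measurable A -> gamma (fst @^-1` A) = nu A.
  move=> mA; rewrite gammaE integral_mkcond.
  have -> : (g \_ (fst @^-1` A))%E = (fun z => g z * (\1_A z.1)%:E)%E.
    apply/funext => z; rewrite patchE indicE /=.
    have -> : (z \in fst @^-1` A) = (z.1 \in A) by apply/idP/idP; rewrite !inE.
    by case: ifP; rewrite ?mule1 ?mule0.
  have m1A : measurable_fun setT (fun z : E * E => (\1_A z.1)%:E : \bar R).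
    apply/measurable_EFinP; exact: measurableT_comp (measurable_indic mA) measurable_fst.
  rewrite (fubini_tonelli1 (fun z => g z * (\1_A z.1)%:E)%E) => //; last 2 first.
  - by apply: emeasurable_funM; [exact: mg|exact: m1A].
  - by move=> z; rewrite mule_ge0// lee_fin.
  transitivity (\int[nu]_x (\1_A x)%:E)%E; last by rewrite integral_indic// setIT.
  apply: eq_integral => x _; rewrite /fubini_F/= ge0_integralZr ?g_first ?mul1e ?lee_fin//.
  exact: measurableT_comp mg _.
have sndE A : measurable A -> gamma (snd @^-1` A) = m_n A.
  move=> mA; rewrite gammaE integral_mkcond.
  have -> : (g \_ (snd @^-1` A))%E = (fun z => g z * (\1_A z.2)%:E)%E.
    apply/funext => z; rewrite patchE indicE /=.
    have -> : (z \in snd @^-1` A) = (z.2 \in A) by apply/idP/idP; rewrite !inE.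
    by case: ifP; rewrite ?mule1 ?mule0.
  have m1A : measurable_fun setT (fun z : E * E => (\1_A z.2)%:E : \bar R).
    apply/measurable_EFinP; exact: measurableT_comp (measurable_indic mA) measurable_snd.
  rewrite (fubini_tonelli2 (fun z => g z * (\1_A z.2)%:E)%E) => //; last 2 first.
  - by apply: emeasurable_funM; [exact: mg|exact: m1A].
  - by move=> z; rewrite mule_ge0// lee_fin.
  transitivity (\int[m_n]_x (\1_A x)%:E)%E; last by rewrite integral_indic// setIT.
  apply: eq_integral => y _; rewrite /fubini_G/= ge0_integralZr ?g_second ?mul1e ?lee_fin//.
  exact: measurableT_comp mg _.
have gT : transportation nu m_n gamma.
  split.
  - move=> A mA /bounded_prod_box[t At].
    apply: (@le_lt_trans _ _ (nu (box 0 t))).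
      rewrite -fstE; last exact: measurable_box.
      apply: le_measure; rewrite ?inE//; last by move=> z /At[].
      by rewrite -[X in measurable X]setTI; apply: measurable_fst => //; exact: measurable_box.
    by apply: nu_lf; [exact: measurable_box|exact: bounded_box].
  - move=> phi cphi _.
    apply: (@integral_image_measure _ _ _ _ _ gamma nu fst (EFin \o phi)) => //.
    by apply/measurable_EFinP; exact: continuous_measurable_rV.
  - move=> phi cphi _.
    apply: (@integral_image_measure _ _ _ _ _ gamma m_n snd (EFin \o phi)) => //.
    by apply/measurable_EFinP; exact: continuous_measurable_rV.
have [rs0|rs0] := leP 0 (r + s); last first.
  have : (\int[m_n]_y g (0%R, y) = 0)%E.
    apply: integral0_eq => y _; apply: g_short; exact: lt_le_trans rs0 _.
  by rewrite g_first => /eqP; rewrite onee_eq0.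
apply: (@le_trans _ _ (maxe 0%E (ereal_sup [set (enorm (z.1 - z.2))%:E | z in spt gamma]))).
  by apply: ereal_inf_lbound; exists gamma.
rewrite ge_max lee_fin mulr_ge0//=; apply: ge_ereal_sup => _ [z zs <-].
rewrite lee_fin (le_trans (enorm_le_norm _))// ler_wpM2l//.
rewrite leNgt; apply/negP => zrs.
pose U : set (E * E) := [set z | r + s < `|z.1 - z.2|].
have oU : open U.
  apply: (@open_comp _ _ (fun z : E * E => `|z.1 - z.2|) [set t | r + s < t]); last exact: open_gt.
  move=> p _; apply: (@continuous_comp _ _ _ (fun z : E * E => z.1 - z.2) Num.norm).
    by apply: continuousB; [exact: cvg_fst|exact: cvg_snd].
  exact: norm_continuous.
have := zs U oU zrs; by rewrite gammaE integral0_eq ?ltxx.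
Qed.

End plans_from_kernels.

(** * From a connecting field to a transportation *)

Section bounded_compactly_supported_integrands.
Variables (R : realType) (n : nat).
Local Notation E := 'rV[R]_n.
Local Notation m_n := (lebesgue_rV R n).

Lemma locally_finite_lebesgue : locally_finite m_n.
Proof.
move=> A mA /bounded_subset_box[r r0 Ar].
apply: (@le_lt_trans _ _ (m_n (box 0 r))).
  by apply: le_measure; rewrite ?inE//; exact: measurable_box.
by rewrite [X in (X < _)%E]box_lebesgue ?ltry// ltW.
Qed.

Lemma bounded_vanishing_integrable (mu : {measure set E -> \bar R})
    (f : E -> R) C c s : locally_finite mu -> measurable_fun setT f ->
  (forall x, `|f x| <= C) -> vanishes_off c s f -> mu.-integrable setT (EFin \o f).
Proof.
move=> lf mf fC f0.
have C0 : 0 <= C by apply: le_trans (fC 0).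
have i1 : mu.-integrable setT (fun x => C%:E * (\1_(box c s) x)%:E)%E.
  apply: integrableZl => //; apply: finite_integrable_indic.
    exact: measurable_box.
  by apply: lf; [exact: measurable_box|exact: bounded_box].
apply: le_integrable i1 => //; first exact/measurable_EFinP.
move=> x _; rewrite -EFinM !abse_EFin lee_fin indicE.
have [xs|/f0->] := leP `|x - c| s; last by rewrite normr0.
by rewrite mem_set// mulr1 (ger0_norm C0).
Qed.

End bounded_compactly_supported_integrands.

Section field_to_plan.
Variables (R : realType) (n : nat).
Local Notation E := 'rV[R]_n.
Local Notation m_n := (lebesgue_rV R n).
Variables (nu : {sigma_finite_measure set E -> \bar R}) (v : E -> E) (r M L C1 : R).
Variable eta : E -> R.
Hypotheses (nu_lf : locally_finite nu) (vloc : locally_integrable_field v)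
  (vnu : connects v nu) (r0 : 0 < r)
  (vM : forall x, enorm (field_conv v (chi r) x) <= M)
  (L0 : 0 < L) (seta : smooth eta) (eta0 : forall x, 0 <= eta x)
  (etaL : vanishes_off 0 L eta) (eta1 : (\int[m_n]_x (eta x)%:E = 1)%E)
  (deta : forall i x, `|partial i eta x| <= C1 / L ^+ n.+1)
  (ML : 2 ^+ n.+1 * n%:R * C1 * M <= L).
Local Notation chi := (@chi R n r).

(* w is the averaged field, S the test function averaged in the same way *)
Let w (i : 'I_n) : E -> R := Defs.conv (fun y => v y ord0 i) chi.
Let S : E -> R := smoothing chi eta.
Let k (p : E * E) : R := S (p.1 - p.2).
(* the flux term in a compensates, at q, the difference between nu and Lebesgue
   measure as seen at scale L: see aN *)
Let a (p : E * E) : R := ((2 * L) ^+ n)^-1 * \1_(box 0 L) (p.2 - p.1) -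
  \sum_i w i p.2 * partial i eta (p.2 - p.1).
Let N (q : E) : R := fine (\int[nu]_x (k (x, q))%:E)%E.

Let ichi := @integrable_chi R n r r0.

Let B : {B : R | 0 <= B & forall x, eta x <= B}.
Proof.
apply: cid2.
have [B B0 BP] := continuous_vanishing_bounded (smooth_continuous seta) etaL.
by exists B => // x; exact: le_trans (ler_norm _) (BP x).
Qed.

Let etaB x : 0 <= eta x <= s2val B.
Proof. by rewrite eta0; case: B => /= b _; exact. Qed.

Let smS : smooth S. Proof. exact: smooth_smoothing ichi _ _ _ seta etaL. Qed.

Let SLr : vanishes_off 0 (L + r) S.
Proof. exact: smoothing_vanishes etaL (@chi_vanishes R n r). Qed.

Let S0 x : 0 <= S x.
Proof. by apply: smoothing_ge0 => // z; exact: chi_ge0. Qed.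

Let S1 : (\int[m_n]_x (S x)%:E = 1)%E.
Proof. by rewrite (integral_smoothing r0 (smooth_measurable seta) etaB). Qed.

Let msub d (T : measurableType d) (f : E -> R) (g h : T -> E) :
  measurable_fun setT f -> measurable_fun setT g -> measurable_fun setT h ->
  measurable_fun setT (fun t => f (g t - h t)).
Proof. by move=> mf mg mh; apply: measurableT_comp mf _; exact: measurable_rVB. Qed.

Let mk : measurable_fun setT k.
Proof. by apply: msub => //; exact: smooth_measurable. Qed.

Let mw i : measurable_fun setT (w i).
Proof. exact: measurable_conv_coord. Qed.

Let ma : measurable_fun setT a.
Proof.
apply: measurable_funB.
  apply: measurable_funM => //; apply: msub => //.
  exact: measurable_indic (measurable_box _ _).
apply: measurable_sum => i; apply: measurable_funM.
  exact: measurableT_comp (mw i) measurable_snd.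
by apply: msub => //; apply: smooth_measurable; exact: smooth_partial.
Qed.

Let wM i x : `|w i x| <= M.
Proof.
rewrite (le_trans _ (vM x))// (le_trans _ (norm_le_enorm _))//.
by rewrite (le_trans _ (coord_le_norm _ i))// mxE.
Qed.

Let M0 : 0 <= M.
Proof. exact: le_trans (sqrtr_ge0 _) (vM 0). Qed.

Let L2n : 0 < (2 * L) ^+ n. Proof. by rewrite exprn_gt0// mulr_gt0. Qed.

(* ML makes the flux term at most half of the height of the box term *)
Let a_lower q y :
  ((2 * L) ^+ n)^-1 / 2 * \1_(box 0 L) (y - q) <= a (q, y).
Proof.
rewrite /a/= indicE; have [yq|yq] := boolP ((y - q) \in _); last first.
  rewrite !mulr0 sub0r oppr_ge0 big1// => i _.
  rewrite (partial_vanishes_off i etaL) ?mulr0//.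
  by move: yq; rewrite notin_setE /box/= => /negP; rewrite -ltNge.
rewrite !mulr1 lerBrDr -lerBrDl.
rewrite [leRHS](_ : _ = ((2 * L) ^+ n)^-1 / 2); last by lra.
rewrite (le_trans (ler_norm _))// (le_trans (ler_norm_sum _ _ _))//.
apply: (@le_trans _ _ (\sum_(i < n) M * (C1 / L ^+ n.+1))).
  by apply: ler_sum => i _; rewrite normrM ler_pM.
rewrite sumr_const card_ord -[leLHS]mulr_natl.
have P0 : 0 < L ^+ n by rewrite exprn_gt0.
have T0 : 0 < 2 ^+ n :> R by rewrite exprn_gt0.
have D0 : 0 < (2 * 2 ^+ n * L * L ^+ n)^-1 by rewrite invr_gt0 !mulr_gt0.
rewrite [leLHS](_ : _ = 2 ^+ n.+1 * n%:R * C1 * M * (2 * 2 ^+ n * L * L ^+ n)^-1); last first.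
  by rewrite !exprS; field; rewrite !gt_eqF.
rewrite [leRHS](_ : _ = L * (2 * 2 ^+ n * L * L ^+ n)^-1); last first.
  by rewrite exprMn; field; rewrite !gt_eqF.
by rewrite ler_pM2r.
Qed.

Let a0 p : 0 <= a p.
Proof.
case: p => q y; apply: le_trans (a_lower q y).
by rewrite mulr_ge0// divr_ge0// invr_ge0 ltW.
Qed.

Let aL q y : L < `|y - q| -> a (q, y) = 0.
Proof.
move=> yq; rewrite /a/= indicE memNset ?mulr0; last by apply/negP; rewrite -ltNge subr0.
rewrite big1 ?subr0// => i _.
by rewrite (partial_vanishes_off i etaL) ?mulr0// subr0.
Qed.

Let kLr x q : L + r < `|x - q| -> k (x, q) = 0.
Proof. by move=> xq; rewrite /k SLr// subr0. Qed.

Let ibox q : m_n.-integrable setT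
  (fun y => (((2 * L) ^+ n)^-1 * \1_(box 0 L) (y - q))%:E).
Proof.
apply: (@bounded_vanishing_integrable _ _ m_n _ ((2 * L) ^+ n)^-1 q L).
- exact: locally_finite_lebesgue.
- by apply: measurable_funM => //; apply: msub => //; exact: measurable_indic (measurable_box _ _).
- move=> y; rewrite ger0_norm ?mulr_ge0 ?invr_ge0 ?(ltW L2n)//.
  by rewrite -[leRHS]mulr1 ler_wpM2l// invr_ge0 ltW.
- move=> y yq; rewrite indicE memNset ?mulr0//.
  by apply/negP; rewrite -ltNge subr0.
Qed.

Let Ibox q : (\int[m_n]_y (((2 * L) ^+ n)^-1 * \1_(box 0 L) (y - q))%:E = 1)%E.
Proof.
under eq_integral do rewrite EFinM.
have mb : measurable_fun setT (fun y : E => (\1_(box 0 L) y)%:E : \bar R).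
  by apply/measurable_EFinP; exact: measurable_indic (measurable_box _ _).
rewrite ge0_integralZl//; last 2 first.
- by apply/measurable_EFinP; apply: msub => //; exact: measurable_indic (measurable_box _ _).
- by rewrite lee_fin invr_ge0 ltW.
under eq_integral do rewrite addrC.
rewrite (ge0_integral_shift (- q) mb); last by move=> y; rewrite lee_fin.
rewrite integral_indic ?setIT//; last exact: measurable_box.
by rewrite [X in (_ * X)%E](box_lebesgue _ (ltW L0)) -EFinM mulVf// gt_eqF.
Qed.

Let detaq_bound i q y : `|partial i eta (y - q)| <= C1 / L ^+ n.+1.
Proof. exact: deta. Qed.

Let mdetaq i q : measurable_fun setT (fun y : E => partial i eta (y - q)).
Proof. by apply: msub => //; apply: smooth_measurable; exact: smooth_partial. Qed.

Let detaq_vanishes i q : vanishes_off q L (fun y => partial i eta (y - q)).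
Proof. by move=> y yq; rewrite (partial_vanishes_off i etaL) ?subr0. Qed.

Let iwd i q : m_n.-integrable setT (fun y => (w i y * partial i eta (y - q))%:E).
Proof.
apply: (@bounded_vanishing_integrable _ _ m_n _ (M * (C1 / L ^+ n.+1)) q L).
- exact: locally_finite_lebesgue.
- by apply: measurable_funM; [exact: mw|exact: mdetaq].
- by move=> y; rewrite normrM ler_pM.
- by move=> y yq; rewrite detaq_vanishes ?mulr0.
Qed.

Let mS : measurable_fun setT (EFin \o S).
Proof. by apply/measurable_EFinP; exact: smooth_measurable smS. Qed.

Let S0' x : (0 <= (EFin \o S) x)%E. Proof. by rewrite lee_fin. Qed.

Let k1 x : (\int[m_n]_q (k (x, q))%:E = 1)%E.
Proof. by rewrite /k/= (ge0_integral_reflect x mS S0'). Qed.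

Let Ibox_sub (c : 'I_n -> E -> R) q :
  (forall i, m_n.-integrable setT (fun y => (c i y * partial i eta (y - q))%:E)) ->
  (\int[m_n]_y (((2 * L) ^+ n)^-1 * \1_(box 0 L) (y - q) -
     \sum_i c i y * partial i eta (y - q))%:E =
   1 - \sum_i \int[m_n]_y (c i y * partial i eta (y - q))%:E)%E.
Proof.
move=> ic; under eq_integral do rewrite EFinB -sumEFin.
rewrite integralB//; last first.
  by apply: (@integrable_sum _ _ _ m_n setT _ 'I_n) => // i _; exact: ic.
rewrite [X in (X - _)%E]Ibox; congr (_ - _)%E.
by rewrite integral_sum.
Qed.

(* as a function of q, the flux term is a combination of translates of
   derivatives of eta, which have integral 0 *)
Let a1 y : (\int[m_n]_q (a (q, y))%:E = 1)%E.
Proof.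
pose f u : R := ((2 * L) ^+ n)^-1 * \1_(box 0 L) u - \sum_i w i y * partial i eta u.
have mf : measurable_fun setT (EFin \o f).
  apply/measurable_EFinP; apply: measurable_funB.
    by apply: measurable_funM => //; exact: measurable_indic (measurable_box _ _).
  apply: measurable_sum => i; apply: measurable_funM => //.
  by apply: smooth_measurable; exact: smooth_partial.
rewrite (integral_reflect y mf).
have id i : m_n.-integrable setT (fun u => (partial i eta (u - 0))%:E).
  apply: (@bounded_vanishing_integrable _ _ m_n _ (C1 / L ^+ n.+1) 0 L) => //.
  exact: locally_finite_lebesgue.
have iwd0 i : m_n.-integrable setT (fun u => (w i y * partial i eta (u - 0))%:E).
  by under eq_fun do rewrite EFinM; exact: integrableZl.
have := Ibox_sub iwd0.
under eq_integral do rewrite subr0.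
rewrite /f => ->; rewrite big1 ?sube0// => i _.
under eq_integral do rewrite EFinM subr0.
rewrite integralZl//; last by have := id i; under eq_fun do rewrite subr0.
by rewrite (integral_partial0 i seta etaL eta0) mule0.
Qed.

Let phi q : E -> R := smoothing chi (fun y => eta (y - q)).

Let phiE q x : phi q x = k (x, q).
Proof. by apply: eq_Rintegral => z _; rewrite addrAC. Qed.

Let etaq_vanishes q : vanishes_off q L (fun y => eta (y - q)).
Proof. by move=> y yq; rewrite etaL ?subr0. Qed.

Let smphi q : smooth (phi q).
Proof. exact: smooth_smoothing ichi _ _ _ (smooth_shift q seta) (@etaq_vanishes q). Qed.

Let phi_vanishes q : vanishes_off q (L + r) (phi q).
Proof. exact: smoothing_vanishes (@etaq_vanishes q) (@chi_vanishes R n r). Qed.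

Let partial_phi i q : partial i (phi q) = smoothing chi (fun y => partial i eta (y - q)).
Proof.
rewrite /phi (partial_smoothing ichi i (smooth_shift q seta) (@etaq_vanishes q)).
by rewrite partial_shift.
Qed.

Let integral_partial_phi i q :
  (\int[m_n]_y (v y ord0 i * partial i (phi q) y)%:E =
   \int[m_n]_y (w i y * partial i eta (y - q))%:E)%E.
Proof.
under eq_integral do rewrite partial_phi.
exact: (integral_conv_smoothing r vloc i (mdetaq i q) (detaq_bound i q) (@detaq_vanishes i q)).
Qed.

Let ik q : nu.-integrable setT (fun x => (k (x, q))%:E).
Proof.
have [C C0 CP] := continuous_vanishing_bounded (smooth_continuous (smphi q)) (@phi_vanishes q).
rewrite (_ : (fun _ => _) = EFin \o phi q); last by apply/funext => x /=; rewrite phiE.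
exact: (bounded_vanishing_integrable nu_lf (smooth_measurable (smphi q)) CP (@phi_vanishes q)).
Qed.

Let kN q : (\int[nu]_x (k (x, q))%:E = (N q)%:E)%E.
Proof. by rewrite /N fineK//; exact: integrable_fin_num (ik q). Qed.

(* the divergence equation tested against phi q, which is k (_, q) *)
Let aN q : (\int[m_n]_y (a (q, y))%:E = (N q)%:E)%E.
Proof.
rewrite (Ibox_sub (iwd ^~ q)).
have iv i : m_n.-integrable setT (fun y => (v y ord0 i * partial i (phi q) y)%:E).
  have [C C0 CP] := continuous_vanishing_bounded
    (smooth_continuous (smooth_partial i (smphi q))) (partial_vanishes_off i (@phi_vanishes q)).
  exact: (integrable_field_box vloc i (smooth_measurable (smooth_partial i (smphi q))) CP
    (partial_vanishes_off i (@phi_vanishes q))).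
have -> : (\sum_i \int[m_n]_y (w i y * partial i eta (y - q))%:E =
    \int[m_n]_y (dotp (v y) (grad (phi q) y))%:E)%E.
  transitivity (\int[m_n]_y (\sum_i (v y ord0 i * partial i (phi q) y)%:E))%E.
    rewrite (integral_sum measurableT iv); apply: eq_bigr => i _.
    by rewrite integral_partial_phi.
  apply: eq_integral => y _; rewrite sumEFin; congr EFin.
  by apply: eq_bigr => i _; rewrite mxE.
rewrite (vnu (smphi q) (vanishes_off_compact (@phi_vanishes q))).
under eq_integral do rewrite phiE.
under [X in (1 - - (_ - X))%E]eq_integral do rewrite phiE /k/= addrC.
rewrite (ge0_integral_shift (- q) mS S0') S1 kN.
by rewrite oppeK -!EFinB -EFinD; congr EFin; lra.
Qed.

Let N0 q : 0 < N q.
Proof.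
rewrite -lte_fin -aN; apply: (@lt_le_trans _ _ (2^-1)%:E); first by rewrite lte_fin.
have := integralZl measurableT (ibox q) (2^-1).
rewrite Ibox mule1 => <-; apply: ge0_le_integral => //.
- by move=> y _; rewrite -EFinM lee_fin !mulr_ge0// invr_ge0 ltW.
- by apply: emeasurable_funM => //; exact: measurable_int (ibox q).
- by apply/measurable_EFinP; apply: measurableT_comp ma _; exact: measurable_fun_pair.
- move=> y _; rewrite -EFinM lee_fin; apply: le_trans (a_lower q y).
  by rewrite mulrC mulrAC.
Qed.

Let mN : measurable_fun setT N.
Proof.
have mk' : measurable_fun setT (fun p : E * E => (k (p.2, p.1))%:E).
  by apply/measurable_EFinP; apply: measurableT_comp mk _; exact: measurable_fun_pair.
have mI := @measurable_fun_integral2 _ _ E E R nu _ mk'.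
exact: (measurableT_comp (fine_measurable (@measurableT _ (\bar R))) mI).
Qed.

Let k0 p : 0 <= k p. Proof. exact: S0. Qed.

(** The scale [L] is free as long as it dominates [M] times a dimensional
    constant; the first step of the transport covers [L + r], the radius of the
    support of [S], and the second one covers [L]. *)
Lemma Tra_le_of_field : (Tra nu <= (n%:R * (L + r + L))%:E)%E.
Proof. exact: (Tra_le_of_kernels nu_lf mk ma mN k0 a0 N0 kLr aL k1 a1 kN aN). Qed.

End field_to_plan.

(** * The upper bound *)

(** [Tra_le_of_field] at the scale [L = r + K * M]: the summand [r] only ensures
    that [L] is positive when [M] is zero. *)
Lemma Tra_upper_bound (R : realType) n : exists2 C : R, 0 < C &
  forall nu : {measure set 'rV[R]_n -> \bar R}, locally_finite nu ->
    (Tra nu <= C%:E * ereal_inf [set Ra v | v in connecting_fields nu])%E.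
Proof.
have [C1 C10 bumpP] := exists_bump R n.
pose K := 2 ^+ n.+1 * n%:R * C1.
have K0 : 0 <= K by rewrite mulr_ge0// ?mulr_ge0// ltW.
pose C := n%:R * 3 * (1 + K) + 1.
have C0 : 0 < C by rewrite ltr_wpDl// !mulr_ge0// addr_ge0.
exists C => // nu lf.
rewrite -lee_pdivrMl//; apply: le_ereal_inf_tmp => _ [v [vloc vnu] <-].
apply: le_ereal_inf_tmp => _ [r /= r0 <-].
rewrite lee_pdivrMl//.
have fs0 : (0 <= field_sup_norm (field_conv v (chi r)))%E.
  apply: (@le_trans _ _ (enorm (field_conv v (chi r) 0))%:E).
    by rewrite lee_fin sqrtr_ge0.
  by apply: ereal_sup_ubound; exists 0.
case fsE : (field_sup_norm (field_conv v (chi r))) fs0 => [M| |//] fs0; last first.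
  by rewrite addey// gt0_muley ?lte_fin// leey.
have vM x : enorm (field_conv v (chi r) x) <= M.
  by rewrite -lee_fin -fsE; apply: ereal_sup_ubound; exists x.
rewrite lee_fin in fs0.
pose L := r + K * M.
have L0 : 0 < L by rewrite ltr_pwDl// mulr_ge0.
have [eta [seta eta0 etaL eta1 deta]] := bumpP L L0.
have ML : 2 ^+ n.+1 * n%:R * C1 * M <= L by rewrite /L lerDr ltW.
pose nu' := as_sigma_finite (locally_finite_sigma_finite lf).
apply: (@le_trans _ _ (n%:R * (L + r + L))%:E).
  exact: (@Tra_le_of_field _ _ nu' v r M L C1 eta).
rewrite -EFinD -EFinM lee_fin /C mulrDl mul1r.
apply: (@le_trans _ _ (n%:R * 3 * (1 + K) * (r + M))); last first.
  by rewrite lerDl addr_ge0// ltW.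
rewrite -!mulrA ler_wpM2l//.
have -> : L + r + L = 3 * (r + K * M) - K * M by rewrite /L; ring.
rewrite lerBlDr (@le_trans _ _ (3 * ((1 + K) * (r + M))))//; last first.
  by rewrite lerDl mulr_ge0.
rewrite ler_pM2l// [leRHS](_ : _ = r + K * M + (M + K * r)); last by ring.
by rewrite lerDl addr_ge0// mulr_ge0// ltW.
Qed.

(** * Marginals, supports and segments *)

Section transportation_measure.
Variables (R : realType) (n : nat).
Local Notation E := 'rV[R]_n.
Local Notation m_n := (lebesgue_rV R n).

(** Each point of [O] has a null neighbourhood, and countably many balls with
    rational centres and radii suffice to cover [O]. *)
Lemma null_off_support (gamma : {measure set (E * E) -> \bar R}) (O : set (E * E)) :
  open O -> (forall z, O z -> ~ spt gamma z) -> gamma O = 0%E.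
Proof.
move=> oO Ospt.
pose c (q : 'rV[rat]_n * 'rV[rat]_n) : E * E := (map_mx ratr q.1, map_mx ratr q.2).
have cd (x : E * E) e : 0 < e -> exists q, ball x e (c q).
  move=> e0; have [q xq] := dense_rV_ratr x.1 e0.
  by have [w xw] := dense_rV_ratr x.2 e0; exists (q, w).
pose Bk (k : ('rV[rat]_n * 'rV[rat]_n) * nat) : set (E * E) := ball (c k.1) k.2.+1%:R^-1.
have mB k : measurable (Bk k).
  apply: measurableX; apply: open_measurable_rV; exact: ball_open.
pose F (j : nat) : set (E * E) :=
  if (unpickle j : option (('rV[rat]_n * 'rV[rat]_n) * nat)) is Some k then
    if gamma (Bk k) == 0%E then Bk k else set0 else set0.
have mF j : measurable (F j) by rewrite /F; case: unpickle => // k; case: ifP.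
have F0 j : gamma (F j) = 0%E.
  rewrite /F; case: unpickle => [k|]; last exact: measure0.
  by case: ifP => [/eqP//|_]; exact: measure0.
have mO : measurable O.
  by rewrite measurable_prod_rVE; exact: sub_sigma_algebra.
have OF : O `<=` \bigcup_j F j.
  move=> z Oz; have := Ospt z Oz; rewrite /spt/= => /existsNP[U].
  move=> /not_implyP[oU /not_implyP[Uz]] /negP; rewrite -leNgt => gU.
  have gU0 : gamma U = 0%E by apply/eqP; rewrite eq_le gU measure_ge0.
  move: Uz; rewrite {1}(open_bigcup_ball (c := c) cd oU) => -[k /= kU kz].
  have k0 : gamma (Bk k) == 0%E.
    rewrite eq_le measure_ge0 andbT -gU0; apply: le_measure; rewrite ?inE//.
    by rewrite measurable_prod_rVE; exact: sub_sigma_algebra.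
  by exists (pickle k) => //; rewrite /F pickleK k0.
apply/negligibleP => //; apply: negligibleS OF _.
by apply: negligible_bigcup => j; exists (F j); split.
Qed.

Definition plateau (c : E) (s : R) (y : E) : R :=
  Num.min 1 (Num.max 0 (2 - `|y - c| / s)).

Lemma continuous_plateau c s : continuous (plateau c s).
Proof.
move=> y; apply: (@continuous_min _ _ (fun=> 1) (fun y : E => Num.max 0 (2 - `|y - c| / s))).
  exact: cst_continuous.
apply: (@continuous_max _ _ (fun=> 0) (fun y : E => 2 - `|y - c| / s)).
  exact: cst_continuous.
apply: (@continuousD _ _ _ (fun=> 2 : R) (fun y : E => - (`|y - c| / s))).
  exact: cst_continuous.
apply: (@continuousN _ _ _ (fun y : E => `|y - c| / s)).
apply: (@continuousM _ _ (fun y : E => `|y - c|) (fun=> s^-1)).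
  apply: (@continuous_comp _ _ _ (fun y : E => y - c) Num.norm).
    by apply: continuousB; [exact: cvg_id|exact: cst_continuous].
  exact: norm_continuous.
exact: cst_continuous.
Qed.

Lemma plateau_bound c s y : 0 <= plateau c s y <= 1.
Proof. by rewrite /plateau le_min ler01 le_max lexx/= ge_min lexx. Qed.

Lemma plateau1 c s y : 0 < s -> box c s y -> plateau c s y = 1.
Proof.
move=> s0 ys; rewrite /plateau; apply/min_idPl; rewrite le_max; apply/orP; right.
by rewrite lerBrDr -lerBrDl (_ : 2 - 1 = 1); [rewrite ler_pdivrMr// mul1r|lra].
Qed.

Lemma plateau_vanishes c s : 0 < s -> vanishes_off c (2 * s) (plateau c s).
Proof.
move=> s0 y ys; rewrite /plateau (_ : Num.max _ _ = 0); first exact/min_idPr.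
by apply/max_idPl; rewrite subr_le0 ler_pdivlMr// ltW.
Qed.

(** The marginal identities concern continuous functions only, so the indicator
    of the box is compared with a plateau carried by the box of twice the
    radius. *)
Lemma transportation_second_box nu (gamma : {measure set (E * E) -> \bar R}) c s :
  transportation nu m_n gamma -> 0 < s ->
  (gamma (snd @^-1` box c s) <= ((4 * s) ^+ n)%:E)%E.
Proof.
move=> [_ _ g2] s0.
have mb : measurable (snd @^-1` box c s : set (E * E)).
  by rewrite -[X in measurable X]setTI; apply: measurable_snd => //; exact: measurable_box.
have mp : measurable_fun setT (plateau c s).
  by apply: continuous_measurable_rV; exact: continuous_plateau.
apply: (@le_trans _ _ (\int[gamma]_z (plateau c s z.2)%:E)%E).
  rewrite -[X in gamma X]setIT -integral_indic//; apply: ge0_le_integral => //.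
  - exact/measurable_EFinP/measurable_indic.
  - apply/measurable_EFinP; exact: measurableT_comp mp measurable_snd.
  - move=> z _; rewrite lee_fin indicE; have [/set_mem zs|_] := boolP (z \in _).
      by rewrite plateau1.
    by have /andP[] := plateau_bound c s z.2.
rewrite g2; last 2 first.
- exact: continuous_plateau.
- apply: (@vanishes_off_compact _ _ c (2 * s)); exact: plateau_vanishes.
rewrite (_ : 4 * s = 2 * (2 * s)); last by ring.
rewrite -(@box_lebesgue R n c (2 * s)); last by rewrite mulr_ge0// ltW.
rewrite -[X in (_ <= m_n X)%E]setIT -integral_indic//; last exact: measurable_box.
apply: ge0_le_integral => //.
- by move=> y _; rewrite lee_fin; have /andP[] := plateau_bound c s y.
- exact/measurable_EFinP.
- by apply/measurable_EFinP; apply: measurable_indic; exact: measurable_box.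
move=> y _; rewrite lee_fin indicE.
have [ys|ys] := leP `|y - c| (2 * s).
  by rewrite mem_set//; have /andP[] := plateau_bound c s y.
by rewrite (plateau_vanishes s0)// ler0n.
Qed.

Lemma transportation_sigma_finite nu1 nu2 (gamma : {measure set (E * E) -> \bar R}) :
  transportation nu1 nu2 gamma -> sigma_finite setT gamma.
Proof.
move=> [lf _ _]; exists (fun k => box (0 : E) k%:R `*` box (0 : E) k%:R).
  apply/esym; apply/seteqP; split => // z _.
  exists (Num.truncn (Num.max `|z.1| `|z.2|)).+1 => //.
  have z0 : 0 <= Num.max `|z.1| `|z.2| by rewrite le_max normr_ge0.
  have /andP[_ /ltW] := truncn_itv z0; rewrite ge_max => /andP[z1 z2].
  by split; rewrite /box/= subr0.
move=> k; have mB : measurable (box (0 : E) k%:R `*` box (0 : E) k%:R).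
  by apply: measurableX; exact: measurable_box.
split => //; apply: lf => //.
exists k%:R; split; first exact: num_real.
move=> M kM z []; rewrite /box/= !subr0 => z1 z2.
by rewrite [`|z|]/Num.norm/= ge_max !(le_trans _ (ltW kM)).
Qed.

End transportation_measure.

Section calculus_along_segments.
Variables (R : realType) (n : nat).
Local Notation E := 'rV[R]_n.
Local Notation m_n := (lebesgue_rV R n).

Lemma integral_affine (a : E) (s : R) (f : E -> R) : 0 < s ->
  m_n.-integrable setT (EFin \o f) ->
  (\int[m_n]_x (f x)%:E = \int[m_n]_z (s ^+ n * f (a + s *: z)%R)%:E)%E.
Proof.
move=> s0 fi; have mf := measurable_int _ fi.
have sn : (0 <= (s ^+ n)%:E)%E by rewrite lee_fin exprn_ge0// ltW.
have pos (h : E -> \bar R) : measurable_fun setT h -> (forall x, 0 <= h x)%E ->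
    (\int[m_n]_x h x = \int[m_n]_z ((s ^+ n)%:E * h (a + s *: z)%R))%E.
  move=> mh h0; rewrite -[LHS](ge0_integral_affine a (lt0r_neq0 s0) mh h0).
  rewrite ge0_integralZl// ?(gtr0_norm s0)//.
  apply: measurableT_comp mh _; apply: measurable_rVD => //.
  by apply: measurable_rVZ.
rewrite integralE [RHS]integralE (pos _ (measurable_funepos mf))//.
rewrite (pos _ (measurable_funeneg mf))//.
congr (_ - _)%E; apply: eq_integral => z _; rewrite !unlock [in RHS]EFinM.
  by rewrite maxe_pMr// mule0.
by rewrite -muleN maxe_pMr// mule0.
Qed.

(** The fundamental theorem of calculus for [s |-> phi (x + s *: h)], whose
    derivative is given by [is_derive_grad]. *)
Lemma integral_along_segment (phi : E -> R) (x h : E) : smooth phi ->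
  (\int[lebesgue_measure]_(s in `]0%R, 1%R]) (dotp h (grad phi (x + s *: h)))%:E =
   (phi (x + h) - phi x)%:E)%E.
Proof.
move=> sphi.
pose F s := phi (s *: h + x).
pose f s := dotp h (grad phi (s *: h + x)).
have dF (s : R) : is_derive s (1 : R) F (f s).
  apply: is_derive_line; apply: is_derive_grad; first exact: smooth_derivable.
  by move=> i; apply: smooth_continuous; exact: smooth_partial.
have cf : continuous f.
  move=> s; apply: (@cvg_big _ _ +%R) => [|i _]; first exact: add_continuous.
  apply: (@continuousM _ _ (fun=> h ord0 i) (fun s : R => grad phi (s *: h + x) ord0 i)).
    exact: cst_continuous.
  rewrite (_ : (fun _ => _) = partial i phi \o (fun s : R => s *: h + x)); last first.
    by apply/funext => t; rewrite /= mxE.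
  apply: (@continuous_comp _ _ _ (fun s : R => s *: h + x) (partial i phi)).
    apply: continuousD; last exact: cst_continuous.
    exact: scalel_continuous.
  by apply: smooth_continuous; exact: smooth_partial.
have cF : continuous F.
  move=> s; apply: differentiable_continuous; apply/derivable1_diffP.
  by have [] := dF s.
transitivity (\int[lebesgue_measure]_(s in `]0%R, 1%R]) (f s)%:E)%E.
  by apply: eq_integral => s _; rewrite /f addrC.
rewrite integral_itv_obnd_cbnd; last first.
  apply: measurable_funTS; apply/measurable_EFinP; exact: continuous_measurable_fun.
rewrite (@continuous_FTC2 _ f F 0 1)//.
- by rewrite /F scale1r scale0r add0r [h + x]addrC EFinB.
- exact: continuous_subspaceT.
- split; first by move=> s _; have [] := dF s.
    by apply: cvg_at_right_filter; exact: cF.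
  by apply: cvg_at_left_filter; exact: cF.
- by move=> s _; rewrite derive1E; have [_ ->] := dF s.
Qed.

End calculus_along_segments.

(** * From a transportation to a connecting field *)

Section product_of_sigma_finite_measures.
Context d1 d2 (T1 : measurableType d1) (T2 : measurableType d2) (R : realType).
Variables (m1 : {sigma_finite_measure set T1 -> \bar R})
  (m2 : {sigma_finite_measure set T2 -> \bar R}).

Lemma product_sigma_finite : sigma_finite setT (m1 \x m2)%E.
Proof.
have /sigma_finiteP[F [TF ndF Foo]] := sigma_finiteT m1.
have /sigma_finiteP[G [TG ndG Goo]] := sigma_finiteT m2.
exists (fun k => F k `*` G k).
  apply/esym/seteqP; split => // -[x y] _.
  have [i _ Fx] : (\bigcup_k F k) x by rewrite -TF.
  have [j _ Gy] : (\bigcup_k G k) y by rewrite -TG.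
  exists (maxn i j) => //; split => /=.
    by move: x Fx; exact/subsetPset/ndF/leq_maxl.
  by move: y Gy; exact/subsetPset/ndG/leq_maxr.
move=> k; have [mF Fk] := Foo k; have [mG Gk] := Goo k.
split; first exact: measurableX.
by rewrite product_measure1E// lte_mul_pinfty// ge0_fin_numE.
Qed.

(** The product again as a sigma-finite measure, so that products can be
    iterated. *)
Definition product_measure : {sigma_finite_measure set (T1 * T2)%type -> \bar R} :=
  as_sigma_finite product_sigma_finite.

Lemma product_measure_tonelli (f : T1 * T2 -> \bar R) :
  measurable_fun setT f -> (forall p, 0 <= f p)%E ->
  (\int[product_measure]_p f p = \int[m1]_x \int[m2]_y f (x, y))%E.
Proof. by move=> mf f0; exact: fubini_tonelli1. Qed.

Lemma product_measure_fubini (f : T1 * T2 -> \bar R) :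
  product_measure.-integrable setT f ->
  (\int[product_measure]_p f p = \int[m1]_x \int[m2]_y f (x, y))%E.
Proof. by move=> fi; rewrite -integral12_prod_meas1. Qed.

Lemma integrable_first_integral (f : T1 * T2 -> \bar R) :
  (m1 \x m2)%E.-integrable setT f ->
  m2.-integrable setT (fun y => \int[m1]_x f (x, y))%E.
Proof.
move=> fi; have mf := measurable_int _ fi.
have mG : measurable_fun setT (fun y => \int[m1]_x f (x, y))%E.
  exact: measurable_fubini_G fi.
apply/integrableP; split => //.
apply: le_lt_trans ((integrable21ltyP m1 m2 mf).1 fi).
apply: ge0_le_integral => //.
- exact: measurableT_comp.
- apply: (measurable_fun_fubini_tonelli_G (abse \o f)).
    exact: measurableT_comp.
  by move=> p; exact: abse_ge0.
- by move=> y _; apply: le_abse_integral => //; apply: measurableT_comp mf _.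
Qed.

End product_of_sigma_finite_measures.

Section plan_to_field.
Variables (R : realType) (n : nat).
Local Notation E := 'rV[R]_n.
Local Notation m_n := (lebesgue_rV R n).
Local Notation lam := (@lebesgue_measure R).
Variables (nu : {measure set E -> \bar R})
  (gamma : {sigma_finite_measure set (E * E)%type -> \bar R}) (r : R).
Let D : set (E * E) := [set z | `|z.1 - z.2| <= r].
Hypotheses (nu_lf : locally_finite nu) (gT : transportation nu m_n gamma)
  (r0 : 0 < r) (gD : gamma (~` D) = 0%E).

Let mD : measurable D.
Proof.
have mf : measurable_fun setT (fun z : E * E => `|z.1 - z.2|).
  apply: measurableT_comp; last exact: measurable_rVB.
  by apply: continuous_measurable_rV; exact: norm_continuous.
rewrite -[X in measurable X]setTI.
have := mf measurableT _ (measurable_itv `]-oo, r]).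
by congr measurable; apply/seteqP; split => z /=; rewrite in_itv.
Qed.

(* equal to t^-1 for t > 0, and measurable as a composite *)
Let inv (t : R) : R := expR (- ln t).

Let invE t : 0 < t -> inv t = t^-1.
Proof. by move=> t0; rewrite /inv expRN lnK// posrE. Qed.

Let minv : measurable_fun setT inv.
Proof.
apply: measurableT_comp => //; apply: measurableT_comp => //; exact: measurable_ln.
Qed.

Local Notation chi := (@chi R n r).

Let chi0 z : 0 <= chi z. Proof. exact: chi_ge0. Qed.

Let chi_off z : r < `|z| -> chi z = 0.
Proof. by move=> rz; apply: (@chi_vanishes R n r); rewrite subr0. Qed.

Let mchi : measurable_fun setT chi. Proof. exact: measurable_chi. Qed.

Let Ichi : (\int[m_n]_z (chi z)%:E = 1)%E. Proof. exact: integral_chi. Qed.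

Let ichi : m_n.-integrable setT (EFin \o chi). Proof. exact: integrable_chi. Qed.

Local Notation W := ((E * E) * measurableTypeR R)%type.

Let P : {sigma_finite_measure set W -> \bar R} := product_measure gamma lam.

(* A particle is given by (x, y, s) and z: it travels from x to y + z along a
   segment, and s is the time.  The gate discards the pairs (x, y) outside D,
   which are gamma-negligible, so that all displacements are bounded. *)
Let gate (w : W) : R := \1_D w.1 * \1_(`]0%R, 1%R]%classic : set R) w.2.

Let mgate : measurable_fun setT gate.
Proof.
apply: measurable_funM.
  exact: measurableT_comp (measurable_indic mD) measurable_fst.
by apply: measurableT_comp measurable_snd; exact: measurable_indic.
Qed.

(* the velocity that brings a particle from w.1.1 to p at time w.2 *)
Let vel (p : E) (w : W) : E := inv w.2 *: (p - w.1.1).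

(* the density in p of the position at time s of the particles starting at x
   and aimed at y, where chi is the density of the error z of aim *)
Let kap (q : E * W) : R :=
  gate q.2 * (inv q.2.2 ^+ n * chi (vel q.1 q.2 - (q.2.1.2 - q.2.1.1))).

Let kap_ge0 q : 0 <= kap q.
Proof. by rewrite mulr_ge0// mulr_ge0// exprn_ge0// expR_ge0. Qed.

Let mvel : measurable_fun setT (fun q : E * W => vel q.1 q.2).
Proof.
apply: measurable_rVZ.
  apply: measurableT_comp minv _; exact: measurableT_comp measurable_snd measurable_snd.
apply: measurable_rVB => //.
apply: measurableT_comp measurable_fst _.
exact: measurableT_comp measurable_fst measurable_snd.
Qed.

Let mkap : measurable_fun setT kap.
Proof.
apply: measurable_funM; first exact: measurableT_comp mgate measurable_snd.
apply: measurable_funM.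
  apply: measurable_funX; apply: measurableT_comp minv _.
  exact: measurableT_comp measurable_snd measurable_snd.
apply: measurableT_comp mchi _; apply: measurable_rVB => //.
have m1 : measurable_fun setT (fun q : E * W => q.2.1).
  exact: measurableT_comp measurable_fst measurable_snd.
by apply: measurable_rVB; apply: measurableT_comp m1.
Qed.

(* density times velocity, integrated below over all particles and times *)
Let H i (q : E * W) : R := kap q * vel q.1 q.2 ord0 i.

Let mH i : measurable_fun setT (H i).
Proof. by apply: measurable_funM => //; exact: measurable_rV_coord. Qed.

Let H_le i q : `|H i q| <= 2 * r * kap q.
Proof.
rewrite /H normrM (ger0_norm (kap_ge0 q)) mulrC.
have [->|k0] := eqVneq (kap q) 0; first by rewrite !mulr0.
rewrite ler_wpM2r//.
have dz : D q.2.1.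
  apply: contra_neqP k0 => dz; rewrite /kap /gate indicE memNset//.
  by rewrite !mul0r.
have vz : `|vel q.1 q.2 - (q.2.1.2 - q.2.1.1)| <= r.
  rewrite leNgt; apply: contra_neqN k0 => rv.
  by rewrite /kap chi_off// !mulr0.
rewrite (le_trans (coord_le_norm _ i))// mulr2n mulrDl mul1r.
rewrite -[vel q.1 q.2](subrK (q.2.1.2 - q.2.1.1)) (le_trans (ler_normD _ _))//.
by rewrite lerD// distrC.
Qed.

Let v (p : E) : E := \row_i fine (\int[P]_w (H i (p, w))%:E)%E.

(* A p is the density at p of the time that particles spend there; it may be
   infinite on a null set, where the integral defining v need not converge *)
Let A (p : E) : \bar R := (\int[P]_w (kap (p, w))%:E)%E.

Let mA : measurable_fun setT A.
Proof.
have mEk : measurable_fun setT (EFin \o kap) by exact/measurable_EFinP.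
exact: (@measurable_fun_integral2 _ _ E W R P (EFin \o kap) mEk).
Qed.

Let A0 p : (0 <= A p)%E.
Proof. by apply: integral_ge0 => w _; rewrite lee_fin. Qed.

Let mkapx p : measurable_fun setT (fun w => (kap (p, w))%:E).
Proof. by apply/measurable_EFinP; apply: measurableT_comp mkap _; exact: measurable_fun_pair. Qed.

Let mHx i p : measurable_fun setT (fun w => (H i (p, w))%:E).
Proof. by apply/measurable_EFinP; apply: measurableT_comp (mH i) _; exact: measurable_fun_pair. Qed.

Let mv : measurable_fun setT v.
Proof.
apply: measurable_fun_rV => i; under eq_fun do rewrite mxE.
have mEH : measurable_fun setT (EFin \o H i) by exact/measurable_EFinP.
have mI := @measurable_fun_integral2 _ _ E W R P (EFin \o H i) mEH.
exact: (measurableT_comp (fine_measurable (@measurableT _ (\bar R))) mI).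
Qed.

Let v_le i p : ((`|v p ord0 i|)%:E <= (2 * r)%:E * A p)%E.
Proof.
apply: (@le_trans _ _ (`|\int[P]_w (H i (p, w))%:E|)%E).
  by rewrite mxE; case: (\int[_]_w _)%E => [x| |]; rewrite /= ?normr0 ?leey.
apply: le_trans (le_abse_integral _ _ (mHx i p)) _ => //.
rewrite -ge0_integralZl//; last 2 first.
- by move=> w _; rewrite lee_fin.
- by rewrite lee_fin mulr_ge0// ltW.
apply: ge0_le_integral => //.
- by apply: measurableT_comp => //; exact: mHx.
- by apply: emeasurable_funM => //; exact: mkapx.
- by move=> w _; rewrite -EFinM abse_EFin lee_fin H_le.
Qed.

Let gate_cases w : gate w = 0 \/ [/\ gate w = 1, D w.1, 0 < w.2 & w.2 <= 1].
Proof.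
rewrite /gate !indicE.
have [/set_mem Dw|_] := boolP (w.1 \in D); last by left; rewrite mul0r.
have [/set_mem|_] := boolP (w.2 \in (`]0%R, 1%R]%classic : set R)); last by left; rewrite mulr0.
by rewrite /= in_itv/= => /andP[s0 s1]; right; rewrite mulr1.
Qed.

(* the position at time w.2 of a particle aimed exactly; p = foot w + w.2 *: z
   is the change of variables from the error z to the position p *)
Let foot (w : W) : E := w.1.1 + w.2 *: (w.1.2 - w.1.1).

Let foot_sub w z : foot w + w.2 *: z = w.1.1 + w.2 *: (w.1.2 - w.1.1 + z).
Proof. by rewrite /foot -addrA -scalerDr. Qed.

Let vel_foot w z : 0 < w.2 -> vel (foot w + w.2 *: z) w = w.1.2 - w.1.1 + z.
Proof.
move=> s0; rewrite /vel foot_sub invE// [w.1.1 + _]addrC addrK.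
by rewrite scalerA mulVf ?gt_eqF// scale1r.
Qed.

Let kap_foot w z : 0 < w.2 -> w.2 ^+ n * kap (foot w + w.2 *: z, w) = gate w * chi z.
Proof.
move=> s0; rewrite /kap [(_, w).1]/= [(_, w).2]/= vel_foot//.
have -> : w.1.2 - w.1.1 + z - (w.1.2 - w.1.1) = z by rewrite addrAC subrr add0r.
rewrite invE// mulrCA; congr (_ * _); rewrite mulrA -exprMn mulfV ?gt_eqF//.
by rewrite expr1n mul1r.
Qed.

Let kap_subst (G : E -> \bar R) w : measurable_fun setT G -> (forall p, 0 <= G p)%E ->
  (\int[m_n]_p ((kap (p, w))%:E * G p) =
   (gate w)%:E * \int[m_n]_z ((chi z)%:E * G (foot w + w.2 *: z)%R))%E.
Proof.
move=> mG G0; have [gw|[gw _ s0 _]] := gate_cases w.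
  rewrite gw mul0e integral0_eq// => p _.
  by rewrite /kap/= gw mul0r mul0e.
have mkp : measurable_fun setT (fun p => (kap (p, w))%:E : \bar R).
  by apply/measurable_EFinP; apply: measurableT_comp mkap _; exact: measurable_fun_pair.
have mf : measurable_fun setT (fun p => (kap (p, w))%:E * G p)%E.
  exact: emeasurable_funM.
have maff : measurable_fun setT (fun z : E => foot w + w.2 *: z).
  by apply: measurable_rVD => //; exact: measurable_rVZ.
rewrite -(ge0_integral_affine (foot w) (lt0r_neq0 s0) mf); last first.
  by move=> p; rewrite mule_ge0// lee_fin.
rewrite gw mul1e (gtr0_norm s0) -ge0_integralZl//; last 3 first.
- exact: measurableT_comp mf maff.
- by move=> z _; rewrite mule_ge0// lee_fin.
- by rewrite lee_fin exprn_ge0// ltW.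
by apply: eq_integral => z _; rewrite muleA -EFinM kap_foot// gw mul1r.
Qed.

(* a particle seen at p started within 2r of p, hence its target y lies within 3r
   of p, and the second marginal of gamma is Lebesgue measure *)
Let A_box c s : 0 < s -> (\int[m_n]_p (A p * (\1_(box c s) p)%:E) <=
  ((4 * (s + 3 * r)) ^+ n)%:E)%E.
Proof.
move=> s0; pose B := box c s.
have m1B : measurable_fun setT (fun p : E => (\1_B p)%:E : \bar R).
  by apply/measurable_EFinP; apply: measurable_indic; exact: measurable_box.
have mf : measurable_fun setT (fun q : E * W => (kap q)%:E * (\1_B q.1)%:E)%E.
  apply: emeasurable_funM; first exact/measurable_EFinP.
  exact: measurableT_comp m1B measurable_fst.
rewrite (eq_integral (fun p => \int[P]_w ((kap (p, w))%:E * (\1_B p)%:E))%E); last first.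
  move=> p _; apply/esym; apply: (ge0_integralZr P measurableT (mkapx p)) => //.
  by move=> w _; rewrite lee_fin.
rewrite (fubini_tonelli (fun q : E * W => (kap q)%:E * (\1_B q.1)%:E)%E mf); last first.
  by move=> q; rewrite mule_ge0 ?lee_fin.
have mS : measurable (snd @^-1` box c (s + 3 * r) : set (E * E)).
  by rewrite -[X in measurable X]setTI; apply: measurable_snd => //; exact: measurable_box.
pose T (w : W) : R := \1_(snd @^-1` box c (s + 3 * r) : set (E * E)) w.1 *
  \1_(`]0%R, 1%R]%classic : set R) w.2.
have mT : measurable_fun setT (EFin \o T).
  apply/measurable_EFinP; apply: measurable_funM.
    exact: measurableT_comp (measurable_indic mS) measurable_fst.
  by apply: measurableT_comp measurable_snd; exact: measurable_indic.
have T0 w : (0 <= (EFin \o T) w)%E by rewrite lee_fin mulr_ge0.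
apply: (@le_trans _ _ (\int[P]_w (T w)%:E)%E).
  apply: ge0_le_integral => //.
  - by move=> w _; apply: integral_ge0 => p _; rewrite mule_ge0 ?lee_fin.
  - apply: (measurable_fun_fubini_tonelli_G _ mf) => q.
    by rewrite mule_ge0 ?lee_fin.
  move=> w _; rewrite kap_subst//.
  have [->|[-> Dw s1 s2]] := gate_cases w; first by rewrite mul0e T0.
  rewrite mul1e /T [\1_(`]0%R, 1%R]%classic) _]indicE mem_set ?mulr1; last first.
    by rewrite /= in_itv/= s1 s2.
  rewrite indicE; have [_|yc] := boolP (w.1 \in _).
    rewrite -Ichi; apply: ge0_le_integral => //.
    - by move=> z _; rewrite -EFinM lee_fin mulr_ge0.
    - apply: emeasurable_funM; first exact/measurable_EFinP.
      apply: measurableT_comp m1B _.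
      by apply: measurable_rVD => //; exact: measurable_rVZ.
    - exact/measurable_EFinP.
    - by move=> z _; rewrite -EFinM lee_fin ler_piMr// indicE.
  rewrite integral0_eq// => z _.
  have [zr|/chi_off->] := leP `|z| r; last by rewrite mul0e.
  rewrite indicE memNset ?mule0// => pB.
  move: yc; rewrite notin_setE/=; apply; rewrite /box/=.
  have xy : `|w.1.1 - w.1.2| <= r := Dw.
  have px : `|w.2 *: (w.1.2 - w.1.1 + z)| <= 2 * r.
    rewrite normrZ (gtr0_norm s1) -[leRHS]mul1r ler_pM ?(ltW s1)//.
    by rewrite (le_trans (ler_normD _ _))// mulr2n mulrDl mul1r lerD// distrC.
  have -> : w.1.2 - c = (foot w + w.2 *: z - c) - (w.2 *: (w.1.2 - w.1.1 + z)) - (w.1.1 - w.1.2).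
    by rewrite foot_sub; apply/rowP => i; rewrite !mxE; ring.
  rewrite (le_trans (ler_normB _ _))// (_ : s + 3 * r = (s + 2 * r) + r); last by ring.
  by rewrite lerD// (le_trans (ler_normB _ _))// lerD.
rewrite product_measure_tonelli//.
rewrite (eq_integral (fun z : E * E => (\1_(snd @^-1` box c (s + 3 * r) : set (E * E)) z)%:E)%E); last first.
  move=> z _; rewrite /T/=; under eq_integral do rewrite EFinM.
  rewrite ge0_integralZl//; last by apply/measurable_EFinP; exact: measurable_indic.
  rewrite integral_indic// setIT [X in (_ * X)%E](lebesgue_measure_itv `]0%R, 1%R])/=.
  by rewrite lte_fin ltr01 sube0 mule1.
rewrite integral_indic// setIT; apply: transportation_second_box gT _.
by rewrite addr_gt0// mulr_gt0.
Qed.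

Let iA c s : 0 < s -> m_n.-integrable setT (fun p => A p * (\1_(box c s) p)%:E)%E.
Proof.
move=> s0.
have m1B : measurable_fun setT (fun p : E => (\1_(box c s) p)%:E : \bar R).
  by apply/measurable_EFinP; apply: measurable_indic; exact: measurable_box.
apply/integrableP; split; first exact: emeasurable_funM.
apply: le_lt_trans (ltry ((4 * (s + 3 * r)) ^+ n)); apply: le_trans (A_box c s0).
rewrite (eq_integral (fun p => A p * (\1_(box c s) p)%:E)%E)// => p _.
by rewrite gee0_abs// mule_ge0// lee_fin.
Qed.

Section testing.
Variables (phi : E -> R) (s C : R).
Hypotheses (sphi : smooth phi) (s0 : 0 < s) (phi0 : vanishes_off 0 s phi)
  (dphi : forall i p, `|partial i phi p| <= C).

Let C0 (i : 'I_n) : 0 <= C. Proof. exact: le_trans (dphi i 0). Qed.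

Let mdphi i : measurable_fun setT (partial i phi).
Proof. by apply: smooth_measurable; exact: smooth_partial. Qed.

Let dphi0 i : vanishes_off 0 s (partial i phi).
Proof. exact: partial_vanishes_off. Qed.

Let M : R := \sum_(i < n) 2 * r * C.

Let M0 : 0 <= M.
Proof. by apply: sumr_ge0 => i _; rewrite mulr_ge0 ?(C0 i)// mulr_ge0// ltW. Qed.

(* the momentum density paired with the gradient of the test function *)
Let K (q : E * W) : R := \sum_i H i q * partial i phi q.1.

Let mK : measurable_fun setT K.
Proof.
apply: measurable_sum => i; apply: measurable_funM; first exact: mH.
exact: measurableT_comp (mdphi i) measurable_fst.
Qed.

Let K_le q : `|K q| <= M * (kap q * \1_(box 0 s) q.1).
Proof.
rewrite (le_trans (ler_norm_sum _ _ _))// /M mulr_suml; apply: ler_sum => i _.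
rewrite normrM indicE; have [qs|/dphi0->] := leP `|q.1 - 0| s; last first.
  rewrite normr0 mulr0; apply: mulr_ge0; last exact: mulr_ge0.
  by rewrite mulr_ge0 ?(C0 i)// mulr_ge0// ltW.
rewrite mem_set// mulr1 [X in _ <= X](_ : _ = 2 * r * kap q * C); last by ring.
by apply: ler_pM; rewrite ?H_le.
Qed.

Let K_off p w : s < `|p| -> K (p, w) = 0.
Proof.
by move=> ps; apply: big1 => i _; rewrite dphi0 ?mulr0// subr0.
Qed.

Let iK : (m_n \x P)%E.-integrable setT (EFin \o K).
Proof.
have mEK : measurable_fun setT (EFin \o K) by exact/measurable_EFinP.
apply/integrable12ltyP => //.
apply: (@le_lt_trans _ _ (\int[m_n]_p (M%:E * (A p * (\1_(box 0 s) p)%:E)))%E); last first.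
  have := integrable_lty measurableT (integrableZl measurableT M (iA 0 s0)).
  by [].
apply: ge0_le_integral => //.
- by move=> p _; exact: integral_ge0.
- apply: (measurable_fun_fubini_tonelli_F (abse \o (EFin \o K))) => //.
    exact: measurableT_comp.
  by move=> q; exact: abse_ge0.
- by apply: emeasurable_funM => //; exact: measurable_int (iA 0 s0).
move=> p _; have B0 : (0 <= (M * \1_(box 0 s) p)%:E)%E by rewrite lee_fin mulr_ge0.
rewrite [leRHS](_ : _ = (M * \1_(box 0 s) p)%:E * A p)%E; last first.
  by rewrite EFinM [(A p * _)%E]muleC muleA.
rewrite -(ge0_integralZl P measurableT (mkapx p)) => [|w _|]; last 2 first.
- by rewrite lee_fin.
- exact: B0.
apply: ge0_le_integral => //.
- by apply/measurable_EFinP; apply: measurableT_comp => //; apply: measurableT_comp mK _; exact: measurable_fun_pair.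
- by apply: emeasurable_funM => //; exact: mkapx.
- by move=> w _; rewrite -EFinM abse_EFin lee_fin; apply: le_trans (K_le _) _; rewrite [kap _ * _]mulrC mulrA.
Qed.

(* the exceptional null set is the set where A is infinite *)
Let test_v : (\int[m_n]_p (dotp (v p) (grad phi p))%:E =
  \int[m_n]_p \int[P]_w (K (p, w))%:E)%E.
Proof.
apply: ae_eq_integral => //.
- apply/measurable_EFinP; apply: measurable_sum => i; apply: measurable_funM.
    exact: measurableT_comp (measurable_coord_rV i) mv.
  by under eq_fun do rewrite mxE; exact: mdphi.
- exact: measurable_fubini_F iK.
have := integrable_ae measurableT (iA 0 s0); apply: filterS => p /(_ I) Ap _.
rewrite -[RHS]/(\int[P]_w (K (p, w))%:E)%E.
have [ps|ps] := leP `|p - 0| s; last first.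
  rewrite integral0_eq => [|w _]; last by rewrite K_off// -[p]subr0.
  by congr _%:E; apply: big1 => i _; rewrite [grad _ _ _ _]mxE dphi0 ?mulr0.
rewrite indicE mem_set// mule1 in Ap.
have ik : P.-integrable setT (fun w => (kap (p, w))%:E).
  apply/integrableP; split; first exact: mkapx.
  rewrite (eq_integral (fun w => (kap (p, w))%:E)); first by rewrite ltey_eq Ap.
  by move=> w _; rewrite gee0_abs// lee_fin.
have iH i : P.-integrable setT (fun w => (H i (p, w))%:E).
  apply: (le_integrable measurableT (mHx i p) _ (integrableZl measurableT (2 * r) ik)).
  move=> w _; rewrite -EFinM !abse_EFin lee_fin.
  by apply: le_trans (H_le i (p, w)) _; exact: ler_norm.
transitivity (\int[P]_w \sum_i ((H i (p, w))%:E * (partial i phi p)%:E))%E; last first.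
  by apply: eq_integral => w _; rewrite /K -sumEFin; apply: eq_bigr => i _; rewrite EFinM.
rewrite integral_sum//; last by move=> i; apply: (integrableZr measurableT _ (iH i)).
rewrite /dotp -sumEFin; apply: eq_bigr => i _.
rewrite (integralZr measurableT (iH i)) EFinM [v _ _ _]mxE [grad _ _ _ _]mxE fineK//.
exact: integrable_fin_num.
Qed.

Let J (w : W) (z : E) : R := gate w * (chi z *
  dotp (w.1.2 - w.1.1 + z) (grad phi (w.1.1 + w.2 *: (w.1.2 - w.1.1 + z)))).

(* from positions p back to errors of aim z *)
Let K_subst w : (\int[m_n]_p (K (p, w))%:E = \int[m_n]_z (J w z)%:E)%E.
Proof.
have [gw|[gw _ w0 _]] := gate_cases w.
  rewrite !integral0_eq// => [z _|p _]; first by rewrite /J gw mul0r.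
  suff -> : K (p, w) = 0 by [].
  apply/eqP; rewrite -normr_le0 (le_trans (K_le _))//.
  by rewrite /kap/= gw !mul0r mulr0.
rewrite (integral_affine (foot w) w0).
  apply: eq_integral => z _; congr _%:E.
  rewrite /K mulr_sumr /J /dotp !mulr_sumr; apply: eq_bigr => i _.
  transitivity (w.2 ^+ n * kap (foot w + w.2 *: z, w) *
      (vel (foot w + w.2 *: z) w ord0 i * partial i phi (foot w + w.2 *: z))).
    by rewrite /H -!mulrA.
  by rewrite kap_foot// vel_foot// -foot_sub [grad _ _ _ _]mxE -mulrA.
pose V := (fine (m_n (eball r)))^-1.
apply: (@bounded_vanishing_integrable _ _ _ _ (M * (inv w.2 ^+ n * V)) 0 s).
- exact: locally_finite_lebesgue.
- by apply: measurableT_comp mK _; exact: measurable_fun_pair.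
- move=> p; rewrite (le_trans (K_le _))// ler_wpM2l// /kap/= gw mul1r -[leRHS]mulr1.
  apply: ler_pM => //.
    by rewrite mulr_ge0// exprn_ge0// expR_ge0.
  by rewrite ler_wpM2l ?exprn_ge0 ?expR_ge0// chi_le.
- by move=> p ps; apply: K_off; rewrite -[p]subr0.
Qed.

Let J_le x y t z : `|J ((x, y), t) z| <= M * (\1_(`]0%R, 1%R]%classic : set R) t * chi z).
Proof.
rewrite /J; have [->|[-> xy t0 t1]] := gate_cases ((x, y), t).
  by rewrite mul0r normr0 mulr_ge0// mulr_ge0.
rewrite mul1r indicE mem_set ?mul1r; last by rewrite /= in_itv/= t0 t1.
have [zr|/chi_off->] := leP `|z| r; last by rewrite mul0r mulr0 normr0.
rewrite normrM (ger0_norm (chi0 z)) mulrC ler_wpM2r//.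
rewrite (le_trans (ler_norm_sum _ _ _))//; apply: ler_sum => i _.
rewrite normrM [grad _ _ _ _]mxE; apply: ler_pM => //.
rewrite (le_trans (coord_le_norm _ i))// (le_trans (ler_normD _ _))//.
by rewrite mulr2n mulrDl mul1r lerD// distrC.
Qed.

Let mJ : measurable_fun setT (fun q : W * E => J q.1 q.2).
Proof.
have mx : measurable_fun setT (fun q : W * E => q.1.1.1).
  by do 2!apply: measurableT_comp measurable_fst _; exact: measurable_fst.
have my : measurable_fun setT (fun q : W * E => q.1.1.2).
  apply: measurableT_comp measurable_snd _.
  by apply: measurableT_comp measurable_fst _; exact: measurable_fst.
have ms : measurable_fun setT (fun q : W * E => q.1.2 : R).
  by apply: measurableT_comp measurable_snd _; exact: measurable_fst.
have mh : measurable_fun setT (fun q : W * E => q.1.1.2 - q.1.1.1 + q.2).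
  by apply: measurable_rVD => //; exact: measurable_rVB.
apply: measurable_funM; first exact: measurableT_comp mgate measurable_fst.
apply: measurable_funM; first exact: measurableT_comp mchi measurable_snd.
apply: measurable_sum => i; apply: measurable_funM.
  exact: measurableT_comp (measurable_coord_rV i) mh.
under eq_fun do rewrite mxE; apply: measurableT_comp (mdphi i) _.
by apply: measurable_rVD => //; exact: measurable_rVZ.
Qed.

(* averaging over z the variation of phi along the segment from x to y + z *)
Let segment_average (x y : E) :
  (\int[lam]_t \int[m_n]_z (J ((x, y), t) z)%:E =
   (\1_D (x, y) * (smoothing chi phi y - phi x))%:E)%E.
Proof.
have [B B0 phiB] := continuous_vanishing_bounded (smooth_continuous sphi) phi0.
have mphi : measurable_fun setT phi by exact: smooth_measurable.
pose I01 : R -> R := \1_(`]0%R, 1%R]%classic : set R).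
have mI01 : measurable_fun setT I01 by exact: measurable_indic.
have II01 : (\int[lam]_t (I01 t)%:E = 1)%E.
  rewrite integral_indic// setIT [LHS](lebesgue_measure_itv `]0%R, 1%R])/=.
  by rewrite lte_fin ltr01 sube0.
have iI01 : lam.-integrable setT (EFin \o I01).
  apply: finite_integrable_indic => //.
  by rewrite [X in (X < _)%E](lebesgue_measure_itv `]0%R, 1%R])/= lte_fin ltr01 sube0 ltry.
pose Q (p : measurableTypeR R * E) : \bar R := (J ((x, y), p.1) p.2)%:E.
have mQ : measurable_fun setT Q.
  apply/measurable_EFinP.
  have mp : measurable_fun setT (fun p : measurableTypeR R * E => (((x, y), p.1), p.2) : W * E).
    by apply: measurable_fun_pair => //; apply: measurable_fun_pair.
  exact: (measurableT_comp mJ mp).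
have iQ : (lam \x m_n)%E.-integrable setT Q.
  apply/integrable12ltyP => //.
  apply: (@le_lt_trans _ _ (\int[lam]_t (M * I01 t)%:E)%E); last first.
    under eq_integral do rewrite EFinM.
    by rewrite (integralZl measurableT iI01) II01 mule1 ltry.
  apply: ge0_le_integral => //.
  - by move=> t _; exact: integral_ge0.
  - apply: (measurable_fun_fubini_tonelli_F (abse \o Q)).
      exact: measurableT_comp.
    by move=> q; exact: abse_ge0.
  - by apply/measurable_EFinP; exact: measurable_funM.
  move=> t _; have MI : (0 <= (M * I01 t)%:E)%E by rewrite lee_fin mulr_ge0.
  rewrite -[leRHS]mule1 -Ichi -ge0_integralZl//; last 2 first.
  - by apply/measurable_EFinP; exact: mchi.
  - by move=> z _; rewrite lee_fin.
  apply: ge0_le_integral => //.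
  - apply: measurableT_comp => //; apply: measurableT_comp mQ _; exact: measurable_fun_pair.
  - by apply: emeasurable_funM => //; apply/measurable_EFinP; exact: mchi.
  - by move=> z _; rewrite -EFinM abse_EFin lee_fin -mulrA J_le.
rewrite [LHS](Fubini iQ).
have along z : (\int[lam]_t Q (t, z) =
    (\1_D (x, y) * (chi z * phi (y + z) - chi z * phi x))%:E)%E.
  pose h := y - x + z.
  have QE t : Q (t, z) = ((\1_D (x, y) * chi z)%:E *
      ((fun t => (dotp h (grad phi (x + t *: h)))%:E) \_ (`]0%R, 1%R]%classic : set R)) t)%E.
    rewrite /Q /J /gate patchE /= -/h !indicE.
    case: ifPn => _; first by rewrite mulr1 -EFinM mulrA.
    by rewrite mulr0 mul0r; apply/esym; exact: mule0.
  under eq_integral do rewrite QE.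
  rewrite integralZl//; last first.
    pose N := \sum_i `|h ord0 i| * C.
    have N0 : 0 <= N by apply: sumr_ge0 => i _; rewrite mulr_ge0 ?(C0 i).
    have md : measurable_fun setT (fun t : R => dotp h (grad phi (x + t *: h))).
      apply: measurable_sum => i; apply: measurable_funM => //.
      under eq_fun do rewrite mxE; apply: measurableT_comp (mdphi i) _.
      by apply: measurable_rVD => //; exact: measurable_rVZ.
    apply: (le_integrable measurableT _ _ (integrableZl measurableT N iI01)).
      apply/(measurable_restrictT _ (measurable_itv _)).
      by apply: measurable_funTS; exact/measurable_EFinP.
    move=> t _; rewrite patchE -EFinM [leRHS]abse_EFin /I01 indicE.
    case: ifPn => _; last by rewrite mulr0 normr0 abse0.
    rewrite mulr1 abse_EFin lee_fin (ger0_norm N0).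
    apply: le_trans (ler_norm_sum _ _ _) _; apply: ler_sum => i _.
    by rewrite normrM [grad _ _ _ _]mxE ler_wpM2l.
  rewrite -integral_mkcond integral_along_segment// -EFinM /h addrA.
  by rewrite [x + (y - x)]addrC subrK -mulrA mulrBr.
under eq_integral do rewrite along EFinM.
have i1 := smoothing_integrable ichi y mphi phiB.
have i2 : m_n.-integrable setT (fun z => (chi z * phi x)%:E).
  by under eq_fun do rewrite EFinM; exact: integrableZr.
rewrite integralZl//; last first.
  by under eq_fun do rewrite EFinB; exact: integrableB.
rewrite [RHS]EFinM; congr (_ * _)%E; under eq_integral do rewrite EFinB.
rewrite integralB// EFinB; congr (_ - _)%E.
  by rewrite EFin_Rintegral.
under eq_integral do rewrite EFinM.
by rewrite (integralZr measurableT ichi) Ichi mul1e.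
Qed.

Let test_gamma : (\int[m_n]_p (dotp (v p) (grad phi p))%:E =
  \int[gamma]_z (smoothing chi phi z.2 - phi z.1)%:E)%E.
Proof.
rewrite test_v (Fubini iK).
have iG : P.-integrable setT (fun w => \int[m_n]_p (K (p, w))%:E)%E.
  exact: integrable_first_integral iK.
rewrite (product_measure_fubini iG).
have cphi := smooth_continuous sphi.
have mphi : measurable_fun setT phi by exact: smooth_measurable.
have mpsi : measurable_fun setT (smoothing chi phi).
  apply: continuous_measurable_rV.
  exact: (continuous_smoothing ichi sphi phi0).
have mF : measurable_fun setT (fun z : E * E => (smoothing chi phi z.2 - phi z.1)%:E).
  apply/measurable_EFinP; apply: measurable_funB.
    exact: measurableT_comp mpsi measurable_snd.
  exact: measurableT_comp mphi measurable_fst.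
transitivity (\int[gamma]_z (\1_D z * (smoothing chi phi z.2 - phi z.1))%:E)%E.
  apply: eq_integral => -[x y] _; rewrite -segment_average.
  by apply: eq_integral => t _; rewrite K_subst.
apply: ae_eq_integral => //.
  under eq_fun do rewrite EFinM; apply: emeasurable_funM => //.
  by apply/measurable_EFinP; exact: measurable_indic.
exists (~` D); split => //; first exact: measurableC.
move=> z /= /not_implyP[_]; apply: contra_not => Dz.
by rewrite indicE mem_set// mul1r.
Qed.

(* the marginal identity for the absolute value of f bounds the integral *)
Let integrable_marginal (mu : {measure set E -> \bar R}) (f : E -> R) (g : E * E -> E) a b :
  measurable_fun setT g ->
  locally_finite mu -> 
  (forall h, continuous h -> compactly_supported h ->
    (\int[gamma]_z (h (g z))%:E = \int[mu]_x (h x)%:E)%E) ->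
  continuous f -> vanishes_off a b f ->
  gamma.-integrable setT (fun z => (f (g z))%:E).
Proof.
move=> mg lfmu gh cf f0.
have mf : measurable_fun setT f by exact: continuous_measurable_rV.
have [B B0 fB] := continuous_vanishing_bounded cf f0.
apply/integrableP; split; first by apply/measurable_EFinP; exact: measurableT_comp mf mg.
rewrite (eq_integral (fun z => (`|f (g z)|)%:E))//.
rewrite (gh (fun x => `|f x|)).
- have := integrable_lty measurableT (integrable_abse (bounded_vanishing_integrable lfmu mf fB f0)).
  by [].
- by move=> x; apply: continuous_comp; [exact: cf|exact: norm_continuous].
- by apply: (@vanishes_off_compact _ _ a b) => x /f0->; rewrite normr0.
Qed.

(** The aiming errors are invisible in the end: they replace [phi] at the end
    point [y] by [smoothing chi phi], which has the same integral with respect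
    to the second marginal. *)
Lemma test_plan_field : (\int[m_n]_p (dotp (v p) (grad phi p))%:E =
  - (\int[nu]_x (phi x)%:E - \int[m_n]_x (phi x)%:E))%E.
Proof.
rewrite test_gamma; have [_ g1 g2] := gT.
have cphi := smooth_continuous sphi.
have mphi : measurable_fun setT phi by exact: smooth_measurable.
have cpsi : continuous (smoothing chi phi) by exact: (continuous_smoothing ichi sphi phi0).
have psi0 : vanishes_off 0 (s + r) (smoothing chi phi).
  by apply: smoothing_vanishes => //; exact: chi_vanishes.
have [B B0 phiB] := continuous_vanishing_bounded cphi phi0.
have i1 := integrable_marginal measurable_fst nu_lf g1 cphi phi0.
have i2 := integrable_marginal measurable_snd (@locally_finite_lebesgue R n) g2 cpsi psi0.
under eq_integral do rewrite EFinB.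
rewrite integralB// g2//; last exact: vanishes_off_compact psi0.
rewrite g1//; last exact: vanishes_off_compact phi0.
have im := bounded_vanishing_integrable (@locally_finite_lebesgue R n) mphi phiB phi0.
rewrite (integral_smoothing_integrable r0 mphi phiB im).
have in_ := bounded_vanishing_integrable nu_lf mphi phiB phi0.
have f1 := integrable_fin_num measurableT im.
have f2 := integrable_fin_num measurableT in_.
by rewrite fin_num_oppeB// addeC.
Qed.

End testing.

Let v_norm_le p : ((`|v p|)%:E <= (2 * r)%:E * A p)%E.
Proof.
have r2 : 0 < 2 * r by rewrite mulr_gt0.
case Ap : (A p) (A0 p) => [a| |//] a0; last by rewrite gt0_muley ?lte_fin// leey.
rewrite -EFinM lee_fin; rewrite lee_fin in a0.
apply: norm_le_coord => [|i]; first by rewrite mulr_ge0// ltW.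
by have := v_le i p; rewrite Ap.
Qed.

Let plan_field_locally_integrable : locally_integrable_field v.
Proof.
split; first exact: mv.
move=> i K cK; have [s s0 Ks] := bounded_subset_box (compact_bounded cK).
have mvi : measurable_fun setT (fun x => (v x ord0 i)%:E).
  by apply/measurable_EFinP; exact: measurableT_comp (measurable_coord_rV i) mv.
suff : m_n.-integrable (box 0 s) (fun x => (v x ord0 i)%:E).
  apply: integrableS => //; first exact: measurable_box.
  by apply: closed_measurable_rV; apply: compact_closed cK; exact: norm_hausdorff.
apply/(integrable_mkcond _ (measurable_box 0 s)).
apply: (le_integrable measurableT _ _ (integrableZl measurableT (2 * r) (iA 0 s0))).
  apply/(measurable_restrictT _ (measurable_box 0 s)); exact: measurable_funTS.
move=> x _; rewrite patchE indicE; case: ifPn => _; last first.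
  by rewrite mule0 mule0 [leLHS]abse0.
rewrite mule1 [leRHS]gee0_abs ?abse_EFin ?v_le//.
by rewrite mule_ge0// lee_fin mulr_ge0// ltW.
Qed.

Let plan_field_connects : connects v nu.
Proof.
move=> phi sphi /compactly_supported_vanishes[s s0 phi0].
have [C _ Cphi] := smooth_bounded_partials sphi phi0.
exact: (@test_plan_field phi s C).
Qed.

Let Ra_tilde_plan_field :
  (Ra_tilde v <= ((1 + 2 * n%:R * (16 * n.+1%:R) ^+ n) * r)%:E)%E.
Proof.
pose N := 2 * n%:R * (16 * n.+1%:R) ^+ n * r.
apply: (@le_trans _ _ (r%:E + sup_norm (Defs.conv (@enorm R n \o v) chi))%E).
  by apply: ereal_inf_lbound; exists r.
rewrite mulrDl mul1r EFinD leeD2l//.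
apply: ge_ereal_sup => _ [q _ <-].
have conv_ge0 : 0 <= Defs.conv (@enorm R n \o v) chi q.
  by apply: Rintegral_ge0 => y _; rewrite mulr_ge0 ?chi_ge0// sqrtr_ge0.
rewrite ger0_norm//.
pose V := fine (m_n (eball r)).
have V0 : 0 < V by exact: eball_volume_gt0.
have fle (x : \bar R) : (0 <= x -> (fine x)%:E <= x)%E by case: x.
apply: le_trans (fle _ _) _; first by apply: integral_ge0 => y _; rewrite lee_fin mulr_ge0 ?chi_ge0// sqrtr_ge0.
pose c := V^-1 * (n%:R * (2 * r)).
have c0 : 0 <= c by rewrite mulr_ge0 ?invr_ge0 ?(ltW V0)// mulr_ge0// mulr_ge0// ltW.
apply: (@le_trans _ _ (\int[m_n]_y (c%:E * (A y * (\1_(box q r) y)%:E)))%E).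
  apply: ge0_le_integral => //.
  - by move=> y _; rewrite lee_fin mulr_ge0 ?chi_ge0// sqrtr_ge0.
  - apply/measurable_EFinP; apply: measurable_funM.
      exact: measurableT_comp (@measurable_enorm R n) mv.
    by apply: measurableT_comp mchi _; exact: measurable_rVB.
  - by apply: emeasurable_funM => //; exact: measurable_int (iA q r0).
  move=> y _; rewrite indicE.
  have [yq|yq] := leP `|y - q| r; last first.
    by rewrite chi_off ?mulr0 ?mule_ge0 ?lee_fin// distrC.
  have cE : c%:E = ((V^-1)%:E * (n%:R%:E * (2 * r)%:E))%E by rewrite -!EFinM.
  rewrite mem_set// mule1 cE -!muleA [X in (X%:E <= _)%E]mulrC EFinM.
  apply: lee_pmul; rewrite ?lee_fin ?chi_ge0 ?sqrtr_ge0 ?chi_le//.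
  apply: (@le_trans _ _ (n%:R * `|v y|)%:E).
    by rewrite lee_fin enorm_le_norm.
  by rewrite EFinM lee_pmul ?lee_fin// v_norm_le.
rewrite ge0_integralZl//; last 2 first.
- exact: measurable_int (iA q r0).
- by move=> y _; rewrite mule_ge0// lee_fin.
apply: le_trans (lee_pmul _ _ (lexx _) (A_box q r0)) _ => //.
  by apply: integral_ge0 => y _; rewrite mule_ge0// lee_fin.
rewrite -EFinM lee_fin /c.
rewrite -[leLHS]mulrA ler_pdivrMl// [leRHS]mulrC.
have rV : (r / n.+1%:R) ^+ n <= V.
  by rewrite -lee_fin fineK ?eball_lebesgue_ge// ge0_fin_numE//; exact: eball_lebesgue_lty.
have b0 : 0 <= 2 * n%:R * (16 * n.+1%:R) ^+ n * r.
  by rewrite mulr_ge0 ?(ltW r0)// mulr_ge0// exprn_ge0.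
apply: le_trans (ler_wpM2l b0 rV).
rewrite (_ : 4 * (r + 3 * r) = 16 * n.+1%:R * (r / n.+1%:R)); last first.
  by rewrite mulrA mulrAC mulfK ?pnatr_eq0//; ring.
rewrite exprMn; move: (_ ^+ n) (_ ^+ n) => a b.
by rewrite le_eqVlt; apply/orP; left; apply/eqP; ring.
Qed.

(** The field is the momentum density of particles moving with constant velocity
    from [x] to [y + z], where [(x, y)] is distributed according to [gamma] and
    the small random [z] spreads the segments into a field with a density.
    Speeds are at most [2 * r], and the particles that visit a given box of
    radius [r] are aimed at points [y] of a box of radius [4 * r]. *)
Lemma exists_field_of_plan : exists2 u : E -> E, connecting_fields nu u &
  (Ra_tilde u <= ((1 + 2 * n%:R * (16 * n.+1%:R) ^+ n) * r)%:E)%E.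
Proof.
exists v; last exact: Ra_tilde_plan_field.
by split; [exact: plan_field_locally_integrable|exact: plan_field_connects].
Qed.

End plan_to_field.

(** * The theorem *)


(** A transportation whose support has displacements at most [t] gives full mass
    to the pairs at distance at most [t + e]; the margin [e] is there because
    [exists_field_of_plan] requires a positive radius. *)
Lemma Tra_lower_bound (R : realType) n : exists2 c : R, 0 < c &
  forall nu : {measure set 'rV[R]_n -> \bar R}, locally_finite nu ->
    (c%:E * ereal_inf [set Ra_tilde v | v in connecting_fields nu] <= Tra nu)%E.
Proof.
pose K : R := 1 + 2 * n%:R * (16 * n.+1%:R) ^+ n.
have K0 : 0 < K.
  by rewrite ltr_wpDr// mulr_ge0// exprn_ge0// mulr_ge0.
exists K^-1; first by rewrite invr_gt0.
move=> nu lf; apply: le_ereal_inf_tmp => _ [gamma gT <-].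
set S : \bar R := maxe _ _.
have S0 : (0 <= S)%E by rewrite /S le_max lexx.
case SE : S S0 => [t| |] //; last by move=> _; exact: leey.
rewrite lee_fin => t0.
have norm_le (z : 'rV[R]_n * 'rV[R]_n) : spt gamma z -> `|z.1 - z.2| <= t.
  move=> zs; apply: le_trans (norm_le_enorm _) _; rewrite -lee_fin -SE /S le_max.
  by apply/orP; right; apply: ereal_sup_ubound; exists z.
apply/lee_addgt0Pr => e e0.
rewrite muleC lee_pdivrMr// -EFinD -EFinM.
have te0 : 0 < t + e by rewrite ltr_wpDl.
pose D : set ('rV[R]_n * 'rV[R]_n) := [set z | `|z.1 - z.2| <= t + e].
have gD : gamma (~` D) = 0%E.
  apply: null_off_support => [|z Dz /norm_le zt]; last first.
    by apply: Dz; rewrite /D/= (le_trans zt)// lerDl ltW.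
  apply: closed_openC.
  apply: (@preimage_closed _ _ (fun z : 'rV[R]_n * 'rV[R]_n => `|z.1 - z.2|) [set x | x <= t + e]).
    move=> z _; apply: (@continuous_comp _ _ _ (fun z : 'rV[R]_n * 'rV[R]_n => z.1 - z.2) Num.norm).
      by apply: continuousB; [exact: cvg_fst|exact: cvg_snd].
    exact: norm_continuous.
  exact: closed_le.
pose gamma' := as_sigma_finite (transportation_sigma_finite gT).
have [v vnu vr] := @exists_field_of_plan R n nu gamma' (t + e) lf gT te0 gD.
apply: (@le_trans _ _ (Ra_tilde v)).
  by apply: ereal_inf_lbound; exists v.
by rewrite [X in (_ <= X%:E)%E]mulrC.
Qed.

Theorem theorem1p4 (R : realType) (d : nat) (d_gt0 : (1 <= d)%N) :
  exists c C : R, [/\ 0 < c, 0 < C &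
    forall nu : {measure set 'rV[R]_d -> \bar R}, locally_finite nu ->
      (c%:E * ereal_inf [set Ra_tilde v | v in connecting_fields nu] <= Tra nu)%E
      /\ (Tra nu <= C%:E * ereal_inf [set Ra v | v in connecting_fields nu])%E].
Proof.
have [c c0 lower] := Tra_lower_bound R d; have [C C0 upper] := Tra_upper_bound R d.
by exists c, C; split => // nu lf; split; [exact: lower|exact: upper].
Qed.
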